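(* Let $d$ be a real number such that $|d|>1$. Let $\Phi=\{\varphi^1,\dots,\varphi^r\}$, $\Psi=\{\psi^1,\dots,\psi^s\}$, $\tilde\Phi=\{\tilde\varphi^1,\dots,\tilde\varphi^r\}$, $\tilde\Psi=\{\tilde\psi^1,\dots,\tilde\psi^s\}$ be subsets of $L_2^{loc}(\mathbb R)$. Then $(FWS_J(\Phi;\Psi),FWS_J(\tilde\Phi;\tilde\Psi))$ forms a pair of frequency-based nonhomogeneous dual wavelet frames in the distribution space $\mathscr D'(\mathbb R)$ for some integer $J$ (or, equivalently, for all integers $J$) if and only if $$\lim_{j\to+\infty}\sum_{\ell=1}^r\overline{\varphi^\ell(d^{-j}\cdot)}\,\tilde\varphi^\ell(d^{-j}\cdot)=1\quad\text{in the sense of distributions}$$ and the following hold: $$\sum_{\ell=1}^r\overline{\varphi^\ell(\xi)}\tilde\varphi^\ell(\xi+2\pi k)+\sum_{\ell=1}^s\overline{\psi^\ell(\xi)}\tilde\psi^\ell(\xi+2\pi k)=\sum_{\ell=1}^r\overline{\varphi^\ell(d^{-1}\xi)}\tilde\varphi^\ell(d^{-1}(\xi+2\pi k)),\quad\text{a.e. }\xi\in\mathbb R,\ \forall k\in\mathbb Z\cap d\mathbb Z,$$ $$\sum_{\ell=1}^r\overline{\varphi^\ell(\xi)}\tilde\varphi^\ell(\xi+2\pi k)+\sum_{\ell=1}^s\overline{\psi^\ell(\xi)}\tilde\psi^\ell(\xi+2\pi k)=0,\quad\text{a.e. }\xi\in\mathbb R,\ \forall k\in\mathbb Z\setminus d\mathbb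 Z,$$ $$\sum_{\ell=1}^r\overline{\varphi^\ell(\xi)}\tilde\varphi^\ell(\xi+2\pi d^{-1}k)=0,\quad\text{a.e. }\xi\in\mathbb R,\ \forall k\in d\mathbb Z\setminus\mathbb Z.$$
   Context: $d\mathbb Z:=\{dk:k\in\mathbb Z\}$. $\mathscr D(\mathbb R)$ is the space of compactly supported $C^\infty$ functions $\mathbb R\to\mathbb C$ and $\mathscr D'(\mathbb R)$ is its dual. $L_2^{loc}(\mathbb R)$ is the space of measurable functions $f:\mathbb R\to\mathbb C$ with $\int_K|f|^2<\infty$ for every compact $K\subset\mathbb R$. Pairing: $\langle f,g\rangle=\int_{\mathbb R}f(\xi)\overline{g(\xi)}\,d\xi$ whenever one of $f,g$ is in $\mathscr D(\mathbb R)$ and the other is locally integrable. $F_j\to1$ in the sense of distributions means $\langle F_j,f\rangle\to\langle1,f\rangle$ for all $f\in\mathscr D(\mathbb R)$. For $\lambda\in\mathbb R\setminus\{0\}$ and $k\in\mathbb R$, $f_{\lambda;0,k}(\xi):=|\lambda|^{1/2}e^{-ik\lambda\xi}f(\lambda\xi)$. ''Sets'' of generators are finite families whose elements need not be distinct; sums run over them with multiplicity. For an integer $J$, $$FWS_J(\Phi;\Psi):=\{\varphi_{d^{-J};0,k}:k\in\mathbb Z,\varphi\in\Phi\}\cup\{\psi_{d^{-j};0,k}:j\ge J,k\in\mathbb Z,\psi\in\Psi\}.$$ The pair $(FWS_J(\Phi;\Psi),FWS_J(\tilde\Phi;\tilde\Psi))$ forms a pair of frequency-based nonhomogeneous dual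 wavelet frames in $\mathscr D'(\mathbb R)$ if for all $f,g\in\mathscr D(\mathbb R)$: (1) the series $\sum_{k\in\mathbb Z}\langle f,\varphi^\ell_{d^{-J};0,k}\rangle\langle\tilde\varphi^\ell_{d^{-J};0,k},g\rangle$ and $\sum_{k\in\mathbb Z}\langle f,\psi^{\ell'}_{d^{-j};0,k}\rangle\langle\tilde\psi^{\ell'}_{d^{-j};0,k},g\rangle$ converge absolutely for all $j\ge J$, $1\le\ell\le r$, $1\le\ell'\le s$; and (2) the following limit exists and satisfies $$\lim_{J'\to+\infty}\Big(\sum_{\ell=1}^r\sum_{k\in\mathbb Z}\langle f,\varphi^\ell_{d^{-J};0,k}\rangle\langle\tilde\varphi^\ell_{d^{-J};0,k},g\rangle+\sum_{j=J}^{J'-1}\sum_{\ell=1}^s\sum_{k\in\mathbb Z}\langle f,\psi^\ell_{d^{-j};0,k}\rangle\langle\tilde\psi^\ell_{d^{-j};0,k},g\rangle\Big)=2\pi\langle f,g\rangle.$$ *)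

(* Defs.v *)
From HB Require Import structures.
From mathcomp Require Import all_boot all_order all_algebra.
From mathcomp Require Import complex.
From mathcomp Require Import all_classical all_reals all_analysis.

Set Implicit Arguments.
Unset Strict Implicit.
Unset Printing Implicit Defensive.

Import Order.TTheory GRing.Theory Num.Theory numFieldNormedType.Exports.

Local Open Scope classical_set_scope.
Local Open Scope ring_scope.
Local Open Scope complex_scope.

(* The topology on complex numbers is that of the regular module R[i]^o, i.e.
   the one given by the modulus.  Measurability, integrals and "a.e." refer to
   the completed Lebesgue measure, so that "measurable" means Lebesgue (not only
   Borel) measurable. *)

Section Functions.
Context {R : realType}.
Implicit Types (f g : R -> R[i]) (u : int -> R[i]).

(* The carrier R with the Lebesgue sigma-algebra (Caratheodory measurable sets
   of the outer Lebesgue measure): the domain of completed_lebesgue_measure. *)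
Definition lebesgueTypeR := caratheodory_type ((@wlength R idfun)^*)%mu.

Definition cabs (z : R[i]) : R := complex.Re `|z|.

Definition cexpi (t : R) : R[i] := cos t +i* sin t.

Definition cmeasurable f :=
  measurable_fun [set: lebesgueTypeR] (fun x => complex.Re (f x)) /\
  measurable_fun [set: lebesgueTypeR] (fun x => complex.Im (f x)).

Definition L2loc f :=
  cmeasurable f /\
  forall K : set R, compact K ->
    (\int[completed_lebesgue_measure]_(x in K) (cabs (f x) ^+ 2)%:E < +oo)%E.

Definition rsmooth (h : R -> R) :=
  forall (n : nat) (x : R), derivable (derive1n n h) x 1.

Definition test_function f :=
  [/\ rsmooth (fun x => complex.Re (f x)),
      rsmooth (fun x => complex.Im (f x)) &
      compact (closure [set x | f x != 0])].

Definition cintegral f : R[i] :=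
  (\int[completed_lebesgue_measure]_x complex.Re (f x))%R +i*
  (\int[completed_lebesgue_measure]_x complex.Im (f x))%R.

Definition pairing f g : R[i] := cintegral (fun x => f x * (g x)^*).

Definition distr_cvg (F : nat -> R -> R[i]) (G : R -> R[i]) :=
  forall f, test_function f ->
    (fun n => pairing (F n) f : R[i]^o) @ \oo --> (pairing G f : R[i]^o).

(* f_{lam;0,k}(xi) = |lam|^(1/2) e^(-i k lam xi) f(lam xi) *)
Definition fdil (lam k : R) f : R -> R[i] := fun xi =>
  (Num.sqrt `|lam|)%:C * cexpi (- (k * lam * xi)) * f (lam * xi).

Definition abs_summable u := summable [set: int] (fun k => (cabs (u k))%:E).

(* The sum over all integers, split as nonnegative plus negative indices
   (Negz n is -(n + 1)); it is only used for absolutely convergent series. *)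
Definition csumZ u : R[i] :=
  limn (series (fun n : nat => u (Posz n) : R[i]^o)) +
  limn (series (fun n : nat => u (Negz n) : R[i]^o)).

Definition setZ : set R := range (fun k : int => k%:~R).

Definition dsetZ (d : R) : set R := [set d * x | x in setZ].

End Functions.

Section Frames.
Context {R : realType} (d : R) (r s : nat).
Variables (phi : 'I_r -> R -> R[i]) (psi : 'I_s -> R -> R[i]).
Variables (phit : 'I_r -> R -> R[i]) (psit : 'I_s -> R -> R[i]).

(* The k-th term <f, eta_{d^-j;0,k}> <etat_{d^-j;0,k}, g>. *)
Definition frame_term (j : int) (eta etat f g : R -> R[i]) (k : int) : R[i] :=
  pairing f (fdil (d ^ (- j)) k%:~R eta) *
  pairing (fdil (d ^ (- j)) k%:~R etat) g.

(* The index n stands for J' - J, so that i < n corresponds to the scales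
   J <= J + i <= J' - 1. *)
Definition frame_partial_sum (J : int) (f g : R -> R[i]) (n : nat) : R[i] :=
  \sum_(l < r) csumZ (frame_term J (phi l) (phit l) f g) +
  \sum_(i < n) \sum_(l < s)
    csumZ (frame_term (J + i%:Z) (psi l) (psit l) f g).

(* The property is stated on the indexed families of generators rather than on
   the sets FWS_J they generate: the sums run with multiplicity and rely on the
   matching of phi l with phit l and of psi l with psit l. *)
Definition dual_wavelet_frames (J : int) :=
  forall f g, test_function f -> test_function g ->
  [/\ forall l : 'I_r, abs_summable (frame_term J (phi l) (phit l) f g),
      forall (j : int) (l : 'I_s), J <= j ->
        abs_summable (frame_term j (psi l) (psit l) f g) &
      (fun n => frame_partial_sum J f g n : R[i]^o) @ \oo -->
        ((2 * pi)%:C * pairing f g : R[i]^o)].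

End Frames.

(* Main.v *)
Require Import Defs.
From mathcomp Require Import all_boot all_order all_algebra.
From mathcomp Require Import complex zify ring lra.
From mathcomp Require Import all_classical all_reals all_analysis measurable_realfun.

Set Implicit Arguments.
Unset Strict Implicit.
Unset Printing Implicit Defensive.

Import Order.TTheory GRing.Theory Num.Theory numFieldNormedType.Exports.

Local Open Scope classical_set_scope.
Local Open Scope ring_scope.
Local Open Scope complex_scope.

(** Fix test functions [f] and [g], and let [A_j] and [B_j] be the sums of the
    terms of the expansion at the scale [j] over the shifts [k] and over the
    generators [phi], respectively [psi].  The change of variables
    [x -> d^j x] turns the inner products of a scale into values at the
    integers of Fourier transforms of compactly supported square-integrable
    functions.  These values are the Fourier coefficients of periodizations, so
    that Parseval's identity on one period, followed by the unfolding of a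
    periodization, yields ([parseval_line], [level_gram])

      A_j = 2 pi sum_k int f(x) conj(g(x + 2 pi d^j k)) Phi_k(d^-j x) dx,

    where [Phi_k(x)] is the sum over the generators of
    [conj(phi(x)) phit(x + 2 pi k)].  The sum is finite because the supports of
    [f] and of the translate of [g] are disjoint for large [k]; absolute
    convergence of the series holds for all locally square-integrable
    generators, by Bessel's inequality.

    Dilating [f] and [g] by [d^m] moves the scale by [m], so the frame property
    is the same at all scales ([frames_any_scale]).  Comparing the expansions
    that start at the scales 0 and 1 shows that it amounts to two facts
    ([framesP]): [A_0 + B_0 = A_1] for all test functions, which makes the
    partial sums telescope, and the convergence of [A_n] to [2 pi <f, g>].

    For large [n] only the shift [k = 0] survives in [A_n], which becomes the
    pairing of [Phi_0(d^-n x)] with the test function [conj(f) g]; every test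
    function is of this form, so the second fact is the convergence in the sense
    of distributions ([approximation_identityP]).

    The difference [A_0 + B_0 - A_1] is [2 pi] times a finite sum of integrals
    of [f(x) conj(g(x + 2 pi t))] against a kernel, over the real numbers [t]
    that are integers or integer multiples of [d] ([refinement_defect]).
    A kernel vanishes almost everywhere for every [t] exactly when the three
    families of equations hold, according to whether [t] lies in both lattices
    or in one of them ([refinement_kernelP]).  If the kernels vanish then so
    does the difference.  Conversely, each [t] is isolated in the union of the
    two lattices, so test functions with small supports, [g] living near the
    translate of [f] by [2 pi t], isolate one kernel ([kernel_of_refinement]),
    and a locally integrable function whose integrals against test functions
    with small supports vanish is zero ([ae_zero_of_local_integrals]). *)

(** * Complex numbers and sums over the integers *)

Section ComplexAlgebra.
Context {R : realType}.
Implicit Types (x y z : R[i]) (a b t : R).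
Local Notation Re := complex.Re.
Local Notation Im := complex.Im.

Lemma complexP z w : Re z = Re w -> Im z = Im w -> z = w.
Proof. by case: z; case: w => ? ? ? ? /= -> ->. Qed.

Lemma ReD z w : Re (z + w) = Re z + Re w. Proof. by case: z; case: w. Qed.
Lemma ImD z w : Im (z + w) = Im z + Im w. Proof. by case: z; case: w. Qed.
Lemma ReN z : Re (- z) = - Re z. Proof. by case: z. Qed.
Lemma ImN z : Im (- z) = - Im z. Proof. by case: z. Qed.
Lemma ReB z w : Re (z - w) = Re z - Re w. Proof. by case: z; case: w. Qed.
Lemma ImB z w : Im (z - w) = Im z - Im w. Proof. by case: z; case: w. Qed.
Lemma ReM z w : Re (z * w) = Re z * Re w - Im z * Im w.
Proof. by case: z; case: w. Qed.
Lemma ImM z w : Im (z * w) = Re z * Im w + Im z * Re w.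
Proof. by case: z => a b; case: w => c d. Qed.
Lemma conjcE z : (z^*)%R = conjc z. Proof. by []. Qed.
Lemma ReJ z : Re (z^*)%R = Re z. Proof. by rewrite conjcE; case: z. Qed.
Lemma ImJ z : Im (z^*)%R = - Im z. Proof. by rewrite conjcE; case: z. Qed.

Lemma Re_sum I (s : seq I) (P : pred I) (F : I -> R[i]) :
  Re (\sum_(i <- s | P i) F i) = \sum_(i <- s | P i) Re (F i).
Proof. by elim/big_rec2: _ => //= i y1 y2 _ <-; rewrite ReD. Qed.

Lemma Im_sum I (s : seq I) (P : pred I) (F : I -> R[i]) :
  Im (\sum_(i <- s | P i) F i) = \sum_(i <- s | P i) Im (F i).
Proof. by elim/big_rec2: _ => //= i y1 y2 _ <-; rewrite ImD. Qed.

Lemma cabsE z : cabs z = Num.sqrt (Re z ^+ 2 + Im z ^+ 2).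
Proof. by rewrite /cabs normc_def. Qed.

Lemma cabsC z : (cabs z)%:C = `|z|.
Proof. by rewrite /cabs normc_def. Qed.

Lemma ltr_cabs z a : (`|z| < a%:C) = (cabs z < a).
Proof. by rewrite -cabsC ltcR. Qed.

Lemma cabs_ge0 z : 0 <= cabs z. Proof. by rewrite cabsE sqrtr_ge0. Qed.

Lemma sqr_cabs z : cabs z ^+ 2 = Re z ^+ 2 + Im z ^+ 2.
Proof. by rewrite cabsE sqr_sqrtr// addr_ge0// sqr_ge0. Qed.

Lemma cabsM z w : cabs (z * w) = cabs z * cabs w.
Proof. by apply: complexI; rewrite rmorphM /= !cabsC normrM. Qed.

Lemma cabs_conj z : cabs (z^*)%R = cabs z.
Proof. by rewrite !cabsE ReJ ImJ sqrrN. Qed.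

Lemma cabsD z w : cabs (z + w) <= cabs z + cabs w.
Proof. by rewrite -lecR rmorphD /= !cabsC ler_normD. Qed.

Lemma cabsN z : cabs (- z) = cabs z.
Proof. by rewrite !cabsE ReN ImN !sqrrN. Qed.

Lemma cabs0 : cabs 0 = 0 :> R.
Proof. by rewrite cabsE /= expr0n /= addr0 sqrtr0. Qed.

Lemma cabs_real a : cabs a%:C = `|a|.
Proof. by rewrite cabsE /= expr0n /= addr0 sqrtr_sqr. Qed.

Lemma cabs_sum I (s : seq I) (P : pred I) (F : I -> R[i]) :
  cabs (\sum_(i <- s | P i) F i) <= \sum_(i <- s | P i) cabs (F i).
Proof.
elim/big_rec2: _ => [|i y1 y2 _ h]; first by rewrite cabs0.
by rewrite (le_trans (cabsD _ _))// lerD2l.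
Qed.

Lemma ler_Re_cabs z : `|Re z| <= cabs z.
Proof.
by rewrite -(sqrtr_sqr (Re z)) cabsE ler_wsqrtr// lerDl sqr_ge0.
Qed.

Lemma ler_Im_cabs z : `|Im z| <= cabs z.
Proof.
by rewrite -(sqrtr_sqr (Im z)) cabsE ler_wsqrtr// lerDr sqr_ge0.
Qed.

Lemma cabs_ler z : cabs z <= `|Re z| + `|Im z|.
Proof.
rewrite -[leRHS]ger0_norm ?addr_ge0// -sqrtr_sqr cabsE ler_wsqrtr//.
rewrite sqrrD !real_normK ?num_real// addrAC lerDl.
by rewrite mulrn_wge0// mulr_ge0.
Qed.

Lemma cabs_eq0 z : cabs z = 0 -> z = 0.
Proof. by move=> h; apply/eqP; rewrite -normr_eq0 -cabsC h. Qed.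

(** Weighted form of the Cauchy-Schwarz inequality: the free weight [t]
    replaces the division by the norms. *)
Lemma cabsM_le z w t : 0 < t ->
  cabs z * cabs w <= t * cabs z ^+ 2 + cabs w ^+ 2 / t.
Proof.
move=> t0.
have h : 0 <= (t * cabs z - cabs w) ^+ 2 / t by rewrite divr_ge0 ?sqr_ge0 ?ltW.
have tn0 : t != 0 by rewrite gt_eqF.
have e : (t * cabs z - cabs w) ^+ 2 / t =
  t * cabs z ^+ 2 + cabs w ^+ 2 / t - 2 * (cabs z * cabs w) by field.
move: h; rewrite e subr_ge0; apply: le_trans.
by rewrite ler_peMl ?mulr_ge0 ?cabs_ge0// ler1n.
Qed.

Lemma cexpi0 : cexpi 0 = 1 :> R[i]. Proof. by rewrite /cexpi cos0 sin0. Qed.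

Lemma cexpiD a b : cexpi (a + b) = cexpi a * cexpi b.
Proof.
apply: complexP; rewrite ?ReM ?ImM /= ?cosD ?sinD//.
by rewrite addrC.
Qed.

Lemma cexpiN a : cexpi (- a) = ((cexpi a)^*)%R.
Proof. by apply: complexP; rewrite ?ReJ ?ImJ /= ?cosN ?sinN. Qed.

Lemma cabs_cexpi a : cabs (cexpi a) = 1.
Proof. by rewrite cabsE /= cos2Dsin2 sqrtr1. Qed.

Lemma Re_cexpi a : Re (cexpi a) = cos a. Proof. by []. Qed.
Lemma Im_cexpi a : Im (cexpi a) = sin a. Proof. by []. Qed.

Lemma cexpi_pi : cexpi pi = -1 :> R[i].
Proof. by apply: complexP; rewrite ?Re_cexpi ?Im_cexpi ?cospi ?sinpi //= oppr0. Qed.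

Lemma cexpiNpi : cexpi (- pi) = -1 :> R[i].
Proof. by rewrite cexpiN cexpi_pi rmorphN rmorph1. Qed.

Lemma cexpi_periodic a (k : int) : cexpi (a + 2 * pi * k%:~R) = cexpi a.
Proof.
have nat_period b (n : nat) : cexpi (b + 2 * pi * n%:R) = cexpi b.
  elim: n => [|n IH]; first by rewrite mulr0 addr0.
  have -> : b + 2 * pi * n.+1%:R = b + 2 * pi * n%:R + pi *+ 2.
    by rewrite -(natr1 n); ring.
  by rewrite -[RHS]IH /cexpi cosD2pi sinD2pi.
case: k => n; first exact: nat_period.
by rewrite -[LHS](nat_period _ n.+1) NegzE rmorphN /= mulrN subrK.
Qed.

End ComplexAlgebra.

Section ComplexLimits.
Context {R : realType}.
Implicit Types (u v : nat -> R[i]^o) (z w : R[i]^o).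
Local Notation Re := complex.Re.
Local Notation Im := complex.Im.

(** Neighbourhoods in the complex plane are defined with radii that are
    themselves complex numbers; this reduces limits to the real line. *)
Lemma cvg_cabsP u z : (u @ \oo --> (z : R[i]^o)) <->
  (fun n => cabs (u n - z)) @ \oo --> (0 : R).
Proof.
have [to_eps of_eps] := @cvgrPdist_lt _ (R[i]^o) nat \oo _ u z.
have E n e : (`|z - u n| < e%:C) = (cabs (u n - z) < e).
  by rewrite -cabsN opprB -ltr_cabs.
split=> [/to_eps h|/cvgrPdist_lt h].
- apply/cvgrPdist_lt => e e0.
  have /h : 0 < e%:C by rewrite ltcR.
  apply: filterS => n hn; rewrite sub0r normrN ger0_norm ?cabs_ge0//.
  exact: etrans (esym (E n e)) hn.
- apply: of_eps => -[e1 e2]; rewrite ltcE /= => /andP[/eqP-> e0].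
  apply: filterS (h _ e0) => n; rewrite sub0r normrN ger0_norm ?cabs_ge0// => hn.
  exact: etrans (E n e1) hn.
Qed.

Lemma cvg_ReImP u z : (u @ \oo --> (z : R[i]^o)) <->
  ((fun n => Re (u n)) @ \oo --> Re z) /\ ((fun n => Im (u n)) @ \oo --> Im z).
Proof.
rewrite cvg_cabsP; split.
- move=> /cvgrPdist_lt h; split; apply/cvgrPdist_lt => e e0.
  + apply: filterS (h _ e0) => n; rewrite sub0r normrN ger0_norm ?cabs_ge0//.
    by apply: le_lt_trans; rewrite distrC -ReB ler_Re_cabs.
  + apply: filterS (h _ e0) => n; rewrite sub0r normrN ger0_norm ?cabs_ge0//.
    by apply: le_lt_trans; rewrite distrC -ImB ler_Im_cabs.
- case=> /cvgrPdist_lt h1 /cvgrPdist_lt h2; apply/cvgrPdist_lt => e e0.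
  have e20 : 0 < e / 2 by rewrite divr_gt0.
  near=> n; rewrite sub0r normrN ger0_norm ?cabs_ge0//.
  rewrite (le_lt_trans (cabs_ler _))// [e]splitr ReB ImB ltrD//.
  + by rewrite distrC; near: n; exact: h1.
  + by rewrite distrC; near: n; exact: h2.
Unshelve. all: by end_near. Qed.

Lemma cvg_cabs_le u z C : u @ \oo --> (z : R[i]^o) ->
  (forall n, cabs (u n) <= C) -> cabs z <= C.
Proof.
move=> /cvg_cabsP /cvgrPdist_lt h uC; apply/ler_addgt0Pr => e e0.
have [n _ hn] := h _ e0.
have := hn n (leqnn _); rewrite sub0r normrN ger0_norm ?cabs_ge0// => /ltW he.
have -> : z = u n + (- (u n - z)) by rewrite opprB addrC subrK.
by rewrite (le_trans (cabsD _ _))// lerD// cabsN.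
Qed.

Lemma cvg_unique_complex u z w :
  u @ \oo --> (z : R[i]^o) -> u @ \oo --> (w : R[i]^o) -> z = w.
Proof.
move=> /cvg_ReImP[z1 z2] /cvg_ReImP[w1 w2].
by apply: complexP; [exact: (cvg_unique _ z1 w1)|exact: (cvg_unique _ z2 w2)].
Qed.

Lemma cvg_complexZ u (c z : R[i]) : u @ \oo --> (z : R[i]^o) ->
  (fun n => c * u n : R[i]^o) @ \oo --> (c * z : R[i]^o).
Proof. exact: (@cvgZl_tmp _ R[i]^o). Qed.

Lemma cvg_complexD u v (z w : R[i]) :
  u @ \oo --> (z : R[i]^o) -> v @ \oo --> (w : R[i]^o) ->
  (fun n => u n + v n : R[i]^o) @ \oo --> (z + w : R[i]^o).
Proof. exact: (@cvgD _ R[i]^o). Qed.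

End ComplexLimits.

Section SumsOverIntegers.
Context {R : realType}.
Implicit Types (u v : int -> R[i]) (c : R[i]).
Local Notation Re := complex.Re.
Local Notation Im := complex.Im.

Definition psumZ {V : nmodType} (u : int -> V) (n : nat) : V :=
  \sum_(0 <= k < n) (u (Posz k) + u (Negz k)).

Definition zseq n : seq int := map Posz (iota 0 n) ++ map Negz (iota 0 n).

Lemma uniq_zseq n : uniq (zseq n).
Proof.
rewrite cat_uniq !map_inj_uniq ?iota_uniq//=; try by move=> ? ? [].
by rewrite andbT; apply/hasPn => _ /mapP[m _ ->]; apply/mapP => -[].
Qed.

Lemma psumZ_zseq (V : nmodType) (u : int -> V) n :
  psumZ u n = \sum_(k <- zseq n) u k.
Proof. by rewrite /psumZ big_split /= /zseq big_cat !big_map /index_iota !subn0. Qed.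

Lemma mem_zseq n k : (k \in zseq n) = (- n%:Z <= k < n%:Z).
Proof.
rewrite mem_cat; case: k => m.
  rewrite mem_map; last by move=> ? ? [].
  have -> : (Posz m \in map Negz (iota 0 n)) = false by apply/negbTE/mapP => -[].
  by rewrite mem_iota; lia.
rewrite [X in _ || X]mem_map; last by move=> ? ? [].
have -> : (Negz m \in map Posz (iota 0 n)) = false by apply/negbTE/mapP => -[].
by rewrite mem_iota; lia.
Qed.

Lemma psumZS (V : nmodType) (u : int -> V) n :
  psumZ u n.+1 = psumZ u n + (u (Posz n) + u (Negz n)).
Proof. by rewrite /psumZ big_nat_recr. Qed.

Lemma psumZ0 (V : nmodType) (u : int -> V) : psumZ u 0 = 0.
Proof. by rewrite /psumZ big_geq. Qed.

(** Telescoping: shifting the summand moves only the two boundary terms. *)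
Lemma psumZ_shift (V : comNzRingType) (v : int -> V) n :
  psumZ (fun j => v (j + 1)) n = psumZ v n + v n%:Z - v (- n%:Z).
Proof.
elim: n => [|n IH]; first by rewrite !psumZ0 oppr0 add0r addrN.
rewrite !psumZS IH.
have -> : Negz n + 1 = - n%:Z by lia.
have -> : n%:Z + 1 = n.+1%:Z by lia.
by rewrite NegzE; ring.
Qed.

Let esum_cabsE u : (\esum_(k in [set: int]) `|(cabs (u k))%:E|)%E =
  (\sum_(0 <= n <oo) (cabs (u (Posz n)) + cabs (u (Negz n)))%:E)%E.
Proof.
have u0 k : (0 <= `|(cabs (u k))%:E|)%E by [].
rewrite (esumID (range Posz))// !setTI.
have -> : ~` range Posz = range Negz.
  apply/seteqP; split => [[n|n] h|_ [n _ <-] [m _]//]; last by exists n.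
  by exfalso; apply: h; exists n.
rewrite (reindex_esum [set: nat] _ Posz); last first.
  by split; [move=> x _; exists x|move=> x y _ _ []|].
rewrite (reindex_esum [set: nat] _ Negz); last first.
  by split; [move=> x _; exists x|move=> x y _ _ []|].
rewrite -esumD//.
have -> : [set: nat] = [set x | xpredT x] by apply/seteqP; split.
rewrite -nneseries_esum; last by move=> n _; rewrite adde_ge0.
apply: eq_eseriesr => n _.
by rewrite /= !ger0_norm ?cabs_ge0.
Qed.

Lemma abs_summableP u C :
  (forall n, psumZ (cabs \o u) n <= C) -> abs_summable u.
Proof.
move=> uC; rewrite /abs_summable /summable esum_cabsE.
rewrite (le_lt_trans _ (ltry C))//; apply: lime_le.
  by apply: is_cvg_nneseries => n _ _; rewrite lee_fin addr_ge0// cabs_ge0.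
apply: nearW => n; have := uC n; rewrite -lee_fin; apply: le_trans.
by rewrite /psumZ -sumEFin.
Qed.

Lemma abs_summable_bound u : abs_summable u ->
  exists C, forall n, psumZ (cabs \o u) n <= C.
Proof.
rewrite /abs_summable /summable esum_cabsE => us.
set s := (X in (X < _)%E) in us.
have s0 : (0 <= s)%E.
  by apply: nneseries_ge0 => n _ _; rewrite lee_fin addr_ge0// cabs_ge0.
exists (fine s) => n; rewrite -lee_fin fineK ?ge0_fin_numE//.
rewrite /psumZ -sumEFin.
apply: (@nneseries_lim_ge _ (fun n => (cabs (u (Posz n)) + cabs (u (Negz n)))%:E)).
by move=> k _; rewrite lee_fin addr_ge0// cabs_ge0.
Qed.

Let cvg_series_bounded (v : nat -> R[i]) C :
  (forall n, \sum_(0 <= k < n) cabs (v k) <= C) ->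
  series (v : nat -> R[i]^o) @ \oo --> (limn (series (v : nat -> R[i]^o)) : R[i]^o).
Proof.
move=> vC.
have bounded_cvg (w : nat -> R) : (forall k, `|w k| <= cabs (v k)) ->
    cvgn (series w).
  move=> wv; apply: normed_cvg.
  change (cvgn (series (fun k => `|w k|))); apply: nondecreasing_is_cvgn.
    apply/nondecreasing_seqP => n.
    by rewrite seriesSr lerDl.
  exists C => _ [n _ <-]; apply: le_trans (vC n).
  by rewrite /series /= ler_sum// => k _; exact: wv.
have cRe := bounded_cvg _ (fun k => ler_Re_cabs (v k)).
have cIm := bounded_cvg _ (fun k => ler_Im_cabs (v k)).
pose l := limn (series (fun k => Re (v k))) +i*
          limn (series (fun k => Im (v k))).
have vl : series (v : nat -> R[i]^o) @ \oo --> (l : R[i]^o).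
  apply/cvg_ReImP; split.
  - have -> : (fun n => Re (series (v : nat -> R[i]^o) n)) =
        series (fun k => Re (v k)) by apply/funext => n; exact: Re_sum.
    exact: cRe.
  - have -> : (fun n => Im (series (v : nat -> R[i]^o) n)) =
        series (fun k => Im (v k)) by apply/funext => n; exact: Im_sum.
    exact: cIm.
by rewrite (cvg_lim _ vl)//; exact: norm_hausdorff.
Qed.

Lemma csumZ_cvg u : abs_summable u ->
  (psumZ u : nat -> R[i]^o) @ \oo --> (csumZ u : R[i]^o).
Proof.
move=> /abs_summable_bound[C uC].
have -> : (psumZ u : nat -> R[i]^o) =
    (fun n => series (u \o Posz : nat -> R[i]^o) n +
              series (u \o Negz : nat -> R[i]^o) n).
  by apply/funext => n; rewrite /psumZ big_split.
apply: (@cvgD _ R[i]^o); apply: (@cvg_series_bounded _ C) => n.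
- apply: le_trans (uC n); rewrite /psumZ ler_sum// => k _.
  by rewrite lerDl cabs_ge0.
- apply: le_trans (uC n); rewrite /psumZ ler_sum// => k _.
  by rewrite lerDr cabs_ge0.
Qed.

Lemma csumZ_unique u l : abs_summable u ->
  (psumZ u : nat -> R[i]^o) @ \oo --> (l : R[i]^o) -> csumZ u = l.
Proof. by move=> /csumZ_cvg ul; exact: cvg_unique_complex ul. Qed.

Lemma eq_abs_summable u v : u =1 v -> abs_summable u -> abs_summable v.
Proof. by move=> /funext ->. Qed.

Lemma abs_summableD u v : abs_summable u -> abs_summable v ->
  abs_summable (fun k => u k + v k).
Proof.
move=> /abs_summable_bound[C uC] /abs_summable_bound[D vD].
apply: (@abs_summableP _ (C + D)) => n.
apply: le_trans (lerD (uC n) (vD n)).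
rewrite /psumZ -big_split/= ler_sum// => k _.
by rewrite addrACA lerD// cabsD.
Qed.

Lemma abs_summableZ u c : abs_summable u -> abs_summable (fun k => c * u k).
Proof.
move=> /abs_summable_bound[C uC].
apply: (@abs_summableP _ (cabs c * C)) => n.
apply: le_trans (ler_wpM2l (cabs_ge0 c) (uC n)).
rewrite /psumZ mulr_sumr ler_sum// => k _.
by rewrite /= !cabsM mulrDr.
Qed.

Lemma csumZD u v : abs_summable u -> abs_summable v ->
  csumZ (fun k => u k + v k) = csumZ u + csumZ v.
Proof.
move=> us vs; apply: csumZ_unique; first exact: abs_summableD.
have -> : (psumZ (fun k => u k + v k) : nat -> R[i]^o) =
    (fun n => (psumZ u n : R[i]^o) + psumZ v n).
  apply/funext => n; rewrite /psumZ -big_split /=.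
  by apply: eq_bigr => k _; rewrite addrACA.
by apply: (@cvgD _ R[i]^o); exact: csumZ_cvg.
Qed.

Lemma csumZZ u c : abs_summable u -> csumZ (fun k => c * u k) = c * csumZ u.
Proof.
move=> us; apply: csumZ_unique; first exact: abs_summableZ.
have -> : (psumZ (fun k => c * u k) : nat -> R[i]^o) = (fun n => c * psumZ u n).
  by apply/funext => n; rewrite /psumZ mulr_sumr; apply: eq_bigr => k _; rewrite mulrDr.
by apply: cvg_complexZ; exact: csumZ_cvg.
Qed.

End SumsOverIntegers.

(** * Lebesgue measure: affine maps and induction on measurable sets *)

Section LebesgueMeasurable.
Context {R : realType}.
Local Notation T := (@lebesgueTypeR R).
Local Notation mu := (@completed_lebesgue_measure R).
Local Notation leb := (@lebesgue_measure R).
Local Open Scope ereal_scope.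

Lemma borel_measurable (A : set R) :
  @measurable _ (measurableTypeR R) A -> @measurable _ T A.
Proof. exact: sub_caratheodory. Qed.

Lemma borel_measurable_fun d (V : measurableType d) (h : R -> V) :
  measurable_fun [set: measurableTypeR R] h -> measurable_fun [set: T] h.
Proof. by move=> mh _ B mB; apply: borel_measurable; exact: mh. Qed.

Lemma continuous_lebesgue_measurable (h : R -> R) :
  continuous h -> measurable_fun [set: T] h.
Proof.
by move=> ch; apply: borel_measurable_fun; exact: continuous_measurable_fun.
Qed.

Lemma itv_lebesgue_measurable (i : interval R) : @measurable _ T [set` i].
Proof. by apply: borel_measurable; exact: measurable_itv. Qed.

(** Affine changes of variables are known on Borel sets and on null sets, and
    this decomposition carries them over to Lebesgue sets. *)
Lemma lebesgue_measurableP (E : set R) : @measurable _ T E ->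
  exists A N, [/\ @measurable _ (measurableTypeR R) A, leb.-negligible N &
               E = A `|` N].
Proof.
move=> mE; have : (completed_algebra_gen leb).-sigma.-measurable E.
  by rewrite completed_caratheodory_measurable.
rewrite g_sigma_completed_algebra_genE => -[A mA [N nN <-]].
by exists A, N.
Qed.

Lemma negligible_completed (N : set R) : leb.-negligible N -> mu.-negligible N.
Proof.
by move=> [A [mA A0 NA]]; exists A; split => //; exact: borel_measurable.
Qed.

Lemma completed_negligible (N : set R) : mu.-negligible N -> leb.-negligible N.
Proof.
move=> [A [mA A0 NA]]; apply/negligible_outer_measure/eqP.
by rewrite eq_le outer_measure_ge0 andbT -[leRHS]A0 le_outer_measure.
Qed.

Lemma negligible_measurable (N : set R) : mu.-negligible N -> @measurable _ T N.
Proof. exact: negligible_sub_caratheodory. Qed.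

(** The rays generate the Borel sets and are stable under intersection, and a
    Lebesgue set is a Borel set up to a null set. *)
Lemma lebesgue_dynkin_induction (P : set R -> Prop) :
  P setT ->
  (forall a, P `[a, +oo[%classic) ->
  (forall E, @measurable _ T E -> P E -> P (~` E)) ->
  (forall F : nat -> set R, (forall n, @measurable _ T (F n)) ->
    trivIset setT F -> (forall n, P (F n)) -> P (\bigcup_n F n)) ->
  (forall E N, @measurable _ T E -> mu.-negligible N -> P E -> P (E `|` N)) ->
  forall E, @measurable _ T E -> P E.
Proof.
move=> PT Pray PC PU PN E /lebesgue_measurableP[A [N [mA nN ->]]].
apply: PN; [exact: borel_measurable|exact: negligible_completed|].
pose G : set (set R) := [set `[a, +oo[%classic | a in setT].
have GE : @measurable _ (measurableTypeR R) = <<s G >>.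
  rewrite [LHS]RGenCInfty.measurableE; congr (<<s _ >>).
  by apply/seteqP; split => X; [move=> [a ->]; exists a|move=> [a _ <-]; exists a].
apply: (@dynkin_induction _ (measurableTypeR R) G P) => //.
- move=> _ _ [a _ <-] [b _ <-]; exists (Num.max a b) => //.
  apply/seteqP; split => x /=; rewrite !in_itv /= !andbT ge_max.
    by move/andP.
  by move=> [-> ->].
- by move=> _ [a _ <-]; exact: Pray.
- by move=> S mS; apply: PC; exact: borel_measurable.
- by move=> F mF tF PF; apply: PU => // n; exact: borel_measurable.
- by rewrite -GE.
Qed.

End LebesgueMeasurable.

Section AffineMaps.
Context {R : realType} (a b : R) (a0 : a != 0%R).
Local Notation T := (@lebesgueTypeR R).
Local Notation mu := (@completed_lebesgue_measure R).
Local Notation leb := (@lebesgue_measure R).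
Local Open Scope ereal_scope.

Let aff (x : R) : R := (a * x + b)%R.

Let maff_borel : measurable_fun [set: measurableTypeR R] (aff : _ -> measurableTypeR R).
Proof.
apply: continuous_measurable_fun => x.
by apply: cvgD; [apply: cvgMl_tmp; exact: cvg_id|exact: cvg_cst].
Qed.

Let norma : {nonneg R} := NngNum (normr_ge0 a).

Let borel_affine (A : set R) : @measurable _ (measurableTypeR R) A ->
  `|a|%:E * leb (aff @^-1` A) = leb A.
Proof.
move=> mA.
pose nu := mscale norma (pushforward leb (aff : measurableTypeR R -> measurableTypeR R)).
suff /esym : leb A = nu maff_borel A by [].
(* Two measures that agree on half-open intervals agree on Borel sets. *)
apply: lebesgue_measure_unique => // _ [[x y] _ <-].
change (leb `]x, y] = `|a|%:E * leb (aff @^-1` `]x, y])).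
have [xy|yx] := ltP x y; last first.
  rewrite set_itv_ge ?bnd_simp -?leNgt//.
  by rewrite preimage_set0 !measure0 mule0.
have [a_gt0|a_lt0|/eqP] := ltgtP 0%R a; last by rewrite eq_sym (negbTE a0).
- have -> : aff @^-1` `]x, y] = `]((x - b) / a)%R, ((y - b) / a)%R]%classic.
    apply/seteqP; split => z /=; rewrite !in_itv /= /aff;
    by rewrite ltr_pdivrMr// ler_pdivlMr// ltrBlDr lerBrDr (mulrC z).
  rewrite !lebesgue_measure_itv /= !lte_fin xy.
  rewrite ltr_pM2r ?invr_gt0// ltrD2r xy -!EFinB -EFinM gtr0_norm//.
  by congr (_%:E); field; rewrite gt_eqF.
- have -> : aff @^-1` `]x, y] = `[((y - b) / a)%R, ((x - b) / a)%R[%classic.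
    apply/seteqP; split => z /=; rewrite !in_itv /= /aff;
    by rewrite ler_ndivrMr// ltr_ndivlMr// ltrBlDr lerBrDr (mulrC z) andbC.
  rewrite !lebesgue_measure_itv /= !lte_fin xy.
  rewrite ltr_nM2r ?invr_lt0// ltrD2r xy -!EFinB -EFinM ltr0_norm//.
  by congr (_%:E); field; rewrite lt_eqF.
Qed.

Let negligible_affine (N : set R) :
  leb.-negligible N -> leb.-negligible (aff @^-1` N).
Proof.
move=> [B [mB B0 NB]]; exists (aff @^-1` B); split.
- by rewrite -[X in measurable X]setTI; exact: maff_borel.
- apply/eqP; have := borel_affine mB; rewrite [X in _ = X]B0 => /eqP.
  by rewrite mule_eq0 eqe normr_eq0 (negbTE a0).
- by move=> x /NB.
Qed.

Lemma affine_measurable : measurable_fun [set: T] (fun x : T => aff x : T).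
Proof.
move=> _ E /lebesgue_measurableP[A [N [mA nN ->]]]; rewrite setTI.
rewrite preimage_setU; apply: measurableU.
- apply: borel_measurable; rewrite -[X in measurable X]setTI; exact: maff_borel.
- apply: negligible_measurable; apply: negligible_completed.
  exact: negligible_affine.
Qed.

Lemma affine_negligible (N : set R) :
  mu.-negligible N -> mu.-negligible (aff @^-1` N).
Proof.
by move=> /completed_negligible /negligible_affine; exact: negligible_completed.
Qed.

Lemma affine_measure (E : set R) : @measurable _ T E ->
  mu (aff @^-1` E) = `|a|^-1%:E * mu E.
Proof.
move=> /lebesgue_measurableP[A [N [mA nN ->]]].
have muU (B M : set R) : @measurable _ (measurableTypeR R) B -> leb.-negligible M ->
    mu (B `|` M) = leb B.
  move=> mB nM; have mM := negligible_measurable (negligible_completed nM).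
  apply/eqP; rewrite eq_le; apply/andP; split; last exact: le_outer_measure.
  have M0 : mu M = 0 by apply: measure_negligible => //; exact: negligible_completed.
  by rewrite -[leRHS]adde0 -[X in _ <= _ + X]M0; exact: outer_measureU2.
rewrite preimage_setU !muU//; last first.
- exact: negligible_affine.
- by rewrite -[X in measurable X]setTI; exact: maff_borel.
rewrite -(borel_affine mA) muleA -EFinM mulVf ?normr_eq0// mul1e//.
Qed.

Let normVa_ge0 : (0 <= `|a|^-1)%R. Proof. by rewrite invr_ge0. Qed.
Let normVa : {nonneg R} := NngNum normVa_ge0.

(** The image of the Lebesgue measure under the affine map is a multiple of it. *)
Lemma ge0_affine_integral (h : R -> \bar R) : measurable_fun [set: T] h ->
  (forall x, 0 <= h x) ->
  \int[mu]_x h (a * x + b)%R = `|a|^-1%:E * \int[mu]_x h x.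
Proof.
move=> mh h0.
rewrite -(ge0_integral_mscale _ measurableT normVa)//.
rewrite -(@ge0_integral_pushforward _ _ T T R _ affine_measurable mu setT h)//.
apply: eq_measure_integral => [|mf E mE _]; first exact: affine_measurable.
exact: affine_measure.
Qed.

Lemma affine_integrable (h : R -> R) :
  mu.-integrable [set: T] (EFin \o h) ->
  mu.-integrable [set: T] (fun x => (h (a * x + b))%:E).
Proof.
move=> /integrableP[mh hoo]; apply/integrableP; split.
  exact: (measurableT_comp mh affine_measurable).
have mh' : measurable_fun [set: T] (fun x => `|(h x)%:E|) by exact: measurableT_comp mh.
have -> := ge0_affine_integral mh' (fun x => abse_ge0 (h x)%:E).
by rewrite lte_mul_pinfty.
Qed.

Lemma affine_Rintegral (h : R -> R) : mu.-integrable [set: T] (EFin \o h) ->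
  (\int[mu]_x h (a * x + b) = `|a|^-1 * \int[mu]_x h x)%R.
Proof.
move=> ih; have mh := measurable_int _ ih.
have pfin := integrable_pos_fin_num measurableT ih.
have nfin := integrable_neg_fin_num measurableT ih.
have -> : (`|a|^-1)%R = fine (`|a|^-1)%:E by [].
rewrite /Rintegral -fineM//; last exact: integrable_fin_num.
congr fine; rewrite [in RHS]integralE [in LHS]integralE.
rewrite muleBr//; last by rewrite fin_num_adde_defl// fin_numN.
have -> := esym (@ge0_affine_integral (EFin \o h)^\+ _ _) => //.
  have -> := esym (@ge0_affine_integral (EFin \o h)^\- _ _) => //.
    by congr (_ - _); apply: eq_integral => x _; rewrite ?funeposE ?funenegE.
  exact: measurable_funeneg.
exact: measurable_funepos.
Qed.

End AffineMaps.

Local Opaque cabs.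

(** * Integrals of complex functions *)

Section ComplexIntegral.
Context {R : realType}.
Local Notation T := (@lebesgueTypeR R).
Local Notation mu := (@completed_lebesgue_measure R).
Local Notation Re := complex.Re.
Local Notation Im := complex.Im.
Implicit Types (f g h : R -> R[i]) (c : R[i]).

Definition integrableR (h : R -> R) := mu.-integrable [set: T] (EFin \o h).

Variant cintegrable f : Prop := CIntegrable of
  integrableR (fun x => Re (f x)) & integrableR (fun x => Im (f x)).

Lemma cmeasurable_cst c : cmeasurable (fun _ => c).
Proof. by split; exact: measurable_cst. Qed.

Lemma cmeasurable_real (h : R -> R) : measurable_fun [set: T] h ->
  cmeasurable (fun x => (h x)%:C).
Proof. by move=> mh; split => //; exact: measurable_cst. Qed.

Lemma cmeasurableD f g : cmeasurable f -> cmeasurable g ->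
  cmeasurable (fun x => f x + g x).
Proof.
move=> [f1 f2] [g1 g2]; split.
- by under eq_fun do rewrite ReD; exact: measurable_funD.
- by under eq_fun do rewrite ImD; exact: measurable_funD.
Qed.

Lemma cmeasurableM f g : cmeasurable f -> cmeasurable g ->
  cmeasurable (fun x => f x * g x).
Proof.
move=> [f1 f2] [g1 g2]; split.
- under eq_fun do rewrite ReM.
  by apply: measurable_funB; exact: measurable_funM.
- under eq_fun do rewrite ImM.
  by apply: measurable_funD; exact: measurable_funM.
Qed.

Lemma cmeasurableJ f : cmeasurable f -> cmeasurable (fun x => ((f x)^*)%R).
Proof.
move=> [f1 f2]; split.
- by under eq_fun do rewrite ReJ.
- by under eq_fun do rewrite ImJ; exact: measurableT_comp f2.
Qed.

Lemma cmeasurable_sum I (s : seq I) (P : pred I) (F : I -> R -> R[i]) :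
  (forall i, P i -> cmeasurable (F i)) ->
  cmeasurable (fun x => \sum_(i <- s | P i) F i x).
Proof.
move=> mF; elim: s => [|i s IH].
  by under eq_fun do rewrite big_nil; exact: cmeasurable_cst.
case: (boolP (P i)) => Pi; under eq_fun do rewrite big_cons ?Pi ?(negbTE Pi)//.
  exact: cmeasurableD (mF i Pi) IH.
exact: IH.
Qed.

Lemma cmeasurable_indic (E : set R) : @measurable _ T E ->
  cmeasurable (fun x => (\1_E x)%:C).
Proof. by move=> mE; apply: cmeasurable_real; exact: measurable_indic. Qed.

Lemma cmeasurable_cexpi (k : R) : cmeasurable (fun x => cexpi (k * x)).
Proof.
have ck : continuous (fun x : R => k * x).
  by move=> x; apply: cvgMl_tmp; exact: cvg_id.
split.
- apply: (@continuous_lebesgue_measurable _ (cos \o ( *%R k))) => x.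
  by apply: continuous_comp; [exact: ck|exact: continuous_cos].
- apply: (@continuous_lebesgue_measurable _ (sin \o ( *%R k))) => x.
  by apply: continuous_comp; [exact: ck|exact: continuous_sin].
Qed.

Lemma cmeasurable_affine f (a b : R) : a != 0 -> cmeasurable f ->
  cmeasurable (fun x => f (a * x + b)).
Proof.
move=> a0 [f1 f2]; have ma := affine_measurable b a0.
by split; [exact: (measurableT_comp f1 ma)|exact: (measurableT_comp f2 ma)].
Qed.

Lemma measurable_cabs f : cmeasurable f ->
  measurable_fun [set: T] (fun x => cabs (f x)).
Proof.
move=> [f1 f2]; under eq_fun do rewrite cabsE.
apply: (measurableT_comp (continuous_measurable_fun (@sqrt_continuous R))).
by apply: measurable_funD; exact: measurable_funX.
Qed.

Lemma integrableR_le (h g : R -> R) : measurable_fun [set: T] h ->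
  integrableR g -> (forall x, `|h x| <= g x) -> integrableR h.
Proof.
move=> mh ig hg.
apply: (@le_integrable _ _ _ mu setT measurableT (EFin \o h) (EFin \o g)).
- exact/measurable_EFinP.
- by move=> x _ /=; rewrite lee_fin (le_trans (hg x))// ler_norm.
- exact: ig.
Qed.

Lemma cintegrable_le f (g : R -> R) : cmeasurable f -> integrableR g ->
  (forall x, cabs (f x) <= g x) -> cintegrable f.
Proof.
move=> [f1 f2] ig fg; split; apply: integrableR_le ig _ => // x.
- exact: le_trans (ler_Re_cabs _) (fg x).
- exact: le_trans (ler_Im_cabs _) (fg x).
Qed.

Lemma cintegrable_measurable f : cintegrable f -> cmeasurable f.
Proof.
by move=> [/measurable_int/measurable_EFinP f1 /measurable_int/measurable_EFinP f2].
Qed.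

Lemma cintegrable_cabs f : cintegrable f -> integrableR (fun x => cabs (f x)).
Proof.
move=> fi; have mf := cintegrable_measurable fi.
case: fi => f1 f2; apply: (@integrableR_le _ (fun x => `|Re (f x)| + `|Im (f x)|)).
- exact: measurable_cabs.
- have := integrableD measurableT (integrable_norm f1) (integrable_norm f2).
  by apply: eq_integrable.
- by move=> x; rewrite ger0_norm ?cabs_ge0// cabs_ler.
Qed.

Lemma integrableRD (g h : R -> R) :
  integrableR g -> integrableR h -> integrableR (fun x => g x + h x).
Proof. by move=> ig ih; have := integrableD measurableT ig ih; exact: eq_integrable. Qed.

Lemma integrableRZ (k : R) (h : R -> R) :
  integrableR h -> integrableR (fun x => k * h x).
Proof. by move=> ih; have := integrableZl measurableT k ih; exact: eq_integrable. Qed.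

Lemma cintegrableD f g : cintegrable f -> cintegrable g ->
  cintegrable (fun x => f x + g x).
Proof.
move=> [f1 f2] [g1 g2]; split.
- by under eq_fun do rewrite ReD; exact: integrableRD.
- by under eq_fun do rewrite ImD; exact: integrableRD.
Qed.

Lemma cintegrableZ c f : cintegrable f -> cintegrable (fun x => c * f x).
Proof.
move=> fi; apply: (@cintegrable_le _ (fun x => cabs c * cabs (f x))).
- by apply: cmeasurableM; [exact: cmeasurable_cst|exact: cintegrable_measurable].
- by apply: integrableRZ; exact: cintegrable_cabs.
- by move=> x; rewrite cabsM.
Qed.

Lemma cintegrable0 : cintegrable (fun _ => 0).
Proof. by split; exact: integrable0. Qed.

Lemma cintegrable_sum I (s : seq I) (P : pred I) (F : I -> R -> R[i]) :
  (forall i, P i -> cintegrable (F i)) ->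
  cintegrable (fun x => \sum_(i <- s | P i) F i x).
Proof.
move=> mF; elim: s => [|i s IH].
  by under eq_fun do rewrite big_nil; exact: cintegrable0.
case: (boolP (P i)) => Pi; under eq_fun do rewrite big_cons ?Pi ?(negbTE Pi)//.
  by apply: cintegrableD => //; exact: mF.
exact: IH.
Qed.

Lemma cintegralD f g : cintegrable f -> cintegrable g ->
  cintegral (fun x => f x + g x) = cintegral f + cintegral g.
Proof.
move=> [f1 f2] [g1 g2]; apply: complexP; rewrite ?ReD ?ImD /=.
- by under eq_Rintegral do rewrite ReD; exact: RintegralD.
- by under eq_Rintegral do rewrite ImD; exact: RintegralD.
Qed.

Lemma cintegralZ c f : cintegrable f ->
  cintegral (fun x => c * f x) = c * cintegral f.
Proof.
move=> [f1 f2]; apply: complexP; rewrite ?ReM ?ImM /=.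
- under eq_Rintegral do rewrite ReM.
  by rewrite RintegralB ?RintegralZl//; exact: integrableRZ.
- under eq_Rintegral do rewrite ImM.
  by rewrite RintegralD ?RintegralZl//; exact: integrableRZ.
Qed.

Lemma cintegralJ f : cintegrable f ->
  cintegral (fun x => ((f x)^*)%R) = ((cintegral f)^*)%R.
Proof.
move=> [f1 f2]; apply: complexP; rewrite ?ReJ ?ImJ /=.
- by under eq_Rintegral do rewrite ReJ.
- under eq_Rintegral do rewrite ImJ -mulN1r.
  by rewrite RintegralZl// mulN1r.
Qed.

Lemma eq_cintegral f g : f =1 g -> cintegral f = cintegral g.
Proof. by move=> /funext ->. Qed.

Lemma cintegral0 : cintegral (fun _ : R => 0) = 0 :> R[i].
Proof. by apply: complexP => /=; rewrite /Rintegral integral0. Qed.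

Lemma cintegral_sum I (s : seq I) (P : pred I) (F : I -> R -> R[i]) :
  (forall i, P i -> cintegrable (F i)) ->
  cintegral (fun x => \sum_(i <- s | P i) F i x) =
  \sum_(i <- s | P i) cintegral (F i).
Proof.
move=> mF; elim: s => [|i s IH].
  by rewrite big_nil; under eq_cintegral do rewrite big_nil; exact: cintegral0.
case: (boolP (P i)) => Pi;
  under eq_cintegral do rewrite big_cons ?Pi ?(negbTE Pi)//;
  rewrite big_cons ?Pi ?(negbTE Pi)//.
by rewrite cintegralD ?IH//; [exact: mF|exact: cintegrable_sum].
Qed.

Lemma ae_mono (P Q : R -> Prop) : (forall x, P x -> Q x) ->
  {ae mu, forall x, P x} -> {ae mu, forall x, Q x}.
Proof. by move=> PQ; apply: negligibleS => x /= nQ Px; apply: nQ; exact: PQ. Qed.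

Lemma ae_and (P Q : R -> Prop) : {ae mu, forall x, P x} ->
  {ae mu, forall x, Q x} -> {ae mu, forall x, P x /\ Q x}.
Proof.
move=> nP nQ; apply: negligibleS (negligibleU nP nQ) => x /= nPQ.
by apply/not_andP.
Qed.

Lemma ae_eq_Rintegral (g h : R -> R) :
  measurable_fun [set: T] g -> measurable_fun [set: T] h ->
  {ae mu, forall x, g x = h x} -> \int[mu]_x g x = \int[mu]_x h x.
Proof.
move=> mg mh gh; congr fine.
have mg' : measurable_fun [set: T] (EFin \o g) by exact/measurable_EFinP.
have mh' : measurable_fun [set: T] (EFin \o h) by exact/measurable_EFinP.
have gh' : ae_eq mu setT (EFin \o g) (EFin \o h).
  by apply: ae_mono gh => x /= ->.
have E := @ae_eq_integral _ _ _ mu setT (EFin \o h) (EFin \o g) measurableT mg' mh' gh'.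
exact: E.
Qed.

Lemma ae_eq_cintegral f g : cmeasurable f -> cmeasurable g ->
  {ae mu, forall x, f x = g x} -> cintegral f = cintegral g.
Proof.
move=> [f1 f2] [g1 g2] fg; apply: complexP => /=; apply: ae_eq_Rintegral => //.
- by apply: ae_mono fg => x ->.
- by apply: ae_mono fg => x ->.
Qed.

Lemma Rintegral_le (g h : R -> R) : integrableR g -> integrableR h ->
  (forall x, g x <= h x) -> \int[mu]_x g x <= \int[mu]_x h x.
Proof. by move=> ig ih gh; apply: le_Rintegral. Qed.

(** The factor [2] comes from estimating the real and the imaginary parts
    separately; it replaces the rotation that gives the sharp constant. *)
Lemma cabs_cintegral f : cintegrable f ->
  cabs (cintegral f) <= 2 * \int[mu]_x cabs (f x).
Proof.
move=> fi; have fa := cintegrable_cabs fi; case: fi => f1 f2.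
rewrite (le_trans (cabs_ler _))//= mulr_natl mulr2n lerD//.
- rewrite (le_trans (le_normr_Rintegral _ _))//.
  by apply: Rintegral_le => //; [exact: integrable_norm|move=> x; exact: ler_Re_cabs].
- rewrite (le_trans (le_normr_Rintegral _ _))//.
  by apply: Rintegral_le => //; [exact: integrable_norm|move=> x; exact: ler_Im_cabs].
Qed.

Lemma dominated_Rintegral (f_ : nat -> R -> R) (f g : R -> R) :
  (forall n, measurable_fun [set: T] (f_ n)) -> measurable_fun [set: T] f ->
  {ae mu, forall x, f_ ^~ x @ \oo --> f x} ->
  integrableR g -> (forall n x, `|f_ n x| <= g x) ->
  (fun n => \int[mu]_x f_ n x) @ \oo --> \int[mu]_x f x.
Proof.
move=> mf_ mf f_f ig f_g.
have [] := @dominated_convergence _ _ _ mu setT measurableT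
  (fun n => EFin \o f_ n) (EFin \o f) (EFin \o g) _ _ _ ig.
- by move=> n; exact/measurable_EFinP.
- exact/measurable_EFinP.
- by apply: ae_mono f_f => x /= h _; apply/fine_cvgP; split => //; exact: nearW.
- by apply: aeW => x n _ /=; rewrite lee_fin.
- move=> fi _; rewrite -[X in _ --> X -> _]fineK ?integrable_fin_num//.
  by move=> /fine_cvgP[_].
Qed.

Lemma dominated_cintegral (f_ : nat -> R -> R[i]) f (g : R -> R) :
  (forall n, cmeasurable (f_ n)) -> cmeasurable f ->
  {ae mu, forall x, (f_ ^~ x : nat -> R[i]^o) @ \oo --> (f x : R[i]^o)} ->
  integrableR g -> (forall n x, cabs (f_ n x) <= g x) ->
  (fun n => cintegral (f_ n) : R[i]^o) @ \oo --> (cintegral f : R[i]^o).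
Proof.
move=> mf_ [mf1 mf2] f_f ig f_g; apply/cvg_ReImP; split => /=.
- apply: (@dominated_Rintegral (fun n x => Re (f_ n x)) (fun x => Re (f x)) g).
  + by move=> n; case: (mf_ n).
  + exact: mf1.
  + by apply: ae_mono f_f => x /cvg_ReImP[].
  + exact: ig.
  + by move=> n x; exact: le_trans (ler_Re_cabs _) (f_g n x).
- apply: (@dominated_Rintegral (fun n x => Im (f_ n x)) (fun x => Im (f x)) g).
  + by move=> n; case: (mf_ n).
  + exact: mf2.
  + by apply: ae_mono f_f => x /cvg_ReImP[].
  + exact: ig.
  + by move=> n x; exact: le_trans (ler_Im_cabs _) (f_g n x).
Qed.

Lemma affine_cintegrable f (a b : R) : a != 0 -> cintegrable f ->
  cintegrable (fun x => f (a * x + b)).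
Proof.
move=> a0 [f1 f2].
by split; [have := affine_integrable b a0 f1|have := affine_integrable b a0 f2].
Qed.

Lemma affine_cintegral f (a b : R) : a != 0 -> cintegrable f ->
  cintegral (fun x => f (a * x + b)) = (`|a|^-1)%:C * cintegral f.
Proof.
move=> a0 [f1 f2]; apply: complexP.
  by rewrite ReM /= mul0r subr0; exact: affine_Rintegral f1.
by rewrite ImM /= mul0r addr0; exact: affine_Rintegral f2.
Qed.

Lemma translate_cintegral f (b : R) : cintegrable f ->
  cintegral (fun x => f (x + b)) = cintegral f.
Proof.
move=> fi; have := affine_cintegral b (oner_neq0 R) fi.
rewrite normr1 invr1 mul1r => <-.
by apply: eq_cintegral => x; rewrite mul1r.
Qed.

Lemma translate_cintegrable f (b : R) : cintegrable f ->
  cintegrable (fun x => f (x + b)).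
Proof.
move=> fi; have := affine_cintegrable b (oner_neq0 R) fi.
by under eq_fun do rewrite mul1r.
Qed.

End ComplexIntegral.

(** * Square-integrable functions *)

Section SquareIntegrable.
Context {R : realType}.
Local Notation mu := (@completed_lebesgue_measure R).
Implicit Types (f g F G : R -> R[i]) (c : R[i]).

Variant sqint F : Prop := SqInt of
  cmeasurable F & integrableR (fun x => cabs (F x) ^+ 2).

Definition sqnorm F : R := \int[mu]_x (cabs (F x) ^+ 2).

Lemma sqnorm_ge0 F : 0 <= sqnorm F.
Proof. by apply: Rintegral_ge0 => x _; exact: sqr_ge0. Qed.

Lemma sqint_le F (g : R -> R) : cmeasurable F -> integrableR g ->
  (forall x, cabs (F x) ^+ 2 <= g x) -> sqint F.
Proof.
move=> mF ig Fg; split=> //; apply: integrableR_le ig _ => [|x].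
  by apply: measurable_funX; exact: measurable_cabs.
by rewrite ger0_norm// sqr_ge0.
Qed.

Lemma sqintZ c F : sqint F -> sqint (fun x => c * F x).
Proof.
move=> [mF iF]; apply: (@sqint_le _ (fun x => cabs c ^+ 2 * cabs (F x) ^+ 2)).
- by apply: cmeasurableM => //; exact: cmeasurable_cst.
- exact: integrableRZ.
- by move=> x; rewrite cabsM exprMn.
Qed.

Lemma sqint_mul_bounded F G (M : R) : cmeasurable F -> (forall x, cabs (F x) <= M) ->
  sqint G -> sqint (fun x => F x * G x).
Proof.
move=> mF FM [mG iG]; apply: (@sqint_le _ (fun x => M ^+ 2 * cabs (G x) ^+ 2)).
- exact: cmeasurableM.
- exact: integrableRZ.
- move=> x; rewrite cabsM exprMn ler_wpM2r ?sqr_ge0//.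
  by rewrite lerXn2r ?nnegrE ?cabs_ge0// (le_trans (cabs_ge0 (F x))).
Qed.

Lemma sqintD F G : sqint F -> sqint G -> sqint (fun x => F x + G x).
Proof.
move=> [mF iF] [mG iG].
apply: (@sqint_le _ (fun x => 2 * cabs (F x) ^+ 2 + 2 * cabs (G x) ^+ 2)).
- exact: cmeasurableD.
- by apply: integrableRD; exact: integrableRZ.
- move=> x; apply: (@le_trans _ _ ((cabs (F x) + cabs (G x)) ^+ 2)).
    by rewrite lerXn2r ?nnegrE ?addr_ge0 ?cabs_ge0// cabsD.
  by have := sqr_ge0 (cabs (F x) - cabs (G x)); nra.
Qed.

Lemma sqintJ F : sqint F -> sqint (fun x => ((F x)^*)%R).
Proof.
move=> [mF iF]; split; first exact: cmeasurableJ.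
by under eq_fun do rewrite cabs_conj.
Qed.

Lemma sqint0 : sqint (fun _ => 0).
Proof.
split; first exact: cmeasurable_cst.
by under eq_fun do rewrite cabs0 expr0n /=; exact: integrable0.
Qed.

Lemma sqint_sum I (s : seq I) (P : pred I) (F : I -> R -> R[i]) :
  (forall i, P i -> sqint (F i)) -> sqint (fun x => \sum_(i <- s | P i) F i x).
Proof.
move=> mF; elim: s => [|i s IH].
  by under eq_fun do rewrite big_nil; exact: sqint0.
case: (boolP (P i)) => Pi; under eq_fun do rewrite big_cons ?Pi ?(negbTE Pi)//.
  exact: sqintD (mF i Pi) IH.
exact: IH.
Qed.

Lemma cintegrableM F G : sqint F -> sqint G -> cintegrable (fun x => F x * G x).
Proof.
move=> [mF iF] [mG iG].
apply: (@cintegrable_le _ _ (fun x => 1 * cabs (F x) ^+ 2 + cabs (G x) ^+ 2 / 1)).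
- exact: cmeasurableM.
- apply: integrableRD; first exact: integrableRZ.
  by under eq_fun do rewrite divr1.
- by move=> x; rewrite cabsM; exact: cabsM_le.
Qed.

Lemma sqint_affine F (a b : R) : a != 0 -> sqint F -> sqint (fun x => F (a * x + b)).
Proof.
move=> a0 [mF iF]; split; first exact: cmeasurable_affine.
exact: (affine_integrable b a0 iF).
Qed.

Lemma sqint_translate F (b : R) : sqint F -> sqint (fun x => F (x + b)).
Proof.
by move=> /(sqint_affine b (oner_neq0 R)); under eq_fun do rewrite mul1r.
Qed.

End SquareIntegrable.

Local Opaque cexpi cmeasurable.

(** * Pairings of square-integrable functions *)

Section Pairing.
Context {R : realType}.
Local Notation T := (@lebesgueTypeR R).
Local Notation mu := (@completed_lebesgue_measure R).
Implicit Types (f g F G H : R -> R[i]) (c : R[i]).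

Lemma cintegrable_pairing F G : sqint F -> sqint G ->
  cintegrable (fun x => F x * ((G x)^*)%R).
Proof. by move=> sF sG; exact: cintegrableM sF (sqintJ sG). Qed.

Lemma pairingDl F G H : sqint F -> sqint G -> sqint H ->
  pairing (fun x => F x + G x) H = pairing F H + pairing G H.
Proof.
move=> sF sG sH; rewrite /pairing -cintegralD; try exact: cintegrable_pairing.
by apply: eq_cintegral => x; rewrite mulrDl.
Qed.

Lemma pairingZl c F H : sqint F -> sqint H ->
  pairing (fun x => c * F x) H = c * pairing F H.
Proof.
move=> sF sH; rewrite /pairing -cintegralZ; try exact: cintegrable_pairing.
by apply: eq_cintegral => x; rewrite mulrA.
Qed.

Lemma pairing_sym F G : sqint F -> sqint G ->
  pairing G F = ((pairing F G)^*)%R.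
Proof.
move=> sF sG; rewrite /pairing -cintegralJ; try exact: cintegrable_pairing.
by apply: eq_cintegral => x; rewrite rmorphM /= conjCK mulrC.
Qed.

Lemma pairing_suml I (s : seq I) (F : I -> R -> R[i]) H :
  (forall i, sqint (F i)) -> sqint H ->
  pairing (fun x => \sum_(i <- s) F i x) H = \sum_(i <- s) pairing (F i) H.
Proof.
move=> sF sH; rewrite /pairing -cintegral_sum => [|i _]; last exact: cintegrable_pairing.
by apply: eq_cintegral => x; rewrite mulr_suml.
Qed.

Lemma pairing_sqnorm F : pairing F F = (sqnorm F)%:C.
Proof.
apply: complexP => /=.
- rewrite /sqnorm; apply: eq_Rintegral => x _.
  by rewrite ReM ReJ ImJ sqr_cabs -!expr2 mulrN opprK !expr2.
- rewrite /Rintegral; under eq_integral do rewrite ImM ReJ ImJ mulrN mulrC addNr.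
  by rewrite integral0.
Qed.

Lemma ae_eq_pairing F F' G : sqint F -> sqint F' -> sqint G ->
  {ae mu, forall x, F x = F' x} -> pairing F G = pairing F' G.
Proof.
move=> [mF _] [mF' _] [mG _] FF'; apply: ae_eq_cintegral.
- by apply: cmeasurableM; [exact: mF|exact: cmeasurableJ].
- by apply: cmeasurableM; [exact: mF'|exact: cmeasurableJ].
- by apply: ae_mono FF' => x ->.
Qed.

(** The weight [t] is free, so that one of the two functions may be made to
    contribute as little as desired. *)
Lemma cabs_pairing F G (t : R) : 0 < t -> sqint F -> sqint G ->
  cabs (pairing F G) <= 2 * (t * sqnorm F + sqnorm G / t).
Proof.
move=> t0 sF sG; have fi := cintegrable_pairing sF sG.
rewrite (le_trans (cabs_cintegral fi))// ler_pM2l//.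
have iF : integrableR (fun x => t * cabs (F x) ^+ 2).
  by apply: integrableRZ; case: sF.
have iG : integrableR (fun x => t^-1 * cabs (G x) ^+ 2).
  by apply: integrableRZ; case: sG.
have -> : t * sqnorm F + sqnorm G / t =
    \int[mu]_x (t * cabs (F x) ^+ 2 + t^-1 * cabs (G x) ^+ 2).
  rewrite RintegralD// !RintegralZl//; first by rewrite [X in _ + X]mulrC.
    by case: sG.
  by case: sF.
apply: Rintegral_le; [exact: cintegrable_cabs|exact: integrableRD|].
by move=> x; rewrite cabsM cabs_conj (le_trans (cabsM_le _ _ t0))// [X in _ + X]mulrC.
Qed.

Lemma pairing0l F : pairing (fun _ => 0) F = 0.
Proof. by rewrite /pairing; under eq_cintegral do rewrite mul0r; exact: cintegral0. Qed.

Lemma sqint_cmeasurable F : sqint F -> cmeasurable F. Proof. by case. Qed.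

End Pairing.

(** * Parseval's identity on one period *)

Section Parseval.
Context {R : realType}.
Local Notation T := (@lebesgueTypeR R).
Local Notation mu := (@completed_lebesgue_measure R).
Local Notation Re := complex.Re.
Local Notation Im := complex.Im.
Implicit Types (f g F G H : R -> R[i]) (c : R[i]) (j k : int).

Definition cell : set R := `[0, 2 * pi[%classic.

Lemma measurable_cell : @measurable _ T cell.
Proof. exact: itv_lebesgue_measurable. Qed.

Lemma cell_measure : mu cell = (2 * pi)%:E.
Proof.
change ((@lebesgue_measure R) cell = (2 * pi)%:E).
by rewrite lebesgue_measure_itv /= lte_fin mulr_gt0 ?pi_gt0// -EFinB subr0.
Qed.

Lemma integrableR_indic (A : set R) (a b : R) : @measurable _ T A ->
  A `<=` `[a, b] -> integrableR (\1_A : R -> R).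
Proof.
move=> mA Aab; apply/integrableP; split.
  by apply/measurable_EFinP; exact: measurable_indic.
have -> : (\int[mu]_x `|(EFin \o \1_A) x| = mu A)%E.
  rewrite -[in RHS](setIT A) -integral_indic//.
  by apply: eq_integral => x _ /=; rewrite ger0_norm.
apply: (@le_lt_trans _ _ (mu `[a, b]%classic)).
  by apply: le_measure; rewrite ?inE//; exact: itv_lebesgue_measurable.
change ((@lebesgue_measure R) `[a, b] < +oo)%E.
by rewrite lebesgue_measure_itv /=; case: ifPn => // _; rewrite ltry.
Qed.

Lemma sqint_indic (A : set R) (a b : R) : @measurable _ T A ->
  A `<=` `[a, b] -> sqint (fun x => (\1_A x)%:C).
Proof.
move=> mA Aab; split; first exact: cmeasurable_indic.
have := integrableR_indic mA Aab; congr (integrableR _); apply/funext => x.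
by rewrite cabs_real real_normK ?num_real// indicE; case: (x \in A); rewrite ?expr1n ?expr0n.
Qed.

Lemma cell_sub : cell `<=` `[0, 2 * pi].
Proof. by rewrite /cell => x /=; rewrite !in_itv /= => /andP[-> /ltW]. Qed.

(** The exponentials of one period.  The sign in the exponent makes
    [pairing F (expo k)] the Fourier coefficient that occurs in frame
    terms. *)
Definition expo k (x : R) : R[i] := (\1_cell x)%:C * cexpi (- k%:~R * x).

Lemma sqint_expo k : sqint (expo k).
Proof.
rewrite /expo; under eq_fun do rewrite mulrC.
apply: (@sqint_mul_bounded _ _ _ 1).
- exact: cmeasurable_cexpi.
- by move=> x; rewrite cabs_cexpi.
- exact: sqint_indic measurable_cell cell_sub.
Qed.

(** The integral over one period is invariant under translations; a
    translation by half a wavelength shows that a nonconstant exponential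
    integrates to zero. *)
Let cell_integral_shift (h : R -> R[i]) (b : R) : 0 < b < 2 * pi ->
  (forall x, h (x + 2 * pi) = h x) -> (forall x, cabs (h x) <= 1) ->
  cmeasurable h ->
  cintegral (fun x => (\1_cell x)%:C * h (x + b)) =
  cintegral (fun x => (\1_cell x)%:C * h x).
Proof.
move=> /andP[b0 b2] hper h1 mh.
have ci (A : set R) (u v : R) : @measurable _ T A -> A `<=` `[u, v] ->
    cintegrable (fun x => (\1_A x)%:C * h x).
  move=> mA Auv; apply: (@cintegrable_le _ _ (\1_A)).
  - by apply: cmeasurableM; [exact: cmeasurable_indic|exact: mh].
  - exact: integrableR_indic mA Auv.
  - move=> x; rewrite cabsM cabs_real ger0_norm//.
    by rewrite -[leRHS]mulr1 ler_wpM2l.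
have mitv (i : interval R) := itv_lebesgue_measurable i.
have sub1 (x y : R) : `[x, y[ `<=` `[x, y].
  by move=> z /=; rewrite !in_itv /= => /andP[-> /ltW].
pose A := `[b, (2 * pi)[%classic : set R.
pose B := `[0, b[%classic : set R.
have iA := ci A _ _ (mitv _) (@sub1 _ _).
have iB := ci B _ _ (mitv _) (@sub1 _ _).
have cAB x : \1_cell x = \1_A x + \1_B x :> R.
  rewrite !indicE /cell /A /B !mem_setE !in_itv /=.
  have [xb|bx] := ltP x b.
    by rewrite (lt_trans xb b2) !andbT add0r.
  have -> : 0 <= x by exact: le_trans (ltW b0) bx.
  by rewrite ?bx /= addr0.
have cellb x : \1_cell (x - b) = \1_A x + \1_B (x - 2 * pi) :> R.
  rewrite !indicE /cell /A /B !mem_setE !in_itv /= subr_ge0 ltrBlDr subr_ge0 ltrBlDr.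
  have [x2|x2] := ltP x (2 * pi).
    have -> : x < 2 * pi + b by rewrite (lt_trans x2)// ltrDl.
    by rewrite !andbT addr0.
  have -> : b <= x by exact: le_trans (ltW b2) x2.
  by rewrite andbF add0r (addrC b).
have hB x : (\1_B (x - 2 * pi))%:C * h x =
    (\1_B (x + - (2 * pi)))%:C * h (x + - (2 * pi)).
  by congr (_ * _); rewrite -[in RHS]hper subrK.
have iB' : cintegrable (fun x => (\1_B (x - 2 * pi))%:C * h x).
  by under eq_fun do rewrite hB; exact: (translate_cintegrable (- (2 * pi)) iB).
transitivity (cintegral (fun x => (\1_cell (x - b))%:C * h x)).
  rewrite -(@translate_cintegral _ (fun x => (\1_cell (x - b))%:C * h x) b).
    by apply: eq_cintegral => x; rewrite addrK.
  under eq_fun do rewrite cellb rmorphD mulrDl.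
  by apply: cintegrableD; [exact: iA|exact: iB'].
under eq_cintegral do rewrite cellb rmorphD mulrDl.
rewrite cintegralD//.
under [in X in _ + X]eq_cintegral do rewrite hB.
rewrite (translate_cintegral _ iB).
under [in RHS]eq_cintegral do rewrite cAB rmorphD mulrDl.
by rewrite cintegralD.
Qed.

Let cintegral_cexpi k : k != 0 ->
  cintegral (fun x : R => (\1_cell x)%:C * cexpi (- k%:~R * x)) = 0.
Proof.
move=> k0; have kR0 : `|k%:~R| != 0 :> R by rewrite normr_eq0 intr_eq0.
have k_ge1 : 1 <= `|k%:~R| :> R.
  by rewrite -intr_norm -[1]/(1%:~R) ler_int -gtz0_ge1 normr_gt0.
set I := cintegral _.
pose b : R := pi / `|k%:~R|.
have b02 : 0 < b < 2 * pi.
  rewrite divr_gt0 ?pi_gt0 ?normr_gt0 ?intr_eq0//=.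
  rewrite ltr_pdivrMr ?(lt_le_trans ltr01)//.
  have := pi_gt0 R; nra.
have eb x : cexpi (- k%:~R * (x + b)) = -1 * cexpi (- k%:~R * x) :> R[i].
  rewrite mulrDr cexpiD mulrC; congr (_ * _).
  have -> : cexpi (- k%:~R * b) = cexpi pi :> R[i].
    have [k_ge0|k_lt0] := leP 0 (k%:~R : R).
      rewrite /b ger0_norm// mulrC mulrN divfK; last by rewrite intr_eq0.
      by rewrite cexpiNpi cexpi_pi.
    by rewrite /b ltr0_norm// mulrC divfK// oppr_eq0 intr_eq0.
  exact: cexpi_pi.
have I_opp : I = -1 * I.
  have per (x : R) : cexpi (- k%:~R * (x + 2 * pi)) = cexpi (- k%:~R * x).
    by rewrite mulrDr -[RHS](cexpi_periodic _ (- k)) rmorphN [X in _ + X]mulrC.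
  have le1 (x : R) : cabs (cexpi (- k%:~R * x)) <= 1 by rewrite cabs_cexpi.
  rewrite {1}/I -(cell_integral_shift b02 per le1 (cmeasurable_cexpi _)).
  under eq_cintegral do rewrite eb mulrCA.
  rewrite cintegralZ//; apply: (@cintegrable_le _ _ (\1_cell)).
  - by apply: cmeasurableM; [exact: cmeasurable_indic measurable_cell|exact: cmeasurable_cexpi].
  - exact: integrableR_indic measurable_cell cell_sub.
  - by move=> x; rewrite cabsM cabs_real cabs_cexpi mulr1 ger0_norm.
have : I + I = 0 by rewrite {1}I_opp mulN1r addNr.
by move/eqP; rewrite -mulr2n -mulr_natl mulf_eq0 pnatr_eq0 /= => /eqP.
Qed.

Lemma pairing_expo j k :
  pairing (expo j) (expo k) = if j == k then (2 * pi)%:C else 0.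
Proof.
have E x : expo j x * ((expo k x)^*)%R =
    (\1_cell x)%:C * cexpi (- (j - k)%:~R * x) :> R[i].
  rewrite /expo rmorphM /= -cexpiN conjcE conjc_real mulrACA -cexpiD -rmorphM /=.
  congr (_%:C * cexpi _).
    by rewrite indicE; case: (x \in cell); rewrite ?mulr1 ?mulr0.
  by rewrite rmorphB /=; ring.
rewrite /pairing (eq_cintegral E); case: eqP => [->|/eqP jk]; last first.
  by apply: cintegral_cexpi; rewrite subr_eq0.
rewrite subrr oppr0.
have -> : (fun x : R => (\1_cell x)%:C * cexpi (0 * x)) = (fun x => (\1_cell x)%:C) :> (R -> R[i]).
  by apply/funext => x; rewrite mul0r cexpi0 mulr1.
Local Transparent cintegral.
apply: complexP => /=.
- rewrite /Rintegral integral_indic//; last exact: measurable_cell.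
  by rewrite setIT [X in fine X]cell_measure.
- by rewrite /Rintegral integral0.
Qed.
Local Opaque cintegral.

End Parseval.

Local Opaque cintegral integrableR sqnorm pairing csumZ abs_summable expo.

Section ParsevalCell.
Context {R : realType}.
Local Notation T := (@lebesgueTypeR R).
Local Notation mu := (@completed_lebesgue_measure R).
Local Notation Re := complex.Re.
Implicit Types (f g F G H : R -> R[i]) (c : R[i]) (j k : int).

Let tau : R := 2 * pi.
Let tau_gt0 : 0 < tau. Proof. by rewrite mulr_gt0 ?pi_gt0. Qed.

Definition coef F k : R[i] := pairing F (expo k).

(** Subtracting from [F] its projection on the exponentials leaves a function
    [H] orthogonal to them, and the bound is the positivity of its square norm. *)
Lemma bessel F (s : seq int) : uniq s -> sqint F ->
  \sum_(k <- s) cabs (coef F k) ^+ 2 <= tau * sqnorm F.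
Proof.
move=> us sF.
pose c k := - (coef F k / tau%:C).
pose q x := \sum_(k <- s) c k * expo k x.
pose H x := F x + q x.
have tau0 : tau%:C != 0 :> R[i] by rewrite eq_complex /= eqxx andbT gt_eqF.
have sc k : sqint (fun x => c k * expo k x) by apply: sqintZ; exact: sqint_expo.
have sq : sqint q by apply: sqint_sum.
have sH : sqint H by exact: sqintD.
have coefH k : k \in s -> pairing H (expo k) = 0.
  move=> ks; rewrite /H (pairingDl sF sq (sqint_expo k)).
  rewrite (pairing_suml s sc (sqint_expo k)) (bigD1_seq k) //=.
  rewrite (pairingZl (c k) (sqint_expo k) (sqint_expo k)) pairing_expo eqxx.
  rewrite big1 => [|j jk].
    by rewrite addr0 /c mulNr divfK// -/(coef F k) addrN.
  rewrite (pairingZl (c j) (sqint_expo j) (sqint_expo k)) pairing_expo.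
  by rewrite (negbTE jk) mulr0.
have HF : pairing H H = pairing F H.
  rewrite {1}/H (pairingDl sF sq sH) (pairing_suml s sc sH).
  rewrite [X in _ + X]big_seq [X in _ + X]big1 ?addr0// => k ks.
  rewrite (pairingZl (c k) (sqint_expo k) sH).
  by rewrite (pairing_sym sH (sqint_expo k)) coefH// rmorph0 mulr0.
have FH : pairing H F = (sqnorm F - tau^-1 * \sum_(k <- s) cabs (coef F k) ^+ 2)%:C.
  rewrite /H (pairingDl sF sq sF) pairing_sqnorm (pairing_suml s sc sF).
  rewrite rmorphB rmorphM /= rmorph_sum /= mulr_sumr; congr (_ + _).
  rewrite -sumrN; apply: eq_bigr => k _.
  rewrite (pairingZl (c k) (sqint_expo k) sF) (pairing_sym sF (sqint_expo k)).
  rewrite -/(coef F k) /c mulNr mulrAC; congr (- _).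
  rewrite mulrC fmorphV; congr (_ * _).
  apply: complexP; rewrite ?ReM ?ImM ReJ ImJ /=.
    by rewrite sqr_cabs mulrN opprK !expr2.
  by rewrite mulrN mulrC addNr.
have : 0 <= sqnorm H by exact: sqnorm_ge0.
have : (sqnorm H)%:C = (sqnorm F - tau^-1 * \sum_(k <- s) cabs (coef F k) ^+ 2)%:C :> R[i].
  by rewrite -pairing_sqnorm HF (pairing_sym sH sF) FH conjcE conjc_real.
move=> /complexI ->; rewrite subr_ge0 => h.
by rewrite -ler_pdivrMl.
Qed.

Definition coef_prod F G k := coef F k * ((coef G k)^*)%R.

Let psumZ_coef_prod F G (t : R) n : 0 < t -> sqint F -> sqint G ->
  psumZ (cabs \o coef_prod F G) n <= tau * (t * sqnorm F + sqnorm G / t).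
Proof.
move=> t0 sF sG; rewrite psumZ_zseq.
apply: (@le_trans _ _ (\sum_(k <- zseq n)
    (t * cabs (coef F k) ^+ 2 + cabs (coef G k) ^+ 2 / t))).
  by apply: ler_sum => k _; rewrite /= cabsM cabs_conj cabsM_le.
rewrite big_split /= -mulr_sumr -mulr_suml.
have -> : tau * (t * sqnorm F + sqnorm G / t) =
  t * (tau * sqnorm F) + tau * sqnorm G / t by ring.
rewrite lerD//.
  by rewrite ler_pM2l//; exact: (bessel (uniq_zseq n) sF).
by rewrite ler_pM2r ?invr_gt0//; exact: (bessel (uniq_zseq n) sG).
Qed.

Lemma abs_summable_coef F G : sqint F -> sqint G -> abs_summable (coef_prod F G).
Proof. by move=> sF sG; apply: abs_summableP => n; exact: (psumZ_coef_prod _ ltr01). Qed.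

Let csumZ_coef_le F G (t : R) : 0 < t -> sqint F -> sqint G ->
  cabs (csumZ (coef_prod F G)) <= tau * (t * sqnorm F + sqnorm G / t).
Proof.
move=> t0 sF sG; apply: cvg_cabs_le (csumZ_cvg (abs_summable_coef sF sG)) _ => n.
apply: le_trans (psumZ_coef_prod n t0 sF sG).
by rewrite !psumZ_zseq cabs_sum.
Qed.

(** The functions for which the polarized Parseval identity against [G]
    holds.  This class is a linear space containing the exponentials and stable
    under dominated limits, and it is shown to be everything. *)
Variant parseval G F : Prop := Parseval of
  sqint F & csumZ (coef_prod F G) = tau%:C * pairing F G.

Section FixedG.
Variables (G : R -> R[i]) (sG : sqint G).

Let coef_prodD F F' k : sqint F -> sqint F' ->
  coef_prod (fun x => F x + F' x) G k = coef_prod F G k + coef_prod F' G k.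
Proof.
by move=> sF sF'; rewrite /coef_prod /coef (pairingDl sF sF' (sqint_expo k)) mulrDl.
Qed.

Let coef_prodZ c F k : sqint F ->
  coef_prod (fun x => c * F x) G k = c * coef_prod F G k.
Proof.
by move=> sF; rewrite /coef_prod /coef (pairingZl c sF (sqint_expo k)) mulrA.
Qed.

Lemma parsevalD F F' : parseval G F -> parseval G F' ->
  parseval G (fun x => F x + F' x).
Proof.
move=> [sF PF] [sF' PF']; split; first exact: sqintD.
rewrite (_ : coef_prod _ G = fun k => coef_prod F G k + coef_prod F' G k); last first.
  by apply/funext => k; exact: coef_prodD.
rewrite (csumZD (abs_summable_coef sF sG) (abs_summable_coef sF' sG)).
by rewrite PF PF' (pairingDl sF sF' sG) mulrDr.
Qed.

Lemma parsevalZ c F : parseval G F -> parseval G (fun x => c * F x).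
Proof.
move=> [sF PF]; split; first exact: sqintZ.
rewrite (_ : coef_prod _ G = fun k => c * coef_prod F G k); last first.
  by apply/funext => k; exact: coef_prodZ.
by rewrite (csumZZ c (abs_summable_coef sF sG)) PF (pairingZl c sF sG) mulrCA.
Qed.

Lemma parseval0 : parseval G (fun _ => 0).
Proof.
split; first exact: sqint0.
rewrite pairing0l mulr0; apply: csumZ_unique; first exact: abs_summable_coef sqint0 sG.
rewrite (_ : psumZ _ = fun=> 0); last first.
  by apply/funext => n; rewrite /psumZ big1// => k _; rewrite /coef_prod /coef !pairing0l !mul0r addr0.
exact: (@cvg_cst R[i]^o).
Qed.

Lemma parseval_sum I (s : seq I) (F : I -> R -> R[i]) :
  (forall i, parseval G (F i)) -> parseval G (fun x => \sum_(i <- s) F i x).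
Proof.
move=> PF; elim: s => [|i s IH]; first by under eq_fun do rewrite big_nil; exact: parseval0.
by under eq_fun do rewrite big_cons; exact: parsevalD.
Qed.

Lemma parseval_ae F F' : parseval G F -> sqint F' ->
  {ae mu, forall x, F x = F' x} -> parseval G F'.
Proof.
move=> [sF PF] sF' FF'; split => //; rewrite -(ae_eq_pairing sF sF' sG FF') -PF.
congr csumZ; apply/funext => k.
by rewrite /coef_prod /coef (ae_eq_pairing sF sF' (sqint_expo k) FF').
Qed.

Lemma parseval_expo k : parseval G (expo k).
Proof.
split; first exact: sqint_expo.
have sk := sqint_expo k : sqint (expo k : R -> R[i]).
rewrite (pairing_sym sG sk); apply: csumZ_unique.
  exact: abs_summable_coef.
have cE j : coef_prod (expo k) G j = if j == k then tau%:C * ((coef G k)^*)%R else 0.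
  rewrite /coef_prod {1}/coef pairing_expo eq_sym.
  by case: eqP => [->//|]; rewrite mul0r.
apply: cvg_near_cst; exists `|k|.+1%N => // n /= kn.
rewrite psumZ_zseq (bigD1_seq k) ?uniq_zseq//=; last first.
  rewrite mem_cat; case: k kn {sk cE} => m /= mn; apply/orP.
    by left; apply: map_f; rewrite mem_iota.
  by right; apply: map_f; rewrite mem_iota /= add0n ltnW.
by rewrite cE eqxx big1 ?addr0// => j /negbTE jk; rewrite cE jk.
Qed.

(** Bessel's inequality and the Cauchy-Schwarz inequality bound the two sides of
    the identity by the same quantity, so both are continuous in square norm. *)
Lemma parseval_lim (F_ : nat -> R -> R[i]) F : (forall n, parseval G (F_ n)) ->
  sqint F -> (fun n => sqnorm (fun x => F x + -1 * F_ n x)) @ \oo --> (0 : R) ->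
  parseval G F.
Proof.
move=> PF sF FF; split => //; apply/eqP; rewrite -subr_eq0; apply/eqP/cabs_eq0.
set D := _ - _.
have key n t : 0 < t ->
    cabs D <= 3 * tau * (t * sqnorm (fun x => F x + -1 * F_ n x) + sqnorm G / t).
  move=> t0; have [sFn PFn] := PF n.
  have sN : sqint (fun x => -1 * F_ n x) by exact: sqintZ.
  have sE : sqint (fun x => F x + -1 * F_ n x) by exact: sqintD.
  have -> : D = csumZ (coef_prod (fun x => F x + -1 * F_ n x) G) -
      tau%:C * pairing (fun x => F x + -1 * F_ n x) G.
    rewrite (_ : coef_prod _ G = fun k => coef_prod F G k + -1 * coef_prod (F_ n) G k); last first.
      by apply/funext => k; rewrite coef_prodD ?coef_prodZ.
    rewrite (csumZD (abs_summable_coef sF sG)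
      (abs_summableZ (-1) (abs_summable_coef sFn sG))).
    rewrite (csumZZ (-1) (abs_summable_coef sFn sG)).
    rewrite (pairingDl sF sN sG) (pairingZl (-1) sFn sG) PFn /D; ring.
  rewrite (le_trans (cabsD _ _))// cabsN cabsM cabs_real (gtr0_norm tau_gt0).
  apply: le_trans (lerD (csumZ_coef_le t0 sE sG)
    (ler_wpM2l (ltW tau_gt0) (cabs_pairing t0 sE sG))) _.
  by rewrite le_eqVlt; apply/orP; left; apply/eqP; ring.
apply/eqP; rewrite eq_le cabs_ge0 andbT; apply/ler_addgt0Pr => e e0; rewrite add0r.
(* The weight [t] makes the contribution of [G] at most [e / 2]; the index [n] is
   then chosen so that the distance to [F] contributes at most [e / 2]. *)
pose K := 3 * tau.
have K0 : 0 < K by rewrite mulr_gt0.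
pose t := 2 * K * (sqnorm G + 1) / e.
have N1 : 0 < sqnorm G + 1 by apply: ltr_wpDl => //; exact: sqnorm_ge0.
have t0 : 0 < t.
  by apply: divr_gt0 => //; apply: mulr_gt0 => //; apply: mulr_gt0.
move/cvgrPdist_lt : FF => /(_ (e / (2 * K * t))) [|n _ Hn].
  by apply: divr_gt0 => //; apply: mulr_gt0 => //; apply: mulr_gt0.
have := Hn n (leqnn n); rewrite sub0r normrN ger0_norm ?sqnorm_ge0// => hn.
apply: le_trans (key n t t0) _; rewrite -/K mulrDr [e]splitr lerD//.
  set N := sqnorm _ in hn *.
  have Kt0 : 0 < 2 * K * t by apply: mulr_gt0 => //; apply: mulr_gt0.
  by move: hn; rewrite ltr_pdivlMr// => /ltW; rewrite ler_pdivlMr//; lra.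
have -> : K * (sqnorm G / t) = e / 2 * (sqnorm G / (sqnorm G + 1)).
  by rewrite /t; field; rewrite !gt_eqF.
by rewrite ler_piMr// ?divr_ge0// ?ltW// ltr_pdivrMr ?mul1r ?ltrDl.
Qed.

Lemma parseval_dominated (F_ : nat -> R -> R[i]) F (g : R -> R) :
  (forall n, parseval G (F_ n)) -> cmeasurable F -> integrableR g ->
  (forall n x, cabs (F_ n x) ^+ 2 <= g x) -> (forall x, cabs (F x) ^+ 2 <= g x) ->
  {ae mu, forall x, (F_ ^~ x : nat -> R[i]^o) @ \oo --> (F x : R[i]^o)} ->
  parseval G F.
Proof.
move=> PF mF ig Fng Fg FF.
have sF : sqint F by exact: sqint_le ig Fg.
apply: (parseval_lim PF sF).
have mD n : cmeasurable (fun x => F x + -1 * F_ n x).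
  apply: cmeasurableD; first exact: mF.
  apply: cmeasurableM; first exact: cmeasurable_cst.
  by case: (PF n) => /sqint_cmeasurable.
have -> : 0 = \int[mu]_x (0 : R) by rewrite /Rintegral integral0.
apply: (@dominated_Rintegral _ _ _ (fun x => 4 * g x)).
- by move=> n; apply: measurable_funX; exact: measurable_cabs.
- exact: measurable_cst.
- apply: ae_mono FF => x /cvg_cabsP h.
  rewrite (_ : (fun n => _) = fun n => cabs (F_ n x - F x) ^+ 2); last first.
    by apply/funext => n; rewrite -cabsN opprD mulN1r opprK addrC.
  have -> : 0 = 0 ^+ 2 :> R by rewrite expr0n.
  by under eq_fun do rewrite expr2; rewrite expr2; exact: cvgM.
- exact: integrableRZ.
- move=> n x; rewrite ger0_norm ?sqr_ge0//.
  have h : cabs (F x + -1 * F_ n x) <= cabs (F x) + cabs (F_ n x).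
    by rewrite (le_trans (cabsD _ _))// mulN1r cabsN.
  have h1 := Fng n x; have h2 := Fg x; have h3 := cabs_ge0 (F x).
  have h4 := cabs_ge0 (F_ n x); have h5 := cabs_ge0 (F x + -1 * F_ n x).
  have h6 := sqr_ge0 (cabs (F x) - cabs (F_ n x)).
  nra.
Qed.

End FixedG.
End ParsevalCell.

Local Transparent expo.

(** * From exponentials to square-integrable functions on one period *)

Section PeakPolynomials.
Context {R : realType}.
Implicit Types u x : R.

Let bernoulli_ge u n : 0 <= u <= 1 -> 1 - n%:R * u <= (1 - u) ^+ n.
Proof.
move=> /andP[u0 u1]; elim: n => [|n IH]; first by rewrite mul0r subr0 expr0.
rewrite exprS (le_trans _ (ler_wpM2l _ IH)) ?subr_ge0//.
have := mulr_ge0 (ler0n R n) (sqr_ge0 u); rewrite -(natr1 n); nra.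
Qed.

Let bernoulli_le u n : 0 <= u <= 1 -> (1 - u) ^+ n * (1 + n%:R * u) <= 1.
Proof.
move=> /andP[u0 u1]; elim: n => [|n IH]; first by rewrite mul0r addr0 expr0 mul1r.
apply: le_trans IH; rewrite exprSr -mulrA ler_wpM2l ?exprn_ge0 ?subr_ge0//.
have := mulr_ge0 (ler0n R n) (sqr_ge0 u); have := sqr_ge0 u; rewrite -(natr1 n); nra.
Qed.

(** Polynomials in [u] that converge on [[0, 1]] to the indicator function of
    the points below one half, except at one half, by the two Bernoulli inequalities: the exponent
    [2 ^ n] compares with [u ^ n] through the powers of [2 * u]. *)
Definition peak u n : R := (1 - u ^+ n) ^+ (2 ^ n)%N.

Lemma peak_itv u n : 0 <= u <= 1 -> 0 <= peak u n <= 1.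
Proof.
move=> /andP[u0 u1].
have h : 0 <= 1 - u ^+ n <= 1.
  by rewrite subr_ge0 exprn_ile1//= gerBl exprn_ge0.
by case/andP: h => h0 h1; rewrite /peak exprn_ge0//= exprn_ile1.
Qed.

Lemma peak_cvg1 u : 0 <= u < 1 / 2 -> peak u @ \oo --> (1 : R).
Proof.
move=> /andP[u0 u2].
have u01 : 0 <= u <= 1 by rewrite u0; lra.
have h : (fun n => 1 - (2 * u) ^+ n) @ \oo --> (1 : R).
  rewrite -[X in _ --> X]subr0; apply: cvgB; first exact: cvg_cst.
  by apply: cvg_expr; rewrite ger0_norm ?mulr_ge0//; lra.
apply: (squeeze_cvgr _ h (cvg_cst (1 : R))).
apply: nearW => n; case/andP: (peak_itv n u01) => _ ->; rewrite andbT.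
apply: le_trans (bernoulli_ge (2 ^ n)%N _).
  by rewrite natrX exprMn.
by rewrite exprn_ge0//= exprn_ile1//; case/andP: u01.
Qed.

Lemma peak_cvg0 u : 1 / 2 < u <= 1 -> peak u @ \oo --> (0 : R).
Proof.
move=> /andP[u2 u1].
have u0 : 0 < u by lra.
have u01 : 0 <= u <= 1 by rewrite ltW.
have h : (fun n => ((2 * u)^-1) ^+ n) @ \oo --> (0 : R).
  apply: cvg_expr; rewrite ger0_norm ?invr_ge0 ?mulr_ge0 ?ltW//.
  by rewrite invf_lt1 ?mulr_gt0//; lra.
apply: (squeeze_cvgr _ (cvg_cst (0 : R)) h).
apply: nearW => n; case/andP: (peak_itv n u01) => p0 _; rewrite p0 /=.
have v01 : 0 <= u ^+ n <= 1 by have u0' := ltW u0; rewrite exprn_ge0//= exprn_ile1.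
have := bernoulli_le (2 ^ n)%N v01; rewrite -/(peak u n) natrX -exprMn => hb.
have un0 : 0 < (2 * u) ^+ n by rewrite exprn_gt0// mulr_gt0.
rewrite exprVn -[leRHS]mul1r ler_pdivlMr//; apply: le_trans hb.
by rewrite ler_wpM2l// lerDr.
Qed.

End PeakPolynomials.

Section TrigPolynomials.
Context {R : realType}.
Implicit Types (p q : R -> R[i]).

Definition trig p := exists s : seq (R[i] * int),
  forall x, p x = \sum_(a <- s) a.1 * cexpi (- a.2%:~R * x).

Lemma trig_exp k : trig (fun x => cexpi (- k%:~R * x)).
Proof. by exists [:: (1, k)] => x; rewrite big_seq1 mul1r. Qed.

Lemma trig_cst c : trig (fun _ => c).
Proof. by exists [:: (c, 0)] => x; rewrite big_seq1 /= oppr0 mul0r cexpi0 mulr1. Qed.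

Lemma trigD p q : trig p -> trig q -> trig (fun x => p x + q x).
Proof. by move=> [s ps] [t qt]; exists (s ++ t) => x; rewrite big_cat /= ps qt. Qed.

Lemma trigM p q : trig p -> trig q -> trig (fun x => p x * q x).
Proof.
move=> [s ps] [t qt].
exists [seq (a.1 * b.1, a.2 + b.2) | a <- s, b <- t] => x.
rewrite big_allpairs_dep ps qt mulr_suml; apply: eq_bigr => a _.
rewrite mulr_sumr; apply: eq_bigr => b _ /=.
by rewrite rmorphD opprD mulrDl cexpiD mulrACA.
Qed.

Lemma trigX p n : trig p -> trig (fun x => p x ^+ n).
Proof.
move=> tp; elim: n => [|n IH]; first by under eq_fun do rewrite expr0; exact: trig_cst.
by under eq_fun do rewrite exprS; exact: trigM.
Qed.

Lemma trig_cos c : trig (fun x => (cos (x - c))%:C).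
Proof.
have -> : (fun x => (cos (x - c))%:C) =
    (fun x => 2^-1 * cexpi (- c) * cexpi (- (-1)%:~R * x) +
              2^-1 * cexpi c * cexpi (- 1%:~R * x)) :> (R -> R[i]).
  apply/funext => x; rewrite -!mulrA -!cexpiD -mulrDr.
  have -> : - c + - (-1)%:~R * x = x - c by rewrite mulrN1z; ring.
  have -> : c + - 1%:~R * x = - (x - c) by rewrite mulr1z; ring.
  rewrite cexpiN; have -> : 2^-1 = (2^-1)%:C :> R[i] by rewrite fmorphV rmorph_nat.
  apply: complexP; rewrite ?ReM ?ImM ?ReD ?ImD ?ReJ ?ImJ ?Re_cexpi ?Im_cexpi /=.
    by field.
  by ring.
have h c' k : trig (fun x => 2^-1 * cexpi c' * cexpi (- k%:~R * x)).
  by apply: trigM; [exact: trig_cst|exact: trig_exp].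
exact: trigD (h _ _) (h _ _).
Qed.

End TrigPolynomials.

Section DisjointIndicators.
Context {R : realType} {U : Type} (F : nat -> set U).
Implicit Types (x : U).

Let S n x : R := \sum_(i <- iota 0 n) \1_(F i) x.

Let S_in m x n : trivIset setT F -> F m x -> S n x = (m < n)%:R.
Proof.
move=> tF Fmx; have Fi i : i != m -> \1_(F i) x = 0 :> R.
  move=> im; rewrite indicE memNset// => Fix.
  by move/eqP: im; apply; apply: tF => //; exists x.
rewrite /S; case: ltnP => mn.
  rewrite (bigD1_seq m) ?iota_uniq ?mem_iota//= big1 ?addr0//.
  by rewrite indicE mem_set.
rewrite big_seq big1// => i; rewrite mem_iota add0n => /andP[_ i_n].
by apply: Fi; rewrite neq_ltn (leq_trans i_n mn).
Qed.

Let S_out x n : ~ (\bigcup_m F m) x -> S n x = 0.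
Proof.
move=> xF; rewrite /S big1// => i _; rewrite indicE memNset// => Fix.
by apply: xF; exists i.
Qed.

Lemma sum_indic01 n x : trivIset setT F ->
  \sum_(i <- iota 0 n) \1_(F i) x = 0 :> R \/
  \sum_(i <- iota 0 n) \1_(F i) x = 1 :> R.
Proof.
move=> tF; rewrite -/(S n x).
have [[m _ Fmx]|xF] := pselect ((\bigcup_m F m) x); last by left; exact: S_out.
by rewrite (S_in _ tF Fmx); case: (m < n)%N; [right|left].
Qed.

Lemma sum_indic_cvg x : trivIset setT F ->
  (fun n => \sum_(i <- iota 0 n) \1_(F i) x : R) @ \oo --> (\1_(\bigcup_m F m) x : R).
Proof.
move=> tF; rewrite indicE; have [[m _ Fmx]|xF] := pselect ((\bigcup_m F m) x).
  rewrite mem_set; last by exists m.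
  apply: cvg_near_cst; exists m.+1 => // n /= mn.
  by rewrite -/(S n x) (S_in n tF Fmx) mn.
by rewrite memNset//; apply: cvg_near_cst; apply: nearW => n; rewrite -/(S n x) S_out.
Qed.

End DisjointIndicators.

Section ParsevalDensity.
Context {R : realType} (G : R -> R[i]) (sG : sqint G).
Local Notation T := (@lebesgueTypeR R).
Local Notation mu := (@completed_lebesgue_measure R).
Local Notation Re := complex.Re.

Lemma ae_notin (s : seq R) : {ae mu, forall x, x \notin s}.
Proof.
elim: s => [|a s IH]; first exact: aeW.
have na : {ae mu, forall x, x != a}.
  apply: negligible_completed; exists [set a]; split => //.
    exact: lebesgue_measure_set1.
  by move=> x /= /negP; rewrite negbK => /eqP.
by apply: ae_mono (ae_and na IH) => x [xa xs]; rewrite inE negb_or xa.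
Qed.

Let in_cellP (x : R) : reflect (0 <= x < 2 * pi) (x \in (cell : set R)).
Proof. by rewrite /cell mem_setE in_itv /=; exact: idP. Qed.

Let indic01 (A : set R) x : \1_A x = 0 :> R \/ \1_A x = 1 :> R.
Proof. by rewrite indicE; case: (x \in A); [right|left]. Qed.

Let cell_int : integrableR (\1_cell : R -> R).
Proof. exact: integrableR_indic measurable_cell cell_sub. Qed.

Lemma parseval_trig p : trig p -> parseval G (fun x => (\1_cell x)%:C * p x).
Proof.
move=> [s ps].
have -> : (fun x => (\1_cell x)%:C * p x) = (fun x => \sum_(a <- s) a.1 * expo a.2 x).
  apply/funext => x; rewrite ps mulr_sumr; apply: eq_bigr => a _.
  by rewrite /expo mulrCA.
by apply: (parseval_sum sG) => a; apply: (parsevalZ sG); exact: (parseval_expo sG).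
Qed.

(** The indicator function of the complement of an arc is a limit of
    trigonometric polynomials, the peak polynomials of a trigonometric
    polynomial [u] that exceeds one half exactly inside the arc.  The latter stays
    below [1] because [cos h] is positive, so the arc has to be shorter than half
    a period. *)
Lemma parseval_arc (c h : R) : 0 < h < pi / 2 -> h <= c -> c + h <= 2 * pi ->
  parseval G (fun x => (\1_cell x * \1_[set y | h < `|y - c|] x)%:C).
Proof.
move=> /andP[h0 h2] hc ch; have pi0 := pi_gt0 R.
have cosh : 0 < cos h by apply: cos_gt0_pihalf; rewrite h2 andbT; lra.
pose u x := (1 + cos (x - c)) / (2 * (1 + cos h)).
have u01 x : 0 <= u x <= 1.
  have := cos_geN1 (x - c); have := cos_le1 (x - c) => c1 c2.
  by rewrite /u divr_ge0/= ?ler_pdivrMr; lra.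
have u_lt x : (u x < 1 / 2) = (cos (x - c) < cos h).
  rewrite /u ltr_pdivrMr; last by lra.
  by apply/idP/idP; lra.
have u_gt x : (1 / 2 < u x) = (cos h < cos (x - c)).
  rewrite /u ltr_pdivlMr; last by lra.
  by apply/idP/idP; lra.
have tu : trig (fun x => (u x)%:C).
  have -> : (fun x => (u x)%:C) = fun x =>
      (1 + (cos (x - c))%:C) * ((2 * (1 + cos h))^-1)%:C :> R[i].
    by apply/funext => x; rewrite /u rmorphM rmorphD.
  by apply: trigM; [apply: trigD; [exact: trig_cst|exact: trig_cos]|exact: trig_cst].
have tpeak n : trig (fun x => (peak (u x) n)%:C).
  have -> : (fun x => (peak (u x) n)%:C) =
      fun x => (1 + -1 * (u x)%:C ^+ n) ^+ (2 ^ n)%N :> R[i].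
    by apply/funext => x; rewrite /peak rmorphXn rmorphB rmorphXn /= mulN1r.
  apply: trigX; apply: trigD; first exact: trig_cst.
  by apply: trigM; [exact: trig_cst|exact: trigX].
have mI : @measurable _ T [set y | h < `|y - c|].
  apply: borel_measurable; apply: open_measurable.
  have -> : [set y | h < `|y - c|] = (fun y => `|y - c|) @^-1` [set z | h < z].
    by apply/seteqP; split.
  apply: open_comp; last exact: open_gt.
  move=> y _; apply: cvg_norm.
  by apply: cvgB; [exact: cvg_id|exact: cvg_cst].
apply: (@parseval_dominated _ _ sG (fun n x => (\1_cell x)%:C * (peak (u x) n)%:C) _ \1_cell).
- by move=> n; apply: parseval_trig.
- apply: cmeasurable_real; apply: measurable_funM; apply: measurable_indic => //.
  exact: measurable_cell.
- exact: cell_int.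
- move=> n x; have /andP[p0 p1] := peak_itv n (u01 x).
  rewrite -rmorphM /= cabs_real real_normK ?num_real//.
  case: (indic01 cell x) => ->; first by rewrite mul0r expr0n.
  by rewrite mul1r exprn_ile1.
- move=> x; rewrite cabs_real real_normK ?num_real//.
  case: (indic01 cell x) => ->; first by rewrite mul0r expr0n.
  by case: (indic01 [set y | h < `|y - c|] x) => ->; rewrite mul1r ?expr0n ?expr1n.
- apply: ae_mono (ae_notin [:: 0; c - h; c + h]) => x.
  rewrite !inE !negb_or => /and3P[x0 xm xp].
  under eq_fun do rewrite -rmorphM.
  apply/cvg_ReImP; split => /=; last exact: cvg_cst.
  have [/in_cellP/andP[x_ge0 x_lt]|xNcell] := boolP (x \in (cell : set R)); last first.
    rewrite [\1_cell x]indicE (negbTE xNcell) mul0r.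
    by under eq_fun do rewrite mul0r; exact: cvg_cst.
  apply: cvgM; first exact: cvg_cst.
  have ph : h \in `[0, pi] by rewrite in_itv /= ltW//=; lra.
  rewrite indicE; have [xh|xh|xh] := ltgtP `|x - c| h.
  + rewrite memNset /=; last by rewrite ltNge (ltW xh).
    apply: peak_cvg0; case/andP: (u01 x) => _ ->; rewrite andbT u_gt.
    rewrite -(cos_norm (x - c)) ltr_cos// in_itv /= normr_ge0/=; lra.
  + rewrite mem_set//; apply: peak_cvg1; case/andP: (u01 x) => -> _ /=.
    rewrite u_lt -(cos_norm (x - c)).
    have [xpi|xpi] := leP `|x - c| pi.
      by rewrite ltr_cos// in_itv /= normr_ge0.
    have -> : cos `|x - c| = cos (2 * pi - `|x - c|).
      by rewrite -(cosN (_ - _)) opprB mulr_natl -[RHS](cosD2pi (_ - _)) subrK.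
    have ylt : `|x - c| < 2 * pi - h.
      have [xc|cx] := leP c x; first by rewrite ger0_norm ?subr_ge0//; lra.
      rewrite ltr0_norm ?subr_lt0//.
      have x_gt0 : 0 < x by rewrite lt_neqAle eq_sym x0.
      lra.
    by rewrite ltr_cos// ?in_itv /=; lra.
  + exfalso; have [xc|cx] := leP c x.
      move: xh; rewrite ger0_norm ?subr_ge0// => /eqP; rewrite subr_eq addrC.
      by rewrite (negbTE xp).
    move: xh; rewrite ltr0_norm ?subr_lt0// opprB => /eqP.
    by rewrite subr_eq addrC -subr_eq eq_sym (negbTE xm).
Qed.

(** The class of measurable sets whose trace on the period satisfies the
    identity is a Dynkin class. *)
Lemma parseval_set (E : set R) : @measurable _ T E ->
  parseval G (fun x => (\1_cell x * \1_E x)%:C).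
Proof.
have sqI B : @measurable _ T B -> sqint (fun x : R => (\1_cell x * \1_B x)%:C).
  move=> mB; apply: (@sqint_le _ _ \1_cell).
  - apply: cmeasurable_real; apply: measurable_funM; apply: measurable_indic => //.
    exact: measurable_cell.
  - exact: cell_int.
  - move=> x; rewrite cabs_real real_normK ?num_real//.
    case: (indic01 cell x) => ->; first by rewrite mul0r expr0n.
    by case: (indic01 B x) => ->; rewrite mul1r ?expr0n ?expr1n.
have subC (a b : R) : a%:C + -1 * b%:C = (a - b)%:C :> R[i].
  by rewrite mulN1r rmorphB.
have PT : parseval G (fun x => (\1_cell x * \1_[set: R] x)%:C).
  have := parseval_expo sG 0; congr (parseval _ _); apply/funext => x.
  by rewrite /expo oppr0 mul0r cexpi0 indicT !mulr1.
move: E; apply: (@lebesgue_dynkin_induction _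
  (fun E => parseval G (fun x => (\1_cell x * \1_E x)%:C))).
- exact: PT.
- move=> a; have mray := @itv_lebesgue_measurable R `[a, +oo[.
  have mray1 := sqI _ mray.
  have [a0|a0] := leP a 0.
    move: PT; congr (parseval _ _); apply/funext => x; congr (_ %:C).
    rewrite indicT [\1_cell x]indicE; case: (in_cellP x) => [/andP[x0 _]|]; last by rewrite !mul0r.
    by rewrite indicE mem_setE in_itv /= andbT (le_trans a0 x0).
  have [a2|a2] := leP (2 * pi) a.
    have := parseval0 sG; congr (parseval _ _); apply/funext => x.
    rewrite [\1_cell x]indicE; case: (in_cellP x) => [/andP[_ x2]|]; last by rewrite !mul0r.
    rewrite indicE mem_setE in_itv /= andbT.
    by rewrite leNgt (lt_le_trans x2 a2) mulr0.
  (* Arcs must be shorter than half a period: [[0, a]] is cut into two arcs of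
     radius [a / 4], and the ray is, up to null sets, the sum of their complements
     minus the whole period. *)
  have P1 : parseval G (fun x => (\1_cell x * \1_[set y | a / 4 < `|y - a / 4|] x)%:C).
    by apply: parseval_arc; lra.
  have P2 : parseval G (fun x => (\1_cell x * \1_[set y | a / 4 < `|y - 3 * a / 4|] x)%:C).
    by apply: parseval_arc; lra.
  have P3 := parsevalD sG (parsevalD sG P1 P2) (parsevalZ sG (-1) PT).
  apply: (parseval_ae sG P3 mray1).
  apply: ae_mono (ae_notin [:: 0; a / 2; a]) => x.
  rewrite !inE !negb_or => /and3P[x0 xm xp].
  rewrite -rmorphD /= subC indicT mulr1; congr (_ %:C).
  rewrite [\1_cell x]indicE.
  case: (in_cellP x) => [/andP[x_ge0 x_lt]|_]; last by rewrite !mul0r addr0 subrr.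
  have x_gt0 : 0 < x by rewrite lt_neqAle eq_sym x0.
  have inS c : (x \in [set y | a / 4 < `|y - c|]) = (a / 4 < `|x - c|).
    by apply/idP/idP => [/set_mem //|h]; exact: mem_set.
  rewrite !mul1r !indicE !inS mem_setE in_itv /= andbT !ltr_normr.
  have -> : (a / 4 < x - a / 4) = (a / 2 < x) by apply/idP/idP; lra.
  have -> : (a / 4 < - (x - a / 4)) = false by apply/negbTE; rewrite -leNgt; lra.
  have -> : (a / 4 < x - 3 * a / 4) = (a < x) by apply/idP/idP; lra.
  have -> : (a / 4 < - (x - 3 * a / 4)) = (x < a / 2) by apply/idP/idP; lra.
  rewrite orbF.
  case: (ltgtP x a) xp => [xa|ax|//] _ /=; last first.
    have -> : a / 2 < x by lra.
    by rewrite addrK.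
  by case: (ltgtP x (a / 2)) xm => [_|_|//] _ /=; rewrite ?add0r ?addr0 subrr.
- move=> E mE PE.
  have := parsevalD sG PT (parsevalZ sG (-1) PE); congr (parseval _ _).
  apply/funext => x; rewrite subC; congr (_ %:C).
  rewrite indicT /= !indicE in_setC.
  by case: (x \in E); case: (x \in cell); rewrite /=; ring.
- move=> F mF tF PF.
  pose S n x : R := \sum_(i <- iota 0 n) \1_(F i) x.
  have SE n x : \sum_(i <- iota 0 n) (\1_cell x * \1_(F i) x)%:C = (\1_cell x * S n x)%:C :> R[i].
    by rewrite -rmorph_sum -mulr_sumr.
  apply: (@parseval_dominated _ _ sG
    (fun n x => \sum_(i <- iota 0 n) (\1_cell x * \1_(F i) x)%:C) _ \1_cell).
  + by move=> n; apply: parseval_sum.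
  + apply: cmeasurable_real; apply: measurable_funM; apply: measurable_indic => //.
      exact: measurable_cell.
    exact: bigcupT_measurable.
  + exact: cell_int.
  + move=> n x; rewrite SE cabs_real real_normK ?num_real//.
    case: (indic01 cell x) => ->; first by rewrite mul0r expr0n.
    have := @sum_indic01 R _ F n x tF; rewrite -/(S n x).
    by case=> ->; rewrite mul1r ?expr0n ?expr1n.
  + move=> x; rewrite cabs_real real_normK ?num_real//.
    case: (indic01 cell x) => ->; first by rewrite mul0r expr0n.
    by case: (indic01 (\bigcup_m F m) x) => ->; rewrite mul1r ?expr0n ?expr1n.
  + apply: aeW => x; under eq_fun do rewrite SE.
    apply/cvg_ReImP; split => /=; last exact: cvg_cst.
    apply: cvgM; first exact: cvg_cst.
    exact: (@sum_indic_cvg R _ F x tF).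
- move=> E N mE nN PE; apply: (parseval_ae sG PE).
    by apply: sqI => //; apply: measurableU => //; exact: negligible_measurable.
  apply: negligibleS nN => x /= h; apply: contrapT => Nx; apply: h.
  congr (_%:C); congr (_ * _); rewrite !indicE in_setU.
  by rewrite [x \in N]memNset// orbF.
Qed.

End ParsevalDensity.

Local Transparent pairing.

Section ParsevalGeneral.
Context {R : realType} (G : R -> R[i]) (sG : sqint G).
Local Notation T := (@lebesgueTypeR R).
Local Notation mu := (@completed_lebesgue_measure R).
Local Notation Re := complex.Re.
Local Notation Im := complex.Im.

Import HBNNSimple.

Let indic_cell01 (x : R) : 0 <= (\1_cell x : R) <= 1.
Proof. by rewrite indicE; case: (x \in _); rewrite ?ler01 ?lexx. Qed.

Let parseval_simple (h : {nnsfun T >-> R}) :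
  parseval G (fun x => (\1_cell x * h x)%:C).
Proof.
pose s : seq R := finmap.enum_fset (fset_set (h @` setT)).
have -> : (fun x => (\1_cell x * h x)%:C) = fun x =>
    \sum_(i < size s) (s`_i)%:C * (\1_cell x * \1_(h @^-1` [set s`_i]) x)%:C.
  apply/funext => x; rewrite (fimfunEord h) mulr_sumr rmorph_sum /=.
  by apply: eq_bigr => i _; rewrite -rmorphM mulrCA.
apply: (parseval_sum sG) => i; apply: (parsevalZ sG); apply: (parseval_set sG).
exact: measurable_sfunP.
Qed.

Let parseval_nonneg (h : R -> R) : (forall x, 0 <= h x) ->
  measurable_fun [set: T] h -> integrableR (fun x => h x ^+ 2) ->
  parseval G (fun x => (\1_cell x * h x)%:C).
Proof.
move=> h0 mh ih.
have mh' : measurable_fun [set: T] (EFin \o h) by exact/measurable_EFinP.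
pose a n := nnsfun_approx measurableT mh' n.
have a_cvg x : (fun n => a n x) @ \oo --> h x.
  have h0' y : [set: T] y -> (0 <= (EFin \o h) y)%E by rewrite lee_fin.
  by have /fine_cvgP[] := cvg_nnsfun_approx measurableT mh' h0' (I : setT x).
have a_le n x : 0 <= a n x <= h x.
  apply/andP; split; first exact: fun_ge0.
  have nd : nondecreasing_seq (fun n => a n x).
    move=> i j ij; have := nd_nnsfun_approx measurableT mh' ij.
    by move=> /lefP/(_ x).
  rewrite -(cvg_lim _ (a_cvg x))//; apply: nondecreasing_cvgn_le => //.
  by apply/cvg_ex; exists (h x).
have sq_le (c y z : R) : 0 <= c <= 1 -> 0 <= y <= z -> cabs (c * y)%:C ^+ 2 <= z ^+ 2.
  move=> /andP[c0 c1] /andP[y0 yz]; rewrite cabs_real real_normK ?num_real//.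
  rewrite lerXn2r ?nnegrE ?mulr_ge0//; first exact: le_trans yz.
  by apply: le_trans yz; rewrite ler_piMl.
apply: (@parseval_dominated _ _ sG (fun n x => (\1_cell x * a n x)%:C) _ (fun x => h x ^+ 2)).
- by move=> n; exact: parseval_simple.
- apply: cmeasurable_real; apply: measurable_funM; last exact: mh.
  by apply: measurable_indic; exact: measurable_cell.
- exact: ih.
- by move=> n x; exact: sq_le (indic_cell01 x) (a_le n x).
- by move=> x; apply: sq_le (indic_cell01 x) _; rewrite h0 lexx.
- apply: aeW => x; apply/cvg_ReImP; split => /=; last exact: cvg_cst.
  by apply: cvgM; [exact: cvg_cst|exact: a_cvg].
Qed.

Let parseval_real (h : R -> R) : measurable_fun [set: T] h ->
  integrableR (fun x => h x ^+ 2) -> parseval G (fun x => (\1_cell x * h x)%:C).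
Proof.
move=> mh ih.
have max_sq y : Num.max y 0 ^+ 2 <= y ^+ 2 :> R.
  by rewrite maxEle; case: ifP => // _; rewrite expr0n sqr_ge0.
have part (g : R -> R) : measurable_fun [set: T] g -> (forall x, g x ^+ 2 = h x ^+ 2) ->
    parseval G (fun x => (\1_cell x * Num.max (g x) 0)%:C).
  move=> mg gh.
  have mmax : measurable_fun [set: T] (fun x => Num.max (g x) 0).
    by apply: measurable_maxr => //; exact: measurable_cst.
  apply: parseval_nonneg => //; first by move=> x; rewrite le_max lexx orbT.
  apply: (integrableR_le _ ih); first exact: measurable_funX.
  by move=> x; rewrite ger0_norm ?sqr_ge0// -gh.
have P1 := part h mh (fun x => erefl).
have mN : measurable_fun [set: T] (fun x => - h x) by exact: measurableT_comp mh.
have P2 := part (fun x => - h x) mN (fun x => sqrrN _).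
have := parsevalD sG P1 (parsevalZ sG (-1) P2); congr (parseval _ _).
apply/funext => x; rewrite mulN1r -rmorphN -rmorphD /= -mulrN -mulrDr; congr (_ * _)%:C.
rewrite !maxEle oppr_le0; have [h0|h0|->] := ltgtP (h x) 0.
- by rewrite opprK add0r.
- by rewrite oppr0 addr0.
- by rewrite oppr0 addr0.
Qed.

(** The passage from sets to functions follows the construction of the
    integral: simple functions, dominated monotone limits, positive and negative
    parts, real and imaginary parts. *)
Lemma parseval_cell F : sqint F -> parseval G (fun x => (\1_cell x)%:C * F x).
Proof.
move=> sF; have [mF iF] := sF.
Local Transparent cmeasurable.
have [mRe mIm] := mF.
Local Opaque cmeasurable.
have PRe : parseval G (fun x => (\1_cell x * Re (F x))%:C).
  apply: parseval_real => //; apply: (integrableR_le _ iF).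
    exact: measurable_funX.
  by move=> x; rewrite ger0_norm ?sqr_ge0// sqr_cabs lerDl sqr_ge0.
have PIm : parseval G (fun x => (\1_cell x * Im (F x))%:C).
  apply: parseval_real => //; apply: (integrableR_le _ iF).
    exact: measurable_funX.
  by move=> x; rewrite ger0_norm ?sqr_ge0// sqr_cabs lerDr sqr_ge0.
have := parsevalD sG PRe (parsevalZ sG 'i PIm); congr (parseval _ _).
by apply/funext => x; apply: complexP; rewrite ?ReD ?ImD ?ReM ?ImM /=; ring.
Qed.

End ParsevalGeneral.

(** * Parseval's identity for compactly supported functions *)

Section ParsevalLine.
Context {R : realType}.
Local Notation T := (@lebesgueTypeR R).
Local Notation mu := (@completed_lebesgue_measure R).
Implicit Types (F G : R -> R[i]) (k : int).

Definition fhat F k : R[i] := cintegral (fun x => F x * cexpi (k%:~R * x)).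

Let tau : R := 2 * pi.
Let tau_gt0 : 0 < tau. Proof. by rewrite mulr_gt0 ?pi_gt0. Qed.

Let periodize F (N : nat) (x : R) : R[i] :=
  psumZ (fun j => F (x + tau * j%:~R)) N.

Let sqint_periodize F N : sqint F -> sqint (periodize F N).
Proof.
move=> sF; rewrite /periodize; under eq_fun do rewrite psumZ_zseq.
by apply: sqint_sum => j _; exact: sqint_translate.
Qed.

(** Translates of one period tile the line: their indicator functions are
    differences of consecutive step functions, and the sum telescopes. *)
Let cell_cover (N : nat) (x : R) : - (tau * N%:R) <= x < tau * N%:R ->
  psumZ (fun j => \1_cell (x - tau * j%:~R) : R) N = 1.
Proof.
move=> /andP[xN Nx].
pose v (j : int) : R := ((tau * j%:~R <= x)%R : nat)%:R.
have E j : \1_cell (x - tau * j%:~R) = v j - v (j + 1).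
  rewrite indicE /cell mem_setE in_itv /= subr_ge0 ltrBlDr -/tau /v rmorphD /= mulrDr mulr1.
  have [xj|jx] := leP (tau * j%:~R) x => /=.
    by rewrite addrC; case: leP => _; rewrite ?subrr ?subr0.
  have -> : (tau * j%:~R + tau <= x) = false.
    by apply/negbTE; rewrite -ltNge (lt_trans jx)// ltrDl.
  by rewrite subr0.
have -> : psumZ (fun j => \1_cell (x - tau * j%:~R)) N = psumZ v N - psumZ (fun j => v (j + 1)) N.
  rewrite !psumZ_zseq -sumrB; apply: eq_bigr => j _; exact: E.
rewrite psumZ_shift /v rmorphN /= mulrN xN leNgt Nx /=; ring.
Qed.

(** A finite periodization is periodic as long as the terms that a translation
    pushes out of the summation window vanish. *)
Let periodize_shift G (M : R) (L K : nat) (n : int) (x : R) :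
  (forall y, M < `|y| -> G y = 0) -> 2 * M < tau * L%:R -> `|x| <= M ->
  (L + absz n <= K)%N -> periodize G K (x + tau * n%:~R) = periodize G K x.
Proof.
move=> G0 ML xM nK.
have v0 j : (L <= absz j)%N -> G (x + tau * j%:~R) = 0.
  move=> Lj; apply: G0.
  have h : tau * L%:R <= `|tau * j%:~R|.
    rewrite normrM (gtr0_norm tau_gt0) ler_pM2l// -intr_norm.
    by rewrite -abszE ler_nat.
  have := ler_normB (x + tau * j%:~R) x.
  by rewrite addrC addKr; lra.
have step (m : int) : (L <= absz (m + K%:Z)%R)%N -> (L <= absz (m - K%:Z)%R)%N ->
    periodize G K (x + tau * (m + 1)%:~R) = periodize G K (x + tau * m%:~R).
  move=> mK1 mK2; pose v j := G (x + tau * (m + j)%:~R).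
  transitivity (psumZ (fun j => v (j + 1)) K).
    rewrite /periodize /v !psumZ_zseq; apply: eq_bigr => j _; congr G.
    by rewrite !rmorphD /=; ring.
  rewrite psumZ_shift /v (v0 _ mK1) (v0 _ mK2) addr0 subr0.
  rewrite /periodize !psumZ_zseq; apply: eq_bigr => j _; congr G.
  by rewrite !rmorphD /=; ring.
have pos (m : nat) : (L + m <= K)%N -> periodize G K (x + tau * m%:~R) = periodize G K x.
  elim: m => [|m IH] mK; first by rewrite mulr0 addr0.
  rewrite -IH; last by lia.
  by rewrite -(step m%:Z) ?intS; [congr (periodize _ _ (_ + _ * _%:~R)); lia|lia|lia].
have neg (m : nat) : (L + m <= K)%N -> periodize G K (x + tau * (- m%:Z)%:~R) = periodize G K x.
  elim: m => [|m IH] mK; first by rewrite oppr0 mulr0 addr0.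
  rewrite -IH; last by lia.
  rewrite -(step (- m.+1%:Z)); [|lia|lia].
  by congr (periodize _ _ (_ + _ * _%:~R)); lia.
case: n nK => m nK; first by apply: pos.
by rewrite NegzE; apply: neg.
Qed.

Let sqint_cell F : sqint F -> sqint (fun x => (\1_cell x)%:C * F x).
Proof.
apply: (@sqint_mul_bounded _ _ _ 1).
- exact: cmeasurable_indic measurable_cell.
- by move=> x; rewrite cabs_real indicE; case: (x \in _); rewrite ?normr0 ?normr1.
Qed.

Let indic_cellM (x : R) : (\1_cell x)%:C * (\1_cell x)%:C = (\1_cell x)%:C :> R[i].
Proof. by rewrite indicE; case: (x \in _); rewrite -rmorphM /= ?mulr1 ?mulr0. Qed.

(** Integrating over one period the periodization of [F] against [H] unfolds to
    an integral over the line, as soon as [H] is periodic along the support of [F]. *)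
Let unfold_cell F (H : R -> R[i]) (N : nat) :
  (forall j, cintegrable (fun x => (\1_cell x)%:C * (F (x + tau * j%:~R) * H x))) ->
  (forall x j, j \in zseq N -> F x != 0 -> H (x - tau * j%:~R) = H x) ->
  (forall x, F x != 0 -> - (tau * N%:R) <= x < tau * N%:R) ->
  cintegral (fun x => (\1_cell x)%:C * (periodize F N x * H x)) =
  cintegral (fun x => F x * H x).
Proof.
move=> iFH Hper Fsupp.
pose f j x := (\1_cell (x - tau * j%:~R))%:C * (F x * H (x - tau * j%:~R)).
have fE j x : f j (x + tau * j%:~R) = (\1_cell x)%:C * (F (x + tau * j%:~R) * H x).
  by rewrite /f addrK.
have fi j : cintegrable (f j).
  have := translate_cintegrable (- (tau * j%:~R)) (iFH j).
  by congr (cintegrable _); apply/funext => x; rewrite -fE subrK.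
transitivity (\sum_(j <- zseq N) cintegral (f j)).
  transitivity (\sum_(j <- zseq N)
      cintegral (fun x => (\1_cell x)%:C * (F (x + tau * j%:~R) * H x))).
    rewrite -(cintegral_sum _ (fun j _ => iFH j)); apply: eq_cintegral => x.
    by rewrite /periodize psumZ_zseq mulr_suml mulr_sumr.
  apply: eq_bigr => j _; rewrite -(translate_cintegral (tau * j%:~R) (fi j)).
  by apply: eq_cintegral => x; rewrite fE.
rewrite -(cintegral_sum _ (fun j _ => fi j)); apply: eq_cintegral => x.
have [Fx0|Fx0] := eqVneq (F x) 0.
  by rewrite big1 => [|j _]; rewrite /f Fx0 mul0r// mulr0.
transitivity (\sum_(j <- zseq N) (\1_cell (x - tau * j%:~R))%:C * (F x * H x)).
  by apply: eq_big_seq => j jN; rewrite /f Hper.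
rewrite -mulr_suml -rmorph_sum -psumZ_zseq cell_cover ?mul1r//.
exact: Fsupp.
Qed.

Let coef_periodize F (M : R) (N : nat) k : sqint F ->
  (forall x, M < `|x| -> F x = 0) -> M < tau * N%:R ->
  coef (fun x => (\1_cell x)%:C * periodize F N x) k = fhat F k.
Proof.
move=> sF F0 MN; rewrite /fhat.
have expoJ x : ((expo k x)^*)%R = (\1_cell x)%:C * cexpi (k%:~R * x).
  by rewrite /expo rmorphM /= conjcE conjc_real -cexpiN mulNr opprK.
rewrite -(@unfold_cell F (fun x => cexpi (k%:~R * x)) N).
- apply: eq_cintegral => x; rewrite expoJ.
  by rewrite mulrACA indic_cellM.
- move=> j; have := cintegrableM (sqint_cell (sqint_translate (tau * j%:~R) sF))
    (sqintJ (sqint_expo k)).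
  congr (cintegrable _); apply/funext => x; rewrite expoJ.
  by rewrite mulrACA indic_cellM.
- move=> x j _ _; rewrite mulrBr -[RHS](cexpi_periodic _ (- (k * j))).
  by congr cexpi; rewrite /tau rmorphN rmorphM /=; ring.
- move=> x; apply: contraNT => xN; apply/eqP/F0; rewrite (lt_le_trans MN)//.
  move: xN; rewrite negb_and -ltNge -leNgt => /orP[xN|Nx].
    by rewrite -normrN (le_trans _ (ler_norm _))//; lra.
  by rewrite (le_trans Nx)// ler_norm.
Qed.

(** The values of [fhat F] at the integers are the Fourier coefficients of a
    periodization of [F].  Parseval's identity is applied to the periodizations
    of both functions, and that of [F] is then unfolded; [G] is summed over a
    longer window, since its periodization must be periodic along the support
    of [F]. *)
Lemma parseval_line F G (M : R) (N K : nat) : sqint F -> sqint G ->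
  (forall x, M < `|x| -> F x = 0) -> (forall x, M < `|x| -> G x = 0) ->
  M < tau * N%:R -> (3 * N <= K)%N ->
  abs_summable (fun k => fhat F k * ((fhat G k)^*)%R) /\
  csumZ (fun k => fhat F k * ((fhat G k)^*)%R) =
    tau%:C * psumZ (fun j => pairing F (fun x => G (x + tau * j%:~R))) K.
Proof.
move=> sF sG F0 G0 MN NK.
have MK : M < tau * K%:R.
  by rewrite (lt_le_trans MN)// ler_pM2l// ler_nat; lia.
pose Gp x := (\1_cell x)%:C * periodize G K x.
have sGp : sqint Gp by exact: sqint_cell (sqint_periodize K sG).
have [sFp csumE] := parseval_cell sGp (sqint_periodize N sF).
have cE : coef_prod (fun x => (\1_cell x)%:C * periodize F N x) Gp =
    fun k => fhat F k * ((fhat G k)^*)%R.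
  by apply/funext => k; rewrite /coef_prod (coef_periodize k sF F0 MN) (coef_periodize k sG G0 MK).
rewrite -cE; split; first exact: abs_summable_coef.
rewrite csumE -/tau; congr (_ * _).
have F_itv x : F x != 0 -> `|x| <= M.
  by apply: contraNT; rewrite -ltNge => /F0 ->.
transitivity (cintegral (fun x => F x * ((periodize G K x)^*)%R)).
  rewrite -(@unfold_cell F (fun x => ((periodize G K x)^*)%R) N).
  - rewrite /pairing; apply: eq_cintegral => x.
    by rewrite /Gp rmorphM /= [((_%:C)^*)%R]conjcE conjc_real mulrACA indic_cellM.
  - move=> j; have := cintegrableM (sqint_cell (sqint_translate (tau * j%:~R) sF))
      (sqintJ (sqint_periodize K sG)).
    by congr (cintegrable _); apply/funext => x; rewrite mulrA.
  - move=> x j; rewrite mem_zseq => jN Fx; congr (_^*)%R.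
    have -> : x - tau * j%:~R = x + tau * (- j)%:~R by rewrite rmorphN mulrN.
    apply: (@periodize_shift G M (2 * N)%N) => //.
    + by rewrite natrM; lra.
    + exact: F_itv.
    + by lia.
  - move=> x /F_itv; rewrite ler_norml => /andP[xm xM].
    by apply/andP; split; lra.
rewrite psumZ_zseq /pairing.
rewrite -(cintegral_sum _ (fun j _ => cintegrable_pairing sF (sqint_translate (tau * j%:~R) sG))).
apply: eq_cintegral => x.
by rewrite /periodize psumZ_zseq rmorph_sum mulr_sumr.
Qed.

End ParsevalLine.

(** * Frame terms *)

Section BoundedCompactSupport.
Context {R : realType}.
Local Notation T := (@lebesgueTypeR R).
Local Notation mu := (@completed_lebesgue_measure R).
Local Notation Re := complex.Re.
Local Notation Im := complex.Im.
Implicit Types (f g eta : R -> R[i]).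

(** Bounded with compact support: what the frame expansions use of a test
    function. *)
Variant bcs f (M B : R) : Prop := BCS of
  cmeasurable f & (forall x, cabs (f x) <= B) & (forall x, M < `|x| -> f x = 0).

Let rsmooth_continuous (h : R -> R) : rsmooth h -> continuous h.
Proof.
move=> sh x; apply: differentiable_continuous; apply/derivable1_diffP.
exact: (sh 0%N x).
Qed.

Let continuous_bounded (h : R -> R) (M : R) : continuous h ->
  exists B, forall x, `|x| <= M -> `|h x| <= B.
Proof.
move=> ch; have cK : compact (h @` `[- M, M]).
  apply: continuous_compact; last exact: segment_compact.
  exact: continuous_subspaceT.
have [B [_ hB]] := compact_bounded cK.
exists (B + 1) => x xM; apply: (hB (B + 1)); first by rewrite ltrDl.
by exists x => //=; rewrite in_itv /= -ler_norml.
Qed.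

Lemma test_function_bcs f : test_function f -> exists M B, bcs f M B.
Proof.
move=> [sRe sIm cK].
have cRe := rsmooth_continuous sRe; have cIm := rsmooth_continuous sIm.
have [M0 [_ hM0]] := compact_bounded cK.
pose M := M0 + 1.
have f0 x : M < `|x| -> f x = 0.
  move=> Mx; apply: contraPP Mx => /eqP fx0; apply/negP; rewrite -leNgt.
  by apply: (hM0 M); [rewrite ltrDl|exact: subset_closure].
have [B1 hB1] := continuous_bounded M cRe.
have [B2 hB2] := continuous_bounded M cIm.
exists M, (`|B1| + `|B2|); split; last exact: f0.
- Local Transparent cmeasurable.
  by split; exact: continuous_lebesgue_measurable.
  Local Opaque cmeasurable.
- move=> x; have [xM|Mx] := leP `|x| M; last by rewrite f0// cabs0 addr_ge0.
  rewrite (le_trans (cabs_ler _))// lerD//.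
    by rewrite (le_trans (hB1 x xM))// ler_norm.
  by rewrite (le_trans (hB2 x xM))// ler_norm.
Qed.

Lemma bcs_affine f M B (a : R) : a != 0 -> bcs f M B ->
  bcs (fun x => f (a * x)) (M / `|a|) B.
Proof.
move=> a0 [mf fB fM]; split.
- by have := cmeasurable_affine 0 a0 mf; under eq_fun do rewrite addr0.
- by move=> x; exact: fB.
by move=> x; rewrite ltr_pdivrMr ?normr_gt0// mulrC -normrM => /fM.
Qed.

(** Truncation by a test function turns local square integrability into square
    integrability. *)
Lemma sqint_bcs_L2loc f M B eta : bcs f M B -> L2loc eta ->
  sqint (fun x => f x * eta x).
Proof.
move=> [mf fB fM] [meta ieta].
pose K : set R := `[- M, M]%classic.
have mK : @measurable _ T K by exact: itv_lebesgue_measurable.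
have me2 : measurable_fun [set: T] (fun x => cabs (eta x) ^+ 2).
  by apply: measurable_funX; exact: measurable_cabs.
have iK : mu.-integrable K (fun x => (cabs (eta x) ^+ 2)%:E).
  apply/integrableP; split.
    by apply/measurable_EFinP; exact: measurable_funTS.
  have /ieta : compact K by exact: segment_compact.
  by under [X in (_ -> X < _)%E]eq_integral do rewrite gee0_abs ?lee_fin ?sqr_ge0//.
have iT : integrableR (fun x => \1_K x * cabs (eta x) ^+ 2).
  move: iK => /(integrable_mkcond _ mK).
  apply: eq_integrable => // x _; rewrite /= patchE indicE.
  by case: ifP => _; rewrite ?mul1r ?mul0r.
apply: (@sqint_le _ _ (fun x => B ^+ 2 * (\1_K x * cabs (eta x) ^+ 2))).
- exact: cmeasurableM.
- exact: integrableRZ.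
- move=> x; rewrite cabsM exprMn.
  have [xK|xK] := leP `|x| M.
    rewrite indicE mem_set ?mul1r; last by rewrite /K /= in_itv /= -ler_norml.
    rewrite ler_wpM2r ?sqr_ge0// lerXn2r ?nnegrE ?cabs_ge0//.
    exact: le_trans (cabs_ge0 _) (fB x).
  by rewrite fM// cabs0 expr0n /= mul0r mulr_ge0 ?sqr_ge0// mulr_ge0 ?sqr_ge0.
Qed.

Lemma L2locJ eta : L2loc eta -> L2loc (fun x => ((eta x)^*)%R).
Proof.
move=> [meta ieta]; split; first exact: cmeasurableJ.
by move=> K cK; under eq_integral do rewrite cabs_conj; exact: ieta.
Qed.

End BoundedCompactSupport.

Section FrameTerms.
Context {R : realType}.
Local Notation T := (@lebesgueTypeR R).
Local Notation mu := (@completed_lebesgue_measure R).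
Implicit Types (f g eta etat : R -> R[i]) (lam : R).

Let local_part lam f eta (x : R) : R[i] := f (lam^-1 * x) * ((eta x)^*)%R.

Let sqint_local_part lam f M B eta : lam != 0 -> bcs f M B -> L2loc eta ->
  sqint (local_part lam f eta).
Proof.
move=> l0 bf /L2locJ le; apply: sqint_bcs_L2loc le.
by apply: (bcs_affine _ bf); rewrite invr_eq0.
Qed.

Let local_part0 lam f M B eta x : lam != 0 -> bcs f M B ->
  M * `|lam| < `|x| -> local_part lam f eta x = 0.
Proof.
move=> l0 [_ _ fM] Mx; rewrite /local_part fM ?mul0r//.
by rewrite normrM normfV mulrC ltr_pdivlMr ?normr_gt0.
Qed.

Let cintegrable_fhat lam f M B eta (k : R) : lam != 0 -> bcs f M B -> L2loc eta ->
  cintegrable (fun x => local_part lam f eta x * cexpi (k * x)).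
Proof.
move=> l0 bf le; have sF := sqint_local_part l0 bf le.
pose K : set R := `[- (M * `|lam|), M * `|lam|]%classic.
have mK : @measurable _ T K by exact: itv_lebesgue_measurable.
have sK : sqint (fun x => (\1_K x)%:C * cexpi (k * x)).
  under eq_fun do rewrite mulrC.
  apply: (@sqint_mul_bounded _ _ _ 1); first exact: cmeasurable_cexpi.
    by move=> x; rewrite cabs_cexpi.
  exact: sqint_indic mK (@subset_refl _ _).
have := cintegrableM sF sK; congr (cintegrable _); apply/funext => x.
rewrite indicE; have [xK|xK] := leP `|x| (M * `|lam|).
  by rewrite mem_set ?mul1r// /K /= in_itv /= -ler_norml.
by rewrite (local_part0 _ l0 bf xK) !mul0r.
Qed.

Let pairing_fdil lam f M B eta (k : int) : lam != 0 -> bcs f M B -> L2loc eta ->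
  cintegrable (fun x => f x * ((fdil lam k%:~R eta x)^*)%R) /\
  pairing f (fdil lam k%:~R eta) =
    (Num.sqrt `|lam| / `|lam|)%:C * fhat (local_part lam f eta) k.
Proof.
move=> l0 bf le; have ci := cintegrable_fhat k%:~R l0 bf le.
have E x : f x * ((fdil lam k%:~R eta x)^*)%R = (Num.sqrt `|lam|)%:C *
    (local_part lam f eta (lam * x + 0) * cexpi (k%:~R * (lam * x + 0))).
  rewrite addr0 /local_part /fdil mulKf// !rmorphM /= conjcE conjc_real -cexpiN opprK.
  by rewrite -(mulrA _ lam x); ring.
have ci' := affine_cintegrable 0 l0 ci.
split; first by under eq_fun do rewrite E; exact: cintegrableZ.
rewrite /pairing (eq_cintegral E) (cintegralZ _ ci') (affine_cintegral 0 l0 ci).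
by rewrite rmorphM /= mulrA.
Qed.

Let conj_realM (a : R) (z : R[i]) : ((a%:C * z)^*)%R = a%:C * (z^*)%R.
Proof. by rewrite rmorphM /= [((_%:C)^*)%R]conjcE conjc_real. Qed.

(** After the change of variables that undoes the dilation of the generators,
    the inner products are Fourier transforms at integer frequencies; the two
    normalizing square roots and the two Jacobians combine into [|d ^ j|]. *)
Lemma frame_termE (d : R) (j : int) eta etat f g M B k : d != 0 ->
  bcs f M B -> bcs g M B -> L2loc eta -> L2loc etat ->
  frame_term d j eta etat f g k = (`|d ^ j|)%:C *
    (fhat (fun x => f (d ^ j * x) * ((eta x)^*)%R) k *
     ((fhat (fun x => g (d ^ j * x) * ((etat x)^*)%R) k)^*)%R).
Proof.
move=> d0 bf bg le let'; set lam := d ^ (- j).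
have l0 : lam != 0 by rewrite /lam expfz_neq0.
have lV : lam^-1 = d ^ j by rewrite /lam -invr_expz invrK.
have [_ pf] := pairing_fdil k l0 bf le.
have [ci pg] := pairing_fdil k l0 bg let'.
have -> : frame_term d j eta etat f g k =
    pairing f (fdil lam k%:~R eta) * ((pairing g (fdil lam k%:~R etat))^*)%R.
  rewrite /frame_term -/lam; congr (_ * _).
  rewrite /pairing -(cintegralJ ci); apply: eq_cintegral => x.
  by rewrite rmorphM /= conjCK mulrC.
rewrite pf pg conj_realM mulrACA -rmorphM /= /local_part lV.
congr (_%:C * _).
have n0 : `|lam| != 0 by rewrite normr_eq0.
rewrite -lV normfV mulrACA -expr2 sqr_sqrtr ?normr_ge0//.
by field; exact: n0.
Qed.

Lemma test_function_bcs2 f g : test_function f -> test_function g ->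
  exists M B, bcs f M B /\ bcs g M B.
Proof.
move=> /test_function_bcs[M1 [B1 [mf fB fM]]] /test_function_bcs[M2 [B2 [mg gB gM]]].
exists (Num.max M1 M2), (Num.max B1 B2); split; split.
- exact: mf.
- by move=> x; rewrite le_max fB.
- by move=> x; rewrite gt_max => /andP[+ _]; exact: fM.
- exact: mg.
- by move=> x; rewrite le_max gB orbT.
- by move=> x; rewrite gt_max => /andP[_]; exact: gM.
Qed.

(** One shift of one scale of a frame expansion. *)
Definition shifted (h f g : R -> R[i]) (b : R) : R[i] :=
  cintegral (fun x => f x * ((g (x + b))^*)%R * h x).

(** The absolute convergence required of the frame series holds for all locally
    square-integrable generators; the sum of a series is a finite sum over the
    shifts for which the supports overlap. *)
Lemma frame_level (d : R) (j : int) eta etat f g M B : d != 0 ->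
  bcs f M B -> bcs g M B -> L2loc eta -> L2loc etat ->
  abs_summable (frame_term d j eta etat f g) /\
  exists K0, forall K, (K0 <= K)%N ->
    csumZ (frame_term d j eta etat f g) = (2 * pi)%:C *
      psumZ (fun k => shifted (fun x => ((eta (d ^ (- j) * x))^*)%R *
          etat (d ^ (- j) * x + 2 * pi * k%:~R)) f g (2 * pi * d ^ j * k%:~R)) K.
Proof.
move=> d0 bf bg le let'; set lam := d ^ (- j).
have l0 : lam != 0 by rewrite /lam expfz_neq0.
have lV : lam^-1 = d ^ j by rewrite /lam -invr_expz invrK.
pose F x := f (d ^ j * x) * ((eta x)^*)%R.
pose G x := g (d ^ j * x) * ((etat x)^*)%R.
have sF : sqint F by rewrite /F -lV; exact: sqint_local_part l0 bf le.
have sG : sqint G by rewrite /G -lV; exact: sqint_local_part l0 bg let'.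
have F0 x : M * `|lam| < `|x| -> F x = 0.
  by rewrite /F -lV; exact: (local_part0 eta l0 bf).
have G0 x : M * `|lam| < `|x| -> G x = 0.
  by rewrite /G -lV; exact: (local_part0 etat l0 bg).
pose N := (Num.truncn (M * `|lam| / (2 * pi))).+1.
have tau0 : 0 < 2 * pi :> R by rewrite mulr_gt0 ?pi_gt0.
have MN : M * `|lam| < 2 * pi * N%:R.
  by rewrite [ltRHS]mulrC -ltr_pdivrMr//; exact: truncnS_gt.
have ft k : frame_term d j eta etat f g k =
    (`|d ^ j|)%:C * (fhat F k * ((fhat G k)^*)%R).
  exact: (frame_termE j k d0 bf bg le let').
have [us _] := parseval_line sF sG F0 G0 MN (leqnn _).
split.
  by apply: (eq_abs_summable (u := fun k => (`|d ^ j|)%:C * (fhat F k * ((fhat G k)^*)%R)));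
    [move=> k; rewrite ft|exact: abs_summableZ].
exists (3 * N)%N => K NK.
have [_ csumE] := parseval_line sF sG F0 G0 MN NK.
rewrite (_ : frame_term d j eta etat f g =
  fun k => (`|d ^ j|)%:C * (fhat F k * ((fhat G k)^*)%R)); last first.
  by apply/funext => k; exact: ft.
rewrite (csumZZ _ us) csumE mulrCA; congr (_ * _).
rewrite !psumZ_zseq mulr_sumr; apply: eq_bigr => k _.
have ci := cintegrable_pairing sF (sqint_translate (2 * pi * k%:~R) sG).
have := affine_cintegral 0 l0 ci.
rewrite -normfV lV => <-; apply: eq_cintegral => x.
rewrite addr0 /F /G !rmorphM /= conjCK -lV mulKf// mulrDr mulKf// lV.
by rewrite (mulrC (2 * pi) (d ^ j)) -!mulrA; congr (_ * _); rewrite mulrCA.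
Qed.

End FrameTerms.

(** * Smooth functions with prescribed support *)

Section Smooth.
Context {R : realType}.
Implicit Types (f g h : R -> R) (x a b : R).

(** Iterated differentiability in recursive form, which suits inductions on the
    order better than iterated derivatives. *)
Fixpoint diff_times n h : Prop :=
  if n is m.+1 then exists2 h', (forall x, is_derive x 1 h (h' x)) & diff_times m h'
  else True.

Lemma rsmoothP h : rsmooth h <-> forall n, diff_times n h.
Proof.
split=> [sh n|].
- elim: n h sh => //= n IH h sh; exists (derive1 h) => [x|].
    by apply: DeriveDef; [exact: (sh 0%N)|rewrite derive1E].
  by apply: IH => m x; rewrite -derive1Sn; exact: sh.
- move=> sh n; elim: n h sh => [|n IH] h sh x.
    by have [h' dh _] := sh 1%N; have [] := dh x.
  rewrite derive1Sn; apply: IH => m.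
  have [h' dh sh'] := sh m.+1.
  suff -> : derive1 h = h' by [].
  by apply/funext => y; rewrite derive1E; have [] := dh y.
Qed.

Lemma diff_times_le n h : diff_times n.+1 h -> diff_times n h.
Proof.
elim: n h => //= n IH h [h' dh sh']; exists h' => //.
exact: IH.
Qed.

Lemma diff_times_cst n a : diff_times n (fun _ => a).
Proof.
elim: n a => //= n IH a; exists (fun _ => 0) => [x|]; last exact: IH.
exact: is_derive_cst.
Qed.

Lemma diff_timesD n f g : diff_times n f -> diff_times n g ->
  diff_times n (fun x => f x + g x).
Proof.
elim: n f g => //= n IH f g [f' df sf] [g' dg sg].
exists (fun x => f' x + g' x) => [x|]; last exact: IH.
exact: (is_deriveD (df x) (dg x)).
Qed.

Lemma diff_timesM n f g : diff_times n f -> diff_times n g ->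
  diff_times n (fun x => f x * g x).
Proof.
elim: n f g => //= n IH f g [f' df sf] [g' dg sg].
exists (fun x => f x * g' x + g x * f' x) => [x|].
  exact: (is_deriveM (df x) (dg x)).
apply: diff_timesD; apply: IH => //; apply: diff_times_le.
- by exists f'.
- by exists g'.
Qed.

Lemma diff_timesV n f : (forall x, f x != 0) -> diff_times n f ->
  diff_times n (fun x => (f x)^-1).
Proof.
move=> f0; elim: n => //= n IH sf.
have sf1 := sf; move/diff_times_le : sf1 => /IH sV.
case: sf => f' df sf.
exists (fun x => -1 * ((f x)^-1 * (f x)^-1 * f' x)) => [x|].
  have [dfx dfE] := df x.
  apply: DeriveDef; first exact: derivableV.
  rewrite deriveV// dfE /GRing.scale /= expr2 invfM; ring.
apply: diff_timesM; first exact: diff_times_cst.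
by apply: diff_timesM => //; exact: diff_timesM.
Qed.

Lemma diff_times_affine n h a b : diff_times n h ->
  diff_times n (fun x => h (a * x + b)).
Proof.
elim: n h => //= n IH h [h' dh sh].
exists (fun x => a * h' (a * x + b)) => [x|]; last first.
  by apply: diff_timesM; [exact: diff_times_cst|exact: IH].
have da : is_derive x 1 (fun y => a * y + b) a.
  have := is_deriveD (is_deriveM (is_derive_cst a x 1) (is_derive_id x 1)) (is_derive_cst b x 1).
  move=> /is_derive_eq; apply.
  by rewrite /GRing.scale /=; ring.
have := @is_derive1_comp _ h (fun y => a * y + b) x _ _ (dh (a * x + b)) da.
by rewrite mulrC.
Qed.

Section FlatFunction.

(** The powers are included because the derivative of a member of the family is
    a combination of members, also at the origin, where the exponential beats
    the powers. *)
Let flat n x : R := if 0 < x then x^-1 ^+ n * expR (- x^-1) else 0.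

Let flat_bound n x : `|flat n x| <= n.+2`!%:R * x ^+ 2.
Proof.
rewrite /flat; case: ifPn => [x0|_]; last first.
  by rewrite normr0 mulr_ge0 ?sqr_ge0.
have t0 : 0 < x^-1 by rewrite invr_gt0.
rewrite ger0_norm; last by rewrite mulr_ge0 ?expR_ge0// exprn_ge0// ltW.
have h : x^-1 ^+ n.+2 <= n.+2`!%:R * expR x^-1.
  have F0 : 0 < n.+2`!%:R :> R by rewrite ltr0n fact_gt0.
  rewrite mulrC -ler_pdivrMr// (le_trans _ (expR_ge1Dxn n.+1 (ltW t0)))//.
  by rewrite lerDr.
rewrite expRN ler_pdivrMr ?expR_gt0//.
have -> : x^-1 ^+ n = x^-1 ^+ n.+2 * x ^+ 2.
  by rewrite -addn2 exprD -mulrA -exprMn mulVf ?gt_eqF// expr1n mulr1.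
by rewrite [leRHS]mulrAC ler_wpM2r// sqr_ge0.
Qed.

Let flat_derive0 n : is_derive (0 : R) 1 (flat n) 0.
Proof.
have c0 : h^-1 *: (flat n (h *: 1 + 0) - flat n 0) @[h --> 0^'] --> (0 : R).
  apply/cvgrPdist_lt => e e0.
  pose C : R := n.+2`!%:R.
  have C0 : 0 < C by rewrite /C ltr0n fact_gt0.
  near=> h.
  have h0 : h != 0 by near: h; exact: nbhs_dnbhs_neq.
  rewrite sub0r normrN [h *: 1]mulr1 addr0 {2}/flat ltxx subr0.
  rewrite /GRing.scale /= normrM normfV.
  apply: (@le_lt_trans _ _ (`|h|^-1 * (C * h ^+ 2))).
    by rewrite ler_wpM2l ?invr_ge0//; exact: flat_bound.
  have -> : `|h|^-1 * (C * h ^+ 2) = C * `|h|.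
    by rewrite -[h ^+ 2]real_normK ?num_real//; field; rewrite normr_eq0.
  rewrite mulrC -ltr_pdivlMr//; near: h.
  apply: dnbhs0_lt; exact: divr_gt0.
apply: DeriveDef; first by apply/cvg_ex; exists 0.
exact: (cvg_lim _ c0).
Unshelve. all: by end_near. Qed.

Let flat_derive n x : is_derive x 1 (flat n) (flat n.+2 x - n%:R * flat n.+1 x).
Proof.
have [x0|x0|->] := ltgtP x 0.
- apply: (near_eq_is_derive (f := fun=> 0)).
    near=> y; rewrite /flat ifF//; apply/negbTE; rewrite -leNgt ltW//.
    by near: y; exact: lt_nbhsl.
  rewrite /flat !ltNge (ltW x0) /= mulr0 subr0; exact: is_derive_cst.
- apply: (@near_eq_is_derive R R R (fun y : R => y^-1 ^+ n * expR (- y^-1)) (flat n)).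
    near=> y; rewrite /flat ifT//.
    by near: y; exact: lt_nbhsr.
  rewrite /flat x0.
  have dV : is_derive x 1 (fun y : R => y^-1) (- x ^- 2).
    have xn0 : x != 0 by rewrite gt_eqF.
    apply: DeriveDef; first exact: derivableV.
    by rewrite deriveV// derive_id /GRing.scale /= mulr1.
  have dN : is_derive x 1 (fun y : R => - y^-1) (x ^- 2).
    by have := is_deriveN dV; rewrite opprK.
  have dE := @is_derive1_comp _ expR (fun y => - y^-1) x _ _ (is_derive_expR _) dN.
  have dX := is_deriveX n dV.
  have := is_deriveM dX dE; rewrite !fctE => /is_derive_eq; apply.
  rewrite /GRing.scale /= -!exprVn.
  case: n {dX} => [|n]; first by rewrite !exprS expr0; ring.
  by rewrite /= !exprS; ring.
- rewrite /flat ltxx mulr0 subr0; exact: flat_derive0.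
Unshelve. all: by end_near. Qed.

Let flat_smooth m n : diff_times m (flat n).
Proof.
elim: m n => //= m IH n.
exists (fun x => flat n.+2 x + (- n%:R) * flat n.+1 x) => [x|].
  by rewrite mulNr; exact: flat_derive.
apply: diff_timesD; first exact: IH.
by apply: diff_timesM; [exact: diff_times_cst|exact: IH].
Qed.

Let flat_gt0 x : 0 < x -> 0 < flat 0 x.
Proof. by move=> x0; rewrite /flat x0 expr0 mul1r expR_gt0. Qed.

Let flat_eq0 x : x <= 0 -> flat 0 x = 0.
Proof. by move=> x0; rewrite /flat ltNge x0. Qed.

Let flat_ge0 x : 0 <= flat 0 x.
Proof. by have [/flat_eq0->|/flat_gt0/ltW] := leP x 0. Qed.

Let den_gt0 x : 0 < flat 0 x + flat 0 (- 1 * x + 1).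
Proof.
have [x0|x0] := ltP 0 x; first by rewrite ltr_wpDr ?flat_gt0.
by rewrite ltr_wpDl// flat_gt0//; lra.
Qed.

Definition smooth_step x : R := flat 0 x / (flat 0 x + flat 0 (- 1 * x + 1)).

Lemma smooth_step_smooth n : diff_times n smooth_step.
Proof.
apply: diff_timesM; first exact: flat_smooth.
apply: diff_timesV => [x|]; first by rewrite gt_eqF.
apply: diff_timesD; first exact: flat_smooth.
by apply: (@diff_times_affine _ (flat 0)); exact: flat_smooth.
Qed.

Lemma smooth_step0 x : x <= 0 -> smooth_step x = 0.
Proof. by move=> x0; rewrite /smooth_step flat_eq0// mul0r. Qed.

Lemma smooth_step1 x : 1 <= x -> smooth_step x = 1.
Proof.
move=> x1; rewrite /smooth_step (@flat_eq0 (_ + 1)); last by lra.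
by rewrite addr0 divff// gt_eqF// flat_gt0//; lra.
Qed.

Lemma smooth_step_itv x : 0 <= smooth_step x <= 1.
Proof.
have d0 := den_gt0 x; rewrite /smooth_step divr_ge0 ?flat_ge0 ?(ltW d0)//=.
by rewrite ler_pdivrMr// mul1r lerDl flat_ge0.
Qed.

End FlatFunction.

(** A plateau function supported on [[a, b]] that is [1] at distance at least
    [1 / k] from the complement; for large [k] it approximates the indicator
    function of the open interval. *)
Definition plateau a b k x : R :=
  smooth_step (k * x + - k * a) * smooth_step (- k * x + k * b).

Lemma plateau_smooth a b k n : diff_times n (plateau a b k).
Proof.
by apply: diff_timesM; apply: diff_times_affine; exact: smooth_step_smooth.
Qed.

Lemma plateau_itv a b k x : 0 <= plateau a b k x <= 1.
Proof.
have /andP[p0 p1] := smooth_step_itv (k * x + - k * a).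
have /andP[q0 q1] := smooth_step_itv (- k * x + k * b).
by rewrite /plateau mulr_ge0//= mulr_ile1.
Qed.

Lemma plateau0 a b k x : 0 < k -> (x <= a) || (b <= x) -> plateau a b k x = 0.
Proof.
move=> k0 /orP[xa|bx]; rewrite /plateau.
  by rewrite smooth_step0 ?mul0r//; nra.
by rewrite [X in _ * X]smooth_step0 ?mulr0//; nra.
Qed.

Lemma plateau1 a b k x : 1 <= k * (x - a) -> 1 <= k * (b - x) -> plateau a b k x = 1.
Proof. by move=> h1 h2; rewrite /plateau !smooth_step1 ?mulr1//; nra. Qed.

Lemma plateau_cvg a b x : (fun n => plateau a b n.+1%:R x) @ \oo -->
  (if (a < x) && (x < b) then 1 else 0 : R).
Proof.
case: ifPn => [/andP[ax xb]|]; last first.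
  rewrite negb_and -!leNgt => h; apply: cvg_near_cst; apply: nearW => n.
  by rewrite plateau0.
apply: cvg_near_cst; near=> n.
have n1 : (x - a)^-1 <= n.+1%:R.
  by rewrite (@le_trans _ _ n%:R) ?ler_nat//; near: n; exact: nbhs_infty_ger.
have n2 : (b - x)^-1 <= n.+1%:R.
  by rewrite (@le_trans _ _ n%:R) ?ler_nat//; near: n; exact: nbhs_infty_ger.
apply: plateau1.
- by rewrite -ler_pdivrMr ?subr_gt0// mul1r.
- by rewrite -ler_pdivrMr ?subr_gt0// mul1r.
Unshelve. all: by end_near. Qed.

End Smooth.

Section TestFunctions.
Context {R : realType}.
Implicit Types (f g : R -> R[i]).
Local Notation Re := complex.Re.
Local Notation Im := complex.Im.

Lemma test_functionM f g : test_function f -> test_function g ->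
  test_function (fun x => f x * g x).
Proof.
move=> [/rsmoothP fRe /rsmoothP fIm fK] [/rsmoothP gRe /rsmoothP gIm _]; split.
- apply/rsmoothP => n; under eq_fun do rewrite ReM -mulN1r mulrA.
  apply: diff_timesD; first exact: diff_timesM.
  by apply: diff_timesM => //; apply: diff_timesM => //; exact: diff_times_cst.
- apply/rsmoothP => n; under eq_fun do rewrite ImM.
  by apply: diff_timesD; exact: diff_timesM.
- apply: (subclosed_compact _ fK); first exact: closed_closure.
  apply: closureS => x /=; apply: contra_neq => ->; exact: mul0r.
Qed.

Lemma test_functionJ f : test_function f -> test_function (fun x => ((f x)^*)%R).
Proof.
move=> [fRe /rsmoothP fIm fK]; split.
- by under eq_fun do rewrite ReJ.
- apply/rsmoothP => n; under eq_fun do rewrite ImJ -mulN1r.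
  by apply: diff_timesM => //; exact: diff_times_cst.
- apply: (subclosed_compact _ fK); first exact: closed_closure.
  by apply: closureS => x /=; rewrite conjC_eq0.
Qed.

Lemma test_function_scale f (a : R) : a != 0 -> test_function f ->
  test_function (fun x => f (a * x)).
Proof.
move=> a0 [/rsmoothP fRe /rsmoothP fIm fK]; split.
- apply/rsmoothP => n.
  by have := diff_times_affine a 0 (fRe n); under eq_fun do rewrite addr0.
- apply/rsmoothP => n.
  by have := diff_times_affine a 0 (fIm n); under eq_fun do rewrite addr0.
- pose K := closure [set x | f x != 0].
  have cK : compact ((fun y => a^-1 * y) @` K).
    apply: continuous_compact fK; apply: continuous_subspaceT => x.
    by apply: cvgMl_tmp; exact: cvg_id.
  apply: (subclosed_compact _ cK); first exact: closed_closure.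
  have clK := compact_closed (@Rhausdorff R) cK.
  rewrite [X in _ `<=` X](closure_id _).1//; apply: closureS => x /= fax.
  by exists (a * x); [exact: subset_closure|rewrite mulKf].
Qed.

End TestFunctions.

(** * Functions determined by their integrals against test functions *)

Section FundamentalLemma.
Context {R : realType}.
Local Notation T := (@lebesgueTypeR R).
Local Notation mu := (@completed_lebesgue_measure R).
Local Notation Re := complex.Re.
Local Notation Im := complex.Im.
Implicit Types (a b c e : R) (h : R -> R[i]).

Lemma test_function_plateau a b k : 0 < k -> test_function (fun x => (plateau a b k x)%:C).
Proof.
move=> k0; split.
- by apply/rsmoothP => n; exact: plateau_smooth.
- by apply/rsmoothP => n; exact: diff_times_cst.
- apply: (subclosed_compact _ (@segment_compact _ a b)); first exact: closed_closure.
  rewrite [X in _ `<=` X](closure_id _).1; last exact: itv_closed.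
  apply: closureS => x /=; apply: contra_neqP => xab; rewrite plateau0//.
  move: xab; rewrite in_itv /= => /negP; rewrite negb_and -!ltNge.
  by case/orP => /ltW ->; rewrite ?orbT.
Qed.

Definition locally_cintegrable h :=
  cmeasurable h /\ forall a b, cintegrable (fun x => (\1_`[a, b] x)%:C * h x).

Section Local.
Variables (h : R -> R[i]) (e : R).
Hypotheses (lh : locally_cintegrable h) (e0 : 0 < e).
Hypothesis h0 : forall a b (f : R -> R[i]), b - a < e -> test_function f ->
  (forall x, f x != 0 -> a < x < b) -> cintegral (fun x => f x * h x) = 0.

Let ci (A : set R) a b : @measurable _ T A -> A `<=` `[a, b] ->
  cintegrable (fun x => (\1_A x)%:C * h x).
Proof.
move=> mA Aab; have [mh /(_ a b) hab] := lh.
apply: (cintegrable_le _ (cintegrable_cabs hab)).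
  by apply: cmeasurableM; [exact: cmeasurable_indic|exact: mh].
move=> x; rewrite !cabsM !cabs_real ler_wpM2r ?cabs_ge0// !indicE.
case: (boolP (x \in A)) => [xA|]; last by rewrite normr0.
by rewrite mem_set//; apply: Aab; exact: set_mem.
Qed.

Let integral_oo a b : b - a < e ->
  cintegral (fun x => (\1_`]a, b[ x)%:C * h x) = 0.
Proof.
move=> ab; have [mh hab] := lh.
have k0 n : 0 < n.+1%:R :> R by rewrite ltr0n.
have z n : cintegral (fun x => (plateau a b n.+1%:R x)%:C * h x) = 0.
  apply: (h0 ab (test_function_plateau a b (k0 n))) => x; apply: contra_neqT => xab.
  by rewrite plateau0//; move: xab; rewrite negb_and -!leNgt.
apply: (@cvg_unique_complex _ (fun n => cintegral (fun x => (plateau a b n.+1%:R x)%:C * h x))).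
  apply: (@dominated_cintegral _ _ _ (fun x => cabs ((\1_`[a, b] x)%:C * h x))).
  - move=> n; apply: cmeasurableM; last exact: mh.
    have [/rsmoothP sb _ _] := test_function_plateau a b (k0 n).
    apply: cmeasurable_real; apply: continuous_lebesgue_measurable => x.
    have [b' db _] := sb 1%N; have [dx _] := db x.
    exact/differentiable_continuous/derivable1_diffP.
  - apply: cmeasurableM; last exact: mh.
    by apply: cmeasurable_indic; exact: itv_lebesgue_measurable.
  - apply: aeW => x; under eq_fun do rewrite mulrC.
    rewrite mulrC; apply: cvg_complexZ; apply/cvg_ReImP; split => /=; last exact: cvg_cst.
    have := @plateau_cvg R a b x; rewrite indicE mem_setE in_itv /=.
    by case: (_ && _).
  - exact: cintegrable_cabs (hab a b).
  - move=> n x; rewrite !cabsM ler_wpM2r ?cabs_ge0// !cabs_real.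
    have /andP[p0 p1] := plateau_itv a b n.+1%:R x.
    rewrite ger0_norm// indicE mem_setE in_itv /=.
    have [_|] := boolP (a <= x <= b); first by rewrite normr1.
    rewrite negb_and -!ltNge => /orP xab; rewrite plateau0 ?normr0//.
    by case: xab => /ltW ->; rewrite ?orbT.
by under eq_fun do rewrite z; exact: (@cvg_cst R[i]^o).
Qed.

Let integral_co a b : b - a < e ->
  cintegral (fun x => (\1_`[a, b[ x)%:C * h x) = 0.
Proof.
move=> ab; rewrite -(integral_oo ab); have [mh _] := lh.
have mi (i : interval R) : cmeasurable (fun x => (\1_[set` i] x)%:C * h x).
  apply: cmeasurableM; last exact: mh.
  by apply: cmeasurable_indic; exact: itv_lebesgue_measurable.
apply: ae_eq_cintegral; [exact: mi|exact: mi|].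
apply: ae_mono (ae_notin [:: a]) => x; rewrite inE => xa.
by rewrite !indicE !mem_setE !in_itv /= [a < x]lt_neqAle (eq_sym a) xa.
Qed.

(** Intervals shorter than [e] are limits of plateau functions, and a Dynkin
    class argument passes from the intervals of a window to its measurable
    subsets. *)
Let ae_zero_window c : {ae mu, forall x, c <= x < c + e / 2 -> h x = 0}.
Proof.
pose W : set R := `[c, c + e / 2[%classic.
have mW : @measurable _ T W by exact: itv_lebesgue_measurable.
have Wsub : W `<=` `[c, c + e / 2].
  by rewrite /W => x /=; rewrite !in_itv /= => /andP[-> /ltW].
have e2 : c + e / 2 - c < e by rewrite addrC addKr; move: e0; lra.
have ciE E : @measurable _ T E -> cintegrable (fun x => (\1_(W `&` E) x)%:C * h x).
  move=> mE; apply: (ci (a := c) (b := c + e / 2)); first exact: measurableI.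
  by move=> x [/Wsub].
have PE E : @measurable _ T E -> cintegral (fun x => (\1_(W `&` E) x)%:C * h x) = 0.
  move: E; apply: (@lebesgue_dynkin_induction _
    (fun E => cintegral (fun x => (\1_(W `&` E) x)%:C * h x) = 0)).
  - by rewrite setIT; exact: integral_co.
  - move=> a; have [ac|ca] := leP a c.
      rewrite (_ : W `&` _ = W); first exact: integral_co.
      apply/seteqP; split => x; rewrite /W /= !in_itv /= andbT; first by case.
      by move=> /andP[cx ->]; rewrite cx (le_trans ac).
    rewrite (_ : W `&` _ = `[a, c + e / 2[%classic); last first.
      apply/seteqP; split => x; rewrite /W /= !in_itv /= andbT.
        by move=> [/andP[_ ->] ->].
      by move=> /andP[ax ->]; rewrite (le_trans (ltW ca)).
    by apply: integral_co; rewrite (le_lt_trans _ e2)// lerB// ltW.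
  - move=> E mE PE.
    have := cintegralD (ciE E mE) (ciE _ (measurableC mE)); rewrite PE add0r => <-.
    rewrite -[RHS](integral_co e2); apply: eq_cintegral => x; rewrite -mulrDl.
    rewrite -rmorphD /= !indicE !in_setI in_setC -/W.
    by case: (x \in W); case: (x \in E); rewrite /= ?addr0 ?add0r.
  - move=> F mF tF PF.
    have SE n x : \sum_(i <- iota 0 n) (\1_(W `&` F i) x)%:C * h x =
        (\sum_(i <- iota 0 n) \1_(F i) x)%:C * ((\1_W x)%:C * h x).
      rewrite -mulr_suml -rmorph_sum /= mulrA -rmorphM /= mulr_suml.
      by congr (_%:C * _); apply: eq_bigr => i _; rewrite indicI mulrC.
    have ciW : cintegrable (fun x => (\1_W x)%:C * h x).
      by have := ciE setT measurableT; rewrite setIT.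
    apply: (@cvg_unique_complex _ (fun n => cintegral (fun x =>
      \sum_(i <- iota 0 n) (\1_(W `&` F i) x)%:C * h x))).
      apply: (@dominated_cintegral _ _ _ (fun x => cabs ((\1_W x)%:C * h x))).
      + by move=> n; apply: cmeasurable_sum => i _; exact: cintegrable_measurable (ciE _ (mF i)).
      + by apply: cintegrable_measurable; apply: ciE; exact: bigcupT_measurable.
      + apply: aeW => x; under eq_fun do rewrite SE mulrC.
        rewrite indicI rmorphM /= mulrAC; apply: cvg_complexZ.
        apply/cvg_ReImP; split => /=; last exact: cvg_cst.
        exact: (@sum_indic_cvg R _ F x tF).
      + exact: cintegrable_cabs.
      + move=> n x; rewrite SE cabsM ler_piMl ?cabs_ge0// cabs_real.
        by case: (@sum_indic01 R _ F n x tF) => ->; rewrite ?normr0 ?normr1.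
    under eq_fun do rewrite (cintegral_sum _ (fun i _ => ciE _ (mF i))) big1 //.
    exact: (@cvg_cst R[i]^o).
  - move=> E N mE nN PE; rewrite -PE; apply: ae_eq_cintegral.
    + apply: cintegrable_measurable; apply: ciE; apply: measurableU => //.
      exact: negligible_measurable.
    + exact: cintegrable_measurable (ciE _ mE).
    + apply: negligibleS nN => x /= hx; apply: contrapT => Nx; apply: hx.
      congr (_%:C * _); rewrite !indicE !in_setI in_setU.
      by rewrite [x \in N]memNset// orbF.
have comp_zero (k : R -> R) : integrableR (fun x => \1_W x * k x) ->
    measurable_fun [set: T] k ->
    (forall E, @measurable _ T E -> \int[mu]_x (\1_(W `&` E) x * k x) = 0) ->
    {ae mu, forall x, W x -> k x = 0}.
  move=> ik mk kE.
  have ikW : mu.-integrable W (EFin \o k).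
    apply/(integrable_mkcond _ mW); move: ik; apply: eq_integrable => // x _.
    by rewrite /= patchE indicE; case: ifP => _; rewrite ?mul1r ?mul0r.
  have : ae_eq mu W (EFin \o k) (cst 0%E).
    apply: (@integral_ae_eq _ _ _ mu W mW (cst 0%E) (EFin \o k) ikW (measurable_cst _)).
    move=> E EW mE.
    rewrite [RHS]integral0 integral_mkcond.
    have ikE : integrableR (fun x => \1_(W `&` E) x * k x).
      apply: (integrableR_le _ (integrable_norm ik)).
        apply: measurable_funM; last exact: mk.
        by apply: measurable_indic; exact: measurableI.
      move=> x /=; rewrite !normrM ler_wpM2r// indicI normrM ler_piMr//.
      by rewrite indicE; case: (x \in E); rewrite ?normr1 ?normr0.
    have := kE E mE; rewrite /Rintegral => /eqP.
    rewrite fine_eq0; last exact: integrable_fin_num.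
    move=> /eqP <-; apply: eq_integral => x _ /=.
    rewrite patchE indicI /= !indicE; case: ifPn => xE; last by rewrite mulr0 mul0r.
    by rewrite (mem_set (EW _ (set_mem xE))) !mul1r.
  by apply: ae_mono => x /= hx Wx; have [] := hx Wx.
have iW := ciE setT measurableT; rewrite setIT in iW.
Local Transparent cintegral cmeasurable.
have [mh _] := lh; have [mRe mIm] := mh.
have zRe : {ae mu, forall x, W x -> Re (h x) = 0}.
  apply: comp_zero => //.
    case: iW => + _; congr (integrableR _); apply/funext => x.
    by rewrite ReM /= mul0r subr0.
  move=> E mE; have := congr1 (@complex.Re R) (PE E mE) => /= <-.
  by apply: eq_Rintegral => x _; rewrite ReM /= mul0r subr0.
have zIm : {ae mu, forall x, W x -> Im (h x) = 0}.
  apply: comp_zero => //.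
    case: iW => _; congr (integrableR _); apply/funext => x.
    by rewrite ImM /= mul0r addr0.
  move=> E mE; have := congr1 (@complex.Im R) (PE E mE) => /= <-.
  by apply: eq_Rintegral => x _; rewrite ImM /= mul0r addr0.
Local Opaque cintegral cmeasurable.
apply: ae_mono (ae_and zRe zIm) => x [hRe hIm] xW.
have Wx : W x by rewrite /W /= in_itv.
by apply: complexP; [exact: hRe|exact: hIm].
Qed.

(** The window is smaller than the admissible size of a support, and countably
    many translates of it cover the line. *)
Lemma ae_zero_of_local_integrals : {ae mu, forall x, h x = 0}.
Proof.
have e2 : 0 < e / 2 by rewrite divr_gt0.
pose N (k : nat) := ~` [set x | k%:R * (e / 2) <= x < k%:R * (e / 2) + e / 2 -> h x = 0].
pose N' (k : nat) := ~` [set x | - k.+1%:R * (e / 2) <= x < - k.+1%:R * (e / 2) + e / 2 -> h x = 0].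
have nN : mu.-negligible (\bigcup_k (N k `|` N' k)).
  by apply: negligible_bigcup => k; apply: negligibleU; exact: ae_zero_window.
apply: negligibleS nN => x /= hx.
have := floor_itv (x / (e / 2)); set m := Num.floor _.
rewrite ler_pdivlMr// ltr_pdivrMr// rmorphD /= mulrDl mul1r => /andP[mx xm].
case: m mx xm => k mx xm; exists k => //; [left|right] => /= xh; apply: hx; apply: xh.
  by apply/andP; split; [exact: mx|exact: xm].
move: mx xm; rewrite NegzE rmorphN /= => mx xm.
by apply/andP; split; [exact: mx|exact: xm].
Qed.

End Local.
End FundamentalLemma.

(** * Levels of a frame expansion *)

Lemma real_complexM (R : realType) (a b : R) : (a * b)%:C = a%:C * b%:C :> R[i].
Proof. exact: rmorphM. Qed.

Section Levels.
Context {R : realType} (d : R) (n : nat).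
Hypothesis d0 : d != 0.
Implicit Types (f g : R -> R[i]) (eta etat : 'I_n -> R -> R[i]) (b M B : R) (j m : int).

Definition level j eta etat f g : R[i] :=
  \sum_(l < n) csumZ (frame_term d j (eta l) (etat l) f g).

(** The kernel against which a level integrates [f x * conj (g (x + b))], up to
    dilation. *)
Definition gram eta etat b (x : R) : R[i] :=
  \sum_(l < n) ((eta l x)^*)%R * etat l (x + b).

Lemma cintegrable_shifted f g M B (eta etat : R -> R[i]) (lam b : R) : lam != 0 ->
  bcs f M B -> bcs g M B -> L2loc eta -> L2loc etat ->
  cintegrable (fun x => f x * ((g (x + b))^*)%R *
    (((eta (lam * x))^*)%R * etat (lam * x + lam * b))).
Proof.
move=> l0 bf bg le let'.
have lV0 : lam^-1 != 0 by rewrite invr_eq0.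
have sF := sqint_affine 0 l0 (sqint_bcs_L2loc (bcs_affine lV0 bf) (L2locJ le)).
have sG := sqint_affine (lam * b) l0
  (sqintJ (sqint_bcs_L2loc (bcs_affine lV0 bg) (L2locJ let'))).
have := cintegrableM sF sG; congr (cintegrable _); apply/funext => x.
rewrite addr0 mulKf// -mulrDr mulKf// rmorphM /= conjCK.
by rewrite mulrACA.
Qed.

Lemma cintegrable_shifted_gram f g M B eta etat (lam b c : R) : lam != 0 ->
  bcs f M B -> bcs g M B -> (forall l, L2loc (eta l)) -> (forall l, L2loc (etat l)) ->
  c = lam * b ->
  cintegrable (fun x => f x * ((g (x + b))^*)%R * gram eta etat c (lam * x)).
Proof.
move=> l0 bf bg le let' ->; rewrite /gram.
under eq_fun do rewrite mulr_sumr.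
by apply: cintegrable_sum => l _; exact: cintegrable_shifted l0 bf bg (le l) (let' l).
Qed.

Lemma shifted_eq0 h f g b M B : bcs f M B -> bcs g M B -> 2 * M < `|b| ->
  shifted h f g b = 0.
Proof.
move=> [_ _ fM] [_ _ gM] Mb; rewrite /shifted -[RHS]cintegral0.
apply: eq_cintegral => x; have [xM|/fM->] := leP `|x| M; last by rewrite !mul0r.
rewrite gM ?conjC0 ?mulr0 ?mul0r//.
have := ler_normB (x + b) x; rewrite addrAC subrr add0r => h1; lra.
Qed.

(** The bounds for the number of relevant shifts are taken uniform over the
    finitely many generators. *)
Lemma level_gram j eta etat f g M B : bcs f M B -> bcs g M B ->
  (forall l, L2loc (eta l)) -> (forall l, L2loc (etat l)) ->
  exists K0, forall K, (K0 <= K)%N -> level j eta etat f g = (2 * pi)%:C *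
    psumZ (fun k => shifted (fun x => gram eta etat (2 * pi * k%:~R) (d ^ (- j) * x))
      f g (2 * pi * d ^ j * k%:~R)) K.
Proof.
move=> bf bg le let'.
have lam0 : d ^ (- j) != 0 by rewrite expfz_neq0.
have /choice[K0 K0P] l := (frame_level j d0 bf bg (le l) (let' l)).2.
exists (\max_(l < n) K0 l)%N => K KK.
rewrite /level; under eq_bigr => l _ do
  rewrite (K0P l _ (leq_trans (leq_bigmax _) KK)) psumZ_zseq.
rewrite -mulr_sumr exchange_big psumZ_zseq; congr (_ * _); apply: eq_bigr => k _ /=.
rewrite /shifted -cintegral_sum => [|l _].
  by apply: eq_cintegral => x; rewrite /gram mulr_sumr.
have := cintegrable_shifted (2 * pi * d ^ j * k%:~R) lam0 bf bg (le l) (let' l).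
congr (cintegrable _); apply/funext => x; congr (_ * (_ * etat l (_ + _))).
by rewrite mulrCA -invr_expz; field; rewrite expfz_neq0.
Qed.

Lemma frame_term_scale j m (eta etat : R -> R[i]) f g k :
  test_function f -> test_function g -> L2loc eta -> L2loc etat ->
  frame_term d (j + m) eta etat f g k = (`|d ^ m|)%:C *
    frame_term d j eta etat (fun x => f (d ^ m * x)) (fun x => g (d ^ m * x)) k.
Proof.
move=> tf tg le let'.
have m0 : d ^ m != 0 by rewrite expfz_neq0.
have [M [B [bf bg]]] := test_function_bcs2 tf tg.
have bfm := bcs_affine m0 bf; have bgm := bcs_affine m0 bg.
rewrite (frame_termE _ _ d0 bf bg le let') (frame_termE _ _ d0 bfm bgm le let').
have E (h z : R -> R[i]) : (fun x => h (d ^ (j + m) * x) * ((z x)^*)%R) =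
    (fun x => h (d ^ m * (d ^ j * x)) * ((z x)^*)%R).
  by apply/funext => x; rewrite addrC (expfzDr _ _ d0) mulrA.
have En : (`|d ^ (j + m)|)%:C = (`|d ^ m|)%:C * (`|d ^ j|)%:C :> R[i].
  by rewrite -real_complexM -normrM addrC (expfzDr _ _ d0).
by rewrite (E f) (E g) En -mulrA; reflexivity.
Qed.

Lemma level_scale j m eta etat f g :
  test_function f -> test_function g ->
  (forall l, L2loc (eta l)) -> (forall l, L2loc (etat l)) ->
  level (j + m) eta etat f g = (`|d ^ m|)%:C *
    level j eta etat (fun x => f (d ^ m * x)) (fun x => g (d ^ m * x)).
Proof.
move=> tf tg le let'.
have m0 : d ^ m != 0 by rewrite expfz_neq0.
have [M [B [bf bg]]] := test_function_bcs2 tf tg.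
rewrite /level mulr_sumr; apply: eq_bigr => l _.
have [us _] := frame_level j d0 (bcs_affine m0 bf) (bcs_affine m0 bg) (le l) (let' l).
rewrite -(csumZZ _ us); congr csumZ; apply/funext => k.
exact: frame_term_scale tf tg (le l) (let' l).
Qed.

End Levels.

Section PairingScale.
Context {R : realType}.
Implicit Types (f g : R -> R[i]).

Lemma bcs_sqint f M B : bcs f M B -> sqint f.
Proof.
move=> [mf fB fM]; pose K : set R := `[- M, M]%classic.
have mK : @measurable _ (@lebesgueTypeR R) K by exact: itv_lebesgue_measurable.
have := sqint_mul_bounded mf fB (sqint_indic mK (@subset_refl _ _)).
congr (sqint _); apply/funext => x; rewrite indicE.
have [xM|/fM->] := leP `|x| M; last by rewrite mul0r.
by rewrite mem_set ?mulr1// /K /= in_itv /= -ler_norml.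
Qed.

Lemma test_function_pairing f g : test_function f -> test_function g ->
  cintegrable (fun x => f x * ((g x)^*)%R).
Proof.
move=> /test_function_bcs[M [B /bcs_sqint sf]] /test_function_bcs[N [C /bcs_sqint sg]].
exact: cintegrable_pairing.
Qed.

Lemma pairing_scale (a : R) f g : a != 0 -> test_function f -> test_function g ->
  pairing (fun x => f (a * x)) (fun x => g (a * x)) = (`|a|^-1)%:C * pairing f g.
Proof.
move=> a0 tf tg; have := affine_cintegral 0 a0 (test_function_pairing tf tg).
by move=> <-; apply: eq_cintegral => x; rewrite addr0.
Qed.

End PairingScale.

(** * Passing from one scale to another *)

Section Scales.
Context {R : realType} (d : R) (r s : nat).
Variables (phi : 'I_r -> R -> R[i]) (psi : 'I_s -> R -> R[i]).
Variables (phit : 'I_r -> R -> R[i]) (psit : 'I_s -> R -> R[i]).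
Hypothesis hd : 1 < `|d|.
Hypotheses (hphi : forall l, L2loc (phi l)) (hpsi : forall l, L2loc (psi l)).
Hypotheses (hphit : forall l, L2loc (phit l)) (hpsit : forall l, L2loc (psit l)).
Implicit Types (f g : R -> R[i]) (J j m : int) (n : nat).

Let d0 : d != 0. Proof. by rewrite -normr_gt0 (lt_trans _ hd). Qed.

Local Notation frames := (dual_wavelet_frames d phi psi phit psit).

Lemma frame_summable j (eta etat : R -> R[i]) f g : L2loc eta -> L2loc etat ->
  test_function f -> test_function g -> abs_summable (frame_term d j eta etat f g).
Proof.
move=> le let' tf tg; have [M [B [bf bg]]] := test_function_bcs2 tf tg.
exact: (frame_level j d0 bf bg le let').1.
Qed.

Let frame_partial_sumE J f g n : frame_partial_sum d phi psi phit psit J f g n =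
  level d J phi phit f g + \sum_(i < n) level d (J + i%:Z) psi psit f g.
Proof. by []. Qed.

Local Opaque level.

Lemma frame_partial_sum_scale J m f g n : test_function f -> test_function g ->
  frame_partial_sum d phi psi phit psit (J + m) f g n = (`|d ^ m|)%:C *
  frame_partial_sum d phi psi phit psit J
    (fun x => f (d ^ m * x)) (fun x => g (d ^ m * x)) n.
Proof.
move=> tf tg; rewrite !frame_partial_sumE mulrDr.
have -> := level_scale d0 J m tf tg hphi hphit; congr (_ + _).
rewrite mulr_sumr; apply: eq_bigr => i _; rewrite addrAC.
exact: (level_scale d0 (J + i%:Z) m tf tg hpsi hpsit).
Qed.

(** The frame property at the scale [J + m] for a pair of test functions is the
    one at the scale [J] for their dilates. *)
Lemma frames_any_scale J J' : frames J -> frames J'.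
Proof.
move=> fJ f g tf tg; split.
- by move=> l; exact: frame_summable.
- by move=> j l _; exact: frame_summable.
have -> : J' = J + (J' - J) by rewrite addrC subrK.
set m := J' - J; have m0 : d ^ m != 0 by rewrite expfz_neq0.
have tfm := test_function_scale m0 tf; have tgm := test_function_scale m0 tg.
have [_ _] := fJ _ _ tfm tgm; rewrite (pairing_scale m0 tf tg).
move=> /(@cvg_complexZ _ _ (`|d ^ m|)%:C).
have -> : (`|d ^ m|)%:C * ((2 * pi)%:C * ((`|d ^ m|^-1)%:C * pairing f g)) =
    (2 * pi)%:C * pairing f g.
  rewrite mulrCA; congr (_ * _); rewrite mulrA -real_complexM divff ?mul1r//.
  by rewrite normr_eq0.
by under eq_fun do rewrite -(frame_partial_sum_scale J m _ tf tg).
Qed.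

Definition refinement_identity := forall f g, test_function f -> test_function g ->
  level d 0 phi phit f g + level d 0 psi psit f g = level d 1 phi phit f g.

Definition approximation_identity := forall f g, test_function f -> test_function g ->
  (fun n => level d n%:Z phi phit f g : R[i]^o) @ \oo -->
    ((2 * pi)%:C * pairing f g : R[i]^o).

Lemma refinement_partial_sum f g n : refinement_identity ->
  test_function f -> test_function g ->
  frame_partial_sum d phi psi phit psit 0 f g n = level d n%:Z phi phit f g.
Proof.
move=> E tf tg; rewrite frame_partial_sumE; elim: n => [|n IH].
  by rewrite big_ord0 addr0.
rewrite big_ord_recr addrA IH /= add0r.
have n0 : d ^ n%:Z != 0 by rewrite expfz_neq0.
have e0 := level_scale d0 0 n%:Z tf tg hphi hphit.
have e1 := level_scale d0 0 n%:Z tf tg hpsi hpsit.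
have e2 := level_scale d0 1 n%:Z tf tg hphi hphit.
rewrite add0r in e0 e1; have e3 : 1 + n%:Z = n.+1%:Z by rewrite -addn1 PoszD addrC.
rewrite e3 in e2.
have scaled (c x y z a b e : R[i]) : a = c * x -> b = c * y -> e = c * z ->
  x + y = z -> a + b = e by move=> -> -> -> <-; rewrite mulrDr.
exact: scaled e0 e1 e2 (E _ _ (test_function_scale n0 tf) (test_function_scale n0 tg)).
Qed.

(** The expansion started at [0] differs from the one started at [1] by the
    first level, which must therefore refine the scaling part at [0] into the
    scaling part at [1]; the partial sums then telescope. *)
Lemma framesP J : frames J <-> refinement_identity /\ approximation_identity.
Proof.
split=> [fJ|[E L]]; last first.
  apply: (@frames_any_scale 0) => f g tf tg; split.
  - by move=> l; exact: frame_summable.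
  - by move=> j l _; exact: frame_summable.
  under eq_fun do rewrite (refinement_partial_sum _ E tf tg); exact: L.
have f0 := frames_any_scale 0 fJ; have f1 := frames_any_scale 1 fJ.
have E : refinement_identity.
  move=> f g tf tg; have [_ _ l0] := f0 _ _ tf tg; have [_ _ l1] := f1 _ _ tf tg.
  have step n : frame_partial_sum d phi psi phit psit 0 f g n.+1 =
      (level d 0 phi phit f g + level d 0 psi psit f g - level d 1 phi phit f g) +
      frame_partial_sum d phi psi phit psit 1 f g n.
    have tele (a b c u v : R[i]) : u = v -> a + (b + u) = (a + b - c) + (c + v).
      by move=> ->; rewrite addrA [RHS]addrA subrK.
    rewrite !frame_partial_sumE big_ord_recl; apply: tele.
    by apply: eq_bigr => i _; congr (level d _ psi psit f g).
  move: l0; rewrite -(@cvg_shiftS R[i]^o); under eq_fun do rewrite step.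
  set c := _ - _ => l0; apply/eqP; rewrite -subr_eq0 -/c.
  have l1c := @cvg_complexD _ _ _ _ _ (@cvg_cst R[i]^o c _ _ _) l1.
  have lE := cvg_unique_complex l0 (l1c _).
  by apply/eqP; apply: (addIr ((2 * pi)%:C * pairing f g)); rewrite -lE add0r.
split=> // f g tf tg; have [_ _ l0] := f0 _ _ tf tg.
by move: l0; under eq_fun do rewrite (refinement_partial_sum _ E tf tg).
Qed.

End Scales.

(** * The limit of the coarse levels *)

Lemma cvg_near_scale (R : realType) (a b : nat -> R[i]) (c z : R[i]) : c != 0 ->
  (\forall n \near \oo, a n = c * b n) ->
  (a : nat -> R[i]^o) @ \oo --> (c * z : R[i]^o) <->
  (b : nat -> R[i]^o) @ \oo --> (z : R[i]^o).
Proof.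
move=> c0 ab; split => h.
  have -> : z = c^-1 * (c * z) by rewrite mulKf.
  apply: cvg_trans (@cvg_complexZ _ _ c^-1 _ h); apply: near_eq_cvg; near=> n.
  by rewrite (near ab n)// mulKf.
apply: cvg_trans (@cvg_complexZ _ _ c _ h); apply: near_eq_cvg; near=> n.
by rewrite (near ab n).
Unshelve. all: by end_near.
Qed.

Lemma twopi_complex_neq0 (R : realType) : (2 * pi)%:C != 0 :> R[i].
Proof.
by apply/eqP => /(congr1 (@complex.Re R)) /= pi2; have := @pi_gt0 R; lra.
Qed.

Section Approximation.
Context {R : realType} (d : R) (r : nat).
Variables (phi phit : 'I_r -> R -> R[i]).
Hypothesis hd : 1 < `|d|.
Hypotheses (hphi : forall l, L2loc (phi l)) (hphit : forall l, L2loc (phit l)).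
Implicit Types (f g : R -> R[i]) (n : nat).

Let d0 : d != 0. Proof. by rewrite -normr_gt0 (lt_trans _ hd). Qed.

Lemma expr_norm_large (C : R) : exists N, forall n, (N <= n)%N -> C < `|d| ^+ n.
Proof.
have dV : `| `|d|^-1 | < 1.
  by rewrite ger0_norm ?invr_ge0// invf_lt1// (lt_trans _ hd).
have /cvgrPdist_lt h := cvg_expr dV.
have C1 : 0 < `|C| + 1 by rewrite ltr_wpDl.
have C0 : 0 < (`|C| + 1)^-1 by rewrite invr_gt0.
have [N _ hN] := h _ C0; exists N => n Nn.
have p0 : 0 < `|d| ^+ n by rewrite exprn_gt0// (lt_trans _ hd).
have := hN n Nn; rewrite sub0r normrN exprVn ger0_norm ?invr_ge0 ?(ltW p0)//.
rewrite (ltf_pV2 p0 C1).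
by apply: le_lt_trans; rewrite (le_trans (ler_norm C))// lerDl.
Qed.

(** At a coarse level the shifts other than zero move the support of [g] off
    the support of [f]. *)
Lemma level_large f g : test_function f -> test_function g ->
  exists N, forall n, (N <= n)%N -> level d n%:Z phi phit f g =
    (2 * pi)%:C * pairing (fun x => \sum_(l < r)
        ((phi l (d ^ (- n%:Z) * x))^*)%R * phit l (d ^ (- n%:Z) * x))
      (fun x => ((f x)^*)%R * g x).
Proof.
move=> tf tg; have [M [B [bf bg]]] := test_function_bcs2 tf tg.
have [N hN] := expr_norm_large M; exists N => n /hN Mn.
have [K0 hK] := level_gram d0 n%:Z bf bg hphi hphit.
rewrite (hK K0.+1 (leqnSn _)) psumZ_zseq; congr (_ * _).
rewrite (bigD1_seq 0) ?uniq_zseq ?mem_zseq//= big_seq_cond big1 => [|k /andP[_ k0]].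
  rewrite addr0 /shifted !mulr0; apply: eq_cintegral => x.
  rewrite addr0 /gram rmorphM /= conjCK mulrC; congr (_ * _).
  by apply: eq_bigr => l _; rewrite addr0.
apply: (shifted_eq0 _ bf bg).
have k1 : 1 <= `|k%:~R| :> R by rewrite -intr_norm (ler_int R 1) -gtz0_ge1 normr_gt0.
rewrite !normrM ger0_norm// ger0_norm ?pi_ge0// -exprnP normrX -!mulrA ltr_pM2l//.
have p1 : 1 <= pi :> R by have := @pi_ge2 R; lra.
have p0 : 0 < `|d| ^+ n by rewrite exprn_gt0// (lt_trans _ hd).
apply: lt_le_trans Mn _; rewrite mulrCA ler_peMr ?(ltW p0)//.
by rewrite -[leLHS]mulr1 ler_pM.
Qed.

(** The pair [(f, g)] enters the coarse levels through [conj f * g], and a test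
    function [h] is such a product, with [f] the conjugate of [h] and [g] a
    plateau function equal to [1] on the support of [h]. *)
Lemma approximation_identityP : approximation_identity d phi phit <->
  distr_cvg (fun (n : nat) (x : R) => \sum_(l < r)
      ((phi l (d ^ (- n%:Z) * x))^*)%R * phit l (d ^ (- n%:Z) * x)) (fun=> 1).
Proof.
have pi0 := twopi_complex_neq0 R.
have near_cvg f g (h : R -> R[i]) : test_function f -> test_function g ->
    (forall x, ((f x)^*)%R * g x = h x) ->
  (fun n => level d n%:Z phi phit f g : R[i]^o) @ \oo -->
    ((2 * pi)%:C * pairing f g : R[i]^o) <->
  (fun n => pairing (fun x => \sum_(l < r)
      ((phi l (d ^ (- n%:Z) * x))^*)%R * phit l (d ^ (- n%:Z) * x)) h : R[i]^o) @ \oo -->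
    (pairing (fun=> 1) h : R[i]^o).
  move=> tf tg /funext <-; have [N hN] := level_large tf tg.
  have -> : pairing (fun=> 1) (fun x => ((f x)^*)%R * g x) = pairing f g.
    by apply: eq_cintegral => x; rewrite mul1r rmorphM /= conjCK.
  set P := fun n : nat => pairing (fun x => \sum_(l < r) _) _.
  have levelE : \forall n \near \oo, level d n%:Z phi phit f g = (2 * pi)%:C * P n.
    by exists N.
  exact: cvg_near_scale pi0 levelE.
split=> [L h th|D f g tf tg]; last first.
  have th := test_functionM (test_functionJ tf) tg.
  by apply/(near_cvg f g _ tf tg (fun=> erefl)); exact: D.
have [M [B [mh hB hM]]] := test_function_bcs th.
have tb := test_function_plateau (- M - 1) (M + 1) (@ltr01 R).
apply: (near_cvg _ _ h (test_functionJ th) tb _).1; last exact: L (test_functionJ th) tb.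
move=> x; rewrite conjCK; have [xM|/hM->] := leP `|x| M; last by rewrite mul0r.
move: xM; rewrite ler_norml => /andP[x1 x2].
by rewrite plateau1 ?mulr1//; lra.
Qed.

End Approximation.

(** * The refinement identity, one shift at a time *)

Section Lattices.
Context {R : realType}.

Lemma int_gap (x : R) : exists2 e, 0 < e &
  forall k : int, k%:~R != x -> e <= `|k%:~R - x|.
Proof.
have := floor_itv x; set m := Num.floor x => /andP[mx xm].
have mS : (m + 1)%:~R = m%:~R + 1 :> R by rewrite rmorphD.
rewrite mS in xm.
pose e := if m%:~R == x then 1 else Num.min (x - m%:~R) (m%:~R + 1 - x).
have e0 : 0 < e.
  rewrite /e; case: ifPn => // mx'; rewrite lt_min !subr_gt0 xm andbT.
  by rewrite lt_neqAle mx'.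
exists e => // k kx; have [km|mk] := leP k m.
  have km' : k%:~R <= m%:~R :> R by rewrite ler_int.
  rewrite ler0_norm ?subr_le0 ?(le_trans km')// opprB /e; case: ifPn => [/eqP mE|_].
    have : k + 1 <= m by rewrite lezD1 lt_neqAle km andbT -(eqr_int R) mE.
    by rewrite -(ler_int R) rmorphD /= mE; move: (x) => y; lra.
  by rewrite ge_min lerB.
have mk' : m%:~R + 1 <= k%:~R :> R by rewrite -mS ler_int lezD1.
rewrite ger0_norm ?subr_ge0 ?(le_trans (ltW xm))// /e; case: ifPn => [/eqP mE|_].
  by move: mk'; rewrite mE; lra.
by rewrite ge_min; apply/orP; right; rewrite lerD2r.
Qed.

Lemma lattice_gap (c x : R) : c != 0 -> exists2 e, 0 < e &
  forall k : int, c * k%:~R != x -> e <= `|c * k%:~R - x|.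
Proof.
move=> c0; have [e e0 he] := int_gap (x / c).
exists (`|c| * e) => [|k kx]; first by rewrite mulr_gt0 ?normr_gt0.
have -> : c * k%:~R - x = c * (k%:~R - x / c) by field.
rewrite normrM ler_wpM2l//; apply: he; apply: contraNneq kx => ->.
by apply/eqP; field.
Qed.

(** Sums over several lattices are compared over a common finite set of reals. *)
Lemma sum_lattice (V : nmodType) (F : seq R) (c : R) (u : R -> V) K :
  uniq F -> c != 0 -> (forall k, k \in zseq K -> c * k%:~R \in F) ->
  (forall k : int, `|c| * K%:R <= `|c * k%:~R| -> u (c * k%:~R) = 0) ->
  \sum_(k <- zseq K) u (c * k%:~R) =
  \sum_(t <- F) (if `[< exists k : int, c * k%:~R = t >] then u t else 0).
Proof.
move=> uF c0 cF u0; pose s := [seq c * k%:~R | k <- zseq K].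
have us : uniq s.
  rewrite map_inj_uniq ?uniq_zseq// => j k /(mulfI c0) /eqP.
  by rewrite eqr_int => /eqP.
rewrite -(big_map (fun k : int => c * k%:~R) predT u) -/s.
have -> : \sum_(t <- F) (if `[< exists k : int, c * k%:~R = t >] then u t else 0) =
    \sum_(t <- F | t \in s) u t.
  rewrite [RHS]big_mkcond; apply: eq_bigr => t _.
  case: (boolP (t \in s)) => [/mapP[k _ ->]|ts]; first by rewrite asboolT//; exists k.
  case: asboolP => // -[k kt]; rewrite -kt u0// normrM ler_wpM2l//.
  rewrite -intr_norm (ler_int R K%:Z) leNgt; apply: contra ts => kK.
  rewrite -kt; apply/mapP; exists k => //; rewrite mem_zseq.
  by move: kK; rewrite ltr_norml => /andP[/ltW -> ->].
rewrite -[RHS]big_filter; apply: perm_big; apply: uniq_perm => //.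
  exact: filter_uniq.
move=> t; rewrite mem_filter; case: (boolP (t \in s)) => //= /mapP[k kK ->].
by rewrite cF.
Qed.

End Lattices.

Section Refinement.
Context {R : realType} (d : R) (r s : nat).
Variables (phi : 'I_r -> R -> R[i]) (psi : 'I_s -> R -> R[i]).
Variables (phit : 'I_r -> R -> R[i]) (psit : 'I_s -> R -> R[i]).
Hypothesis hd : 1 < `|d|.
Hypotheses (hphi : forall l, L2loc (phi l)) (hpsi : forall l, L2loc (psi l)).
Hypotheses (hphit : forall l, L2loc (phit l)) (hpsit : forall l, L2loc (psit l)).
Local Notation mu := (@completed_lebesgue_measure R).
Implicit Types (f g h : R -> R[i]) (t : R) (M B : R).

Let d0 : d != 0. Proof. by rewrite -normr_gt0 (lt_trans _ hd). Qed.
Let dV0 : d^-1 != 0. Proof. by rewrite invr_eq0. Qed.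

(** The kernels are indexed by all real numbers [t], and are zero when [t] is
    not a shift of the level, so that the shifts of the two levels, which overlap
    in a way that depends on the arithmetic of [d], can be summed together. *)
Definition fine_kernel t (x : R) : R[i] :=
  if `[< setZ t >] then gram phi phit (2 * pi * t) x + gram psi psit (2 * pi * t) x else 0.

Definition coarse_kernel t (x : R) : R[i] :=
  if `[< dsetZ d t >] then gram phi phit (d^-1 * (2 * pi * t)) (d^-1 * x) else 0.

Definition refinement_kernel t x := fine_kernel t x - coarse_kernel t x.

Let cintegrable_fine f g M B t : bcs f M B -> bcs g M B ->
  cintegrable (fun x => f x * ((g (x + 2 * pi * t))^*)%R * gram phi phit (2 * pi * t) x) /\
  cintegrable (fun x => f x * ((g (x + 2 * pi * t))^*)%R * gram psi psit (2 * pi * t) x).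
Proof.
move=> bf bg; have c1 : 2 * pi * t = 1 * (2 * pi * t) by rewrite mul1r.
split.
  have := cintegrable_shifted_gram (oner_neq0 R) bf bg hphi hphit c1.
  by under eq_fun do rewrite mul1r.
have := cintegrable_shifted_gram (oner_neq0 R) bf bg hpsi hpsit c1.
by under eq_fun do rewrite mul1r.
Qed.

Let cintegrable_coarse f g M B t : bcs f M B -> bcs g M B ->
  cintegrable (fun x => f x * ((g (x + 2 * pi * t))^*)%R *
    gram phi phit (d^-1 * (2 * pi * t)) (d^-1 * x)).
Proof. by move=> bf bg; exact: cintegrable_shifted_gram dV0 bf bg hphi hphit erefl. Qed.

Let shifted_kernel f g M B t : bcs f M B -> bcs g M B ->
  shifted (refinement_kernel t) f g (2 * pi * t) =
  (if `[< setZ t >] then shifted (gram phi phit (2 * pi * t)) f g (2 * pi * t) else 0) +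
  (if `[< setZ t >] then shifted (gram psi psit (2 * pi * t)) f g (2 * pi * t) else 0) -
  (if `[< dsetZ d t >] then shifted (fun x =>
     gram phi phit (d^-1 * (2 * pi * t)) (d^-1 * x)) f g (2 * pi * t) else 0).
Proof.
move=> bf bg; have [i1 i2] := cintegrable_fine t bf bg.
have i3 := cintegrable_coarse t bf bg.
rewrite /shifted /refinement_kernel /fine_kernel /coarse_kernel.
case: `[< setZ t >]; case: `[< dsetZ d t >].
- rewrite -(cintegralD i1 i2) -mulN1r -(cintegralZ _ i3).
  rewrite -(cintegralD (cintegrableD i1 i2) (cintegrableZ _ i3)).
  by apply: eq_cintegral => x; ring.
- rewrite subr0 -(cintegralD i1 i2).
  by apply: eq_cintegral => x; ring.
- rewrite addr0 add0r -mulN1r -(cintegralZ _ i3).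
  by apply: eq_cintegral => x; ring.
- rewrite addr0 subr0 -[RHS]cintegral0.
  by apply: eq_cintegral => x; ring.
Qed.

Definition shifts K : seq R :=
  undup ([seq 1 * k%:~R | k <- zseq K] ++ [seq d * k%:~R | k <- zseq K]).

(** The defect of the refinement identity is a finite sum of integrals against
    kernels, one for each real number that is a shift of the levels 0 or 1; the
    kernel of a shift that occurs on both levels is a difference. *)
Lemma refinement_defect f g M B : bcs f M B -> bcs g M B ->
  exists K0, forall K, (K0 <= K)%N ->
    level d 0 phi phit f g + level d 0 psi psit f g - level d 1 phi phit f g =
    (2 * pi)%:C * \sum_(t <- shifts K) shifted (refinement_kernel t) f g (2 * pi * t).
Proof.
move=> bf bg.
have [K1 h1] := level_gram d0 0 bf bg hphi hphit.
have [K2 h2] := level_gram d0 0 bf bg hpsi hpsit.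
have [K3 h3] := level_gram d0 1 bf bg hphi hphit.
pose K4 := (Num.truncn M).+1.
exists (maxn (maxn K1 K2) (maxn K3 K4)) => K; rewrite !geq_max.
move=> /andP[/andP[k1 k2] /andP[k3 k4]].
have far (c : R) (k : int) (h : R -> R[i]) : 1 <= `|c| -> `|c| * K%:R <= `|c * k%:~R| ->
    shifted h f g (2 * pi * (c * k%:~R)) = 0.
  move=> c1 ck; apply: (shifted_eq0 _ bf bg).
  rewrite normrM ger0_norm ?mulr_ge0 ?pi_ge0// -mulrA ltr_pM2l//.
  have MK : M < K%:R.
    by rewrite (lt_le_trans (truncnS_gt M))// ler_nat.
  have p1 : 1 <= pi :> R by have := @pi_ge2 R; lra.
  rewrite (lt_le_trans MK)// (le_trans _ (ler_wpM2l (pi_ge0 R) ck))//.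
  by rewrite mulrA ler_peMl// -[leLHS]mulr1 ler_pM.
have uF : uniq (shifts K) by exact: undup_uniq.
have oneZ t : (exists k : int, 1 * k%:~R = t) <-> setZ t.
  by split=> [[k <-]|[k _ <-]]; [exists k; rewrite ?mul1r|exists k; rewrite ?mul1r].
have dZ t : (exists k : int, d * k%:~R = t) <-> dsetZ d t.
  by split=> [[k <-]|[_ [k _ <-] <-]]; [exists k%:~R => //; exists k|exists k].
have in1 k : k \in zseq K -> 1 * k%:~R \in shifts K.
  by move=> kK; rewrite mem_undup mem_cat; apply/orP; left; exact: map_f.
have ind k : k \in zseq K -> d * k%:~R \in shifts K.
  by move=> kK; rewrite mem_undup mem_cat; apply/orP; right; exact: map_f.
have fineE n (eta etat : 'I_n -> R -> R[i]) : psumZ (fun k : int =>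
      shifted (fun x => gram eta etat (2 * pi * k%:~R) (d ^ (- 0) * x))
        f g (2 * pi * d ^ 0 * k%:~R)) K =
    \sum_(t <- shifts K) if `[< setZ t >] then
      shifted (gram eta etat (2 * pi * t)) f g (2 * pi * t) else 0.
  pose u t := shifted (gram eta etat (2 * pi * t)) f g (2 * pi * t).
  rewrite psumZ_zseq (eq_bigr (fun k : int => u (1 * k%:~R))) => [|k _].
    rewrite (sum_lattice uF (oner_neq0 R) in1) => [|k ck]; last first.
      by apply: far ck; rewrite normr1.
    by apply: eq_bigr => t _; rewrite (asbool_equiv_eq (oneZ t)).
  rewrite /u mul1r oppr0 expr0z mulr1; apply: eq_cintegral => x.
  by rewrite mul1r.
have coarseE : psumZ (fun k : int =>
      shifted (fun x => gram phi phit (2 * pi * k%:~R) (d ^ (- 1) * x))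
        f g (2 * pi * d ^ 1 * k%:~R)) K =
    \sum_(t <- shifts K) if `[< dsetZ d t >] then
      shifted (fun x => gram phi phit (d^-1 * (2 * pi * t)) (d^-1 * x)) f g (2 * pi * t)
      else 0.
  pose u t := shifted (fun x =>
    gram phi phit (d^-1 * (2 * pi * t)) (d^-1 * x)) f g (2 * pi * t).
  rewrite psumZ_zseq (eq_bigr (fun k : int => u (d * k%:~R))) => [|k _].
    rewrite (sum_lattice uF d0 ind) => [|k ck]; last first.
      by apply: far ck; exact: ltW.
    by apply: eq_bigr => t _; rewrite (asbool_equiv_eq (dZ t)).
  have e1 : 2 * pi * d ^ 1 * k%:~R = 2 * pi * (d * k%:~R) by rewrite expr1z mulrA.
  have e2 : 2 * pi * k%:~R = d^-1 * (2 * pi * (d * k%:~R)) by field.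
  by rewrite /u e1 -e2 exprN1.
rewrite (h1 K k1) (h2 K k2) (h3 K k3) !fineE coarseE -mulrDr -mulrBr; congr (_ * _).
rewrite -big_split -sumrB /=; apply: eq_bigr => t _.
by rewrite (shifted_kernel t bf bg).
Qed.

Lemma refinement_of_kernel :
  (forall t, {ae mu, forall x, refinement_kernel t x = 0}) ->
  refinement_identity d phi psi phit psit.
Proof.
move=> k0 f g tf tg; have [M [B [bf bg]]] := test_function_bcs2 tf tg.
have [K /(_ K (leqnn K)) h] := refinement_defect bf bg.
apply/eqP; rewrite -subr_eq0 h big1 ?mulr0// => t _.
rewrite -[RHS]cintegral0; apply: ae_eq_cintegral; last first.
- by apply: ae_mono (k0 t) => x ->; rewrite mulr0.
- exact: cmeasurable_cst.
have [i1 i2] := cintegrable_fine t bf bg; have i3 := cintegrable_coarse t bf bg.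
rewrite /refinement_kernel /fine_kernel /coarse_kernel.
have -> : (fun x => f x * ((g (x + 2 * pi * t))^*)%R *
   ((if `[< setZ t >] then gram phi phit (2 * pi * t) x + gram psi psit (2 * pi * t) x
     else 0) - (if `[< dsetZ d t >] then gram phi phit (d^-1 * (2 * pi * t)) (d^-1 * x)
     else 0))) = (fun x =>
   (if `[< setZ t >] then 1 else 0) *
     (f x * ((g (x + 2 * pi * t))^*)%R * gram phi phit (2 * pi * t) x +
      f x * ((g (x + 2 * pi * t))^*)%R * gram psi psit (2 * pi * t) x) +
   (if `[< dsetZ d t >] then -1 else 0) *
     (f x * ((g (x + 2 * pi * t))^*)%R *
      gram phi phit (d^-1 * (2 * pi * t)) (d^-1 * x))).
  by apply/funext => x; case: `[< setZ t >]; case: `[< dsetZ d t >]; ring.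
apply: cintegrable_measurable; apply: cintegrableD; apply: cintegrableZ => //.
exact: cintegrableD.
Qed.

End Refinement.

(** * Localisation of the refinement identity *)

Section Localisation.
Context {R : realType}.
Implicit Types (h : R -> R[i]) (a b c : R).

Lemma locally_cintegrableD h1 h2 : locally_cintegrable h1 -> locally_cintegrable h2 ->
  locally_cintegrable (fun x => h1 x + h2 x).
Proof.
move=> [m1 i1] [m2 i2]; split; first exact: cmeasurableD.
by move=> a b; under eq_fun do rewrite mulrDr; exact: cintegrableD.
Qed.

Lemma locally_cintegrableN h : locally_cintegrable h ->
  locally_cintegrable (fun x => - h x).
Proof.
move=> [m1 i1]; split.
  under eq_fun do rewrite -mulN1r; apply: cmeasurableM => //; exact: cmeasurable_cst.
move=> a b; under eq_fun do rewrite mulrN -mulN1r; exact: cintegrableZ.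
Qed.

Lemma locally_cintegrable0 : locally_cintegrable (fun _ : R => 0).
Proof.
split; first exact: cmeasurable_cst.
by move=> a b; under eq_fun do rewrite mulr0; exact: cintegrable0.
Qed.

Lemma bcs_indic a b M : `[a, b] `<=` `[- M, M] -> bcs (fun x => (\1_`[a, b] x)%:C) M 1.
Proof.
move=> abM; split.
- by apply: cmeasurable_indic; exact: itv_lebesgue_measurable.
- by move=> x; rewrite cabs_real indicE; case: (_ \in _); rewrite ?normr1 ?normr0.
- move=> x Mx; rewrite indicE memNset// => /abM /=.
  by rewrite in_itv /= -ler_norml leNgt Mx.
Qed.

Lemma locally_cintegrable_gram n (eta etat : 'I_n -> R -> R[i]) c lam : lam != 0 ->
  (forall l, L2loc (eta l)) -> (forall l, L2loc (etat l)) ->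
  locally_cintegrable (fun x => gram eta etat c (lam * x)).
Proof.
move=> l0 le let'; split.
  rewrite /gram; apply: cmeasurable_sum => l _; apply: cmeasurableM.
    have := cmeasurable_affine 0 l0 (le l).1.
    by under eq_fun do rewrite addr0; exact: cmeasurableJ.
  exact: cmeasurable_affine (let' l).1.
move=> a b; pose M := `|a| + `|b|; pose N := M + `|c / lam|.
have abM : `[a, b] `<=` `[- M, M].
  move=> x; rewrite /= !in_itv /= => /andP[ax xb]; rewrite /M.
  have := ler_norm b; have := ler_norm (- a); have := normr_ge0 b; have := normr_ge0 a.
  by rewrite normrN => h1 h2 h3 h4; apply/andP; split; lra.
have MN : M <= N by rewrite /N lerDl.
have abN : `[a, b] `<=` `[- N, N].
  by move=> x /abM; rewrite /= !in_itv /= -!ler_norml => /le_trans; exact.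
have bf := bcs_indic abN; have bg := bcs_indic (@subset_refl _ `[- N, N]).
have cE : c = lam * (c / lam) by field.
have := cintegrable_shifted_gram l0 bf bg le let' cE.
congr (cintegrable _); apply/funext => x; congr (_ * _).
rewrite [\1_`[a, b] x]indicE; case: (boolP (x \in _)) => [/set_mem /abM|]; last by rewrite mul0r.
rewrite /= in_itv /= -ler_norml => xM.
rewrite indicE mem_set; first by rewrite conjC1 mulr1.
rewrite /= in_itv /= -ler_norml (le_trans (ler_normD _ _))// lerD//.
Qed.

End Localisation.

Section Kernel.
Context {R : realType} (d : R) (r s : nat).
Variables (phi : 'I_r -> R -> R[i]) (psi : 'I_s -> R -> R[i]).
Variables (phit : 'I_r -> R -> R[i]) (psit : 'I_s -> R -> R[i]).
Hypothesis hd : 1 < `|d|.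
Hypotheses (hphi : forall l, L2loc (phi l)) (hpsi : forall l, L2loc (psi l)).
Hypotheses (hphit : forall l, L2loc (phit l)) (hpsit : forall l, L2loc (psit l)).
Local Notation mu := (@completed_lebesgue_measure R).
Local Notation kernel := (refinement_kernel d phi psi phit psit).
Implicit Types (f g h : R -> R[i]) (t : R) (M B : R).

Let d0 : d != 0. Proof. by rewrite -normr_gt0 (lt_trans _ hd). Qed.

Lemma locally_cintegrable_kernel t : locally_cintegrable (kernel t).
Proof.
have dV0 : d^-1 != 0 by rewrite invr_eq0.
have fineL n (eta etat : 'I_n -> R -> R[i]) : (forall l, L2loc (eta l)) ->
    (forall l, L2loc (etat l)) -> locally_cintegrable (gram eta etat (2 * pi * t)).
  move=> le let'; have := locally_cintegrable_gram (2 * pi * t) (oner_neq0 R) le let'.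
  by under eq_fun do rewrite mul1r.
rewrite /refinement_kernel; apply: locally_cintegrableD; last apply: locally_cintegrableN.
  rewrite /fine_kernel; case: `[< _ >]; last exact: locally_cintegrable0.
  exact: locally_cintegrableD (fineL _ _ _ hphi hphit) (fineL _ _ _ hpsi hpsit).
rewrite /coarse_kernel; case: `[< _ >]; last exact: locally_cintegrable0.
exact: locally_cintegrable_gram.
Qed.

(** Test functions with small supports, the second one being close to the
    translate of the first one by [2 * pi * t], see the kernel of the shift [t]
    only, because the shifts of the two levels near [t] are isolated. *)
Lemma kernel_of_refinement : refinement_identity d phi psi phit psit ->
  forall t, {ae mu, forall x, kernel t x = 0}.
Proof.
move=> E t.
(* A real number that is not a shift has a zero kernel by definition. *)
have [tF|tF] := pselect (exists K0, forall K, (K0 <= K)%N -> t \in shifts d K); last first.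
  apply: aeW => x; rewrite /refinement_kernel /fine_kernel /coarse_kernel.
  rewrite asboolF; last first.
    move=> [k _ kt]; apply: tF; exists `|k|.+1 => K kK; rewrite /shifts mem_undup mem_cat.
    apply/orP; left; apply/mapP; exists k; rewrite ?mul1r ?kt//.
    by rewrite mem_zseq; lia.
  rewrite asboolF; last first.
    move=> [_ [k _ <-] kt]; apply: tF; exists `|k|.+1 => K kK; rewrite /shifts mem_undup mem_cat.
    apply/orP; right; apply/mapP; exists k; rewrite ?kt//.
    by rewrite mem_zseq; lia.
  by rewrite subr0.
have [e1 e10 he1] := lattice_gap t (oner_neq0 R).
have [e2 e20 he2] := lattice_gap t d0.
pose e := Num.min e1 e2; have e0 : 0 < e by rewrite lt_min e10.
have he u K : u \in shifts d K -> u != t -> e <= `|u - t|.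
  rewrite /shifts mem_undup mem_cat => /orP[] /mapP[k _ ->] kt; rewrite /e ge_min.
    by rewrite he1.
  by rewrite he2// orbT.
have pe0 : 0 < pi * e :> R by rewrite mulr_gt0 ?pi_gt0.
apply: (ae_zero_of_local_integrals (locally_cintegrable_kernel t) pe0) => a b f ab tf fab.
(* [g] is [1] on the translate of the support of [f], and its support exceeds that
   translate by the margin [w], which is small compared with the distance
   [2 * pi * e] between shifts. *)
pose q := 2 / (pi * e); have q0 : 0 < q by rewrite divr_gt0.
pose w := pi * e / 2.
pose g x : R[i] := (plateau (a + 2 * pi * t - w) (b + 2 * pi * t + w) q x)%:C.
have tg : test_function g by exact: test_function_plateau.
have qw : q * w = 1 by rewrite /q /w mulf_div [X in _ / X]mulrC divff// mulf_neq0// lt0r_neq0.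
have g1 x : a < x < b -> g (x + 2 * pi * t) = 1.
  move=> /andP[ax xb]; rewrite /g plateau1//.
    by rewrite -[leLHS]qw ler_pM2l//; lra.
  by rewrite -[leLHS]qw ler_pM2l//; lra.
have [M [B [bf bg]]] := test_function_bcs2 tf tg.
have [K0 hK0] := refinement_defect hd hphi hpsi hphit hpsit bf bg.
have [K1 hK1] := tF; have := hK0 _ (leq_maxl K0 K1); have := hK1 _ (leq_maxr K0 K1).
move: (maxn K0 K1) => K tK; rewrite (E _ _ tf tg) subrr.
rewrite (bigD1_seq t) ?undup_uniq//= big_seq_cond big1 => [|u /andP[uK ut]].
  rewrite addr0 => /esym/eqP; rewrite mulf_eq0 (negPf (twopi_complex_neq0 R)) => /eqP.
  rewrite /shifted => <-; apply: eq_cintegral => x.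
  have [->|/fab xab] := eqVneq (f x) 0; first by rewrite !mul0r.
  by rewrite (g1 _ xab) conjC1 mulr1.
rewrite /shifted -[RHS]cintegral0; apply: eq_cintegral => x.
have [->|/fab /andP[ax xb]] := eqVneq (f x) 0; first by rewrite !mul0r.
suff -> : g (x + 2 * pi * u) = 0 by rewrite conjC0 mulr0 mul0r.
have /(ler_wpM2l (pi_ge0 R)) := he _ _ uK ut.
have [ut'|ut'] := leP t u.
  rewrite ger0_norm ?subr_ge0// => h; rewrite /g plateau0//; apply/orP; right.
  by rewrite /w; lra.
rewrite ltr0_norm ?subr_lt0// => h; rewrite /g plateau0//; apply/orP; left.
by rewrite /w; lra.
Qed.

End Kernel.

(** * The equations for the generators *)

Lemma ae_dilate (R : realType) (a : R) (P : R -> Prop) : a != 0 ->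
  {ae @completed_lebesgue_measure R, forall x, P x} ->
  {ae @completed_lebesgue_measure R, forall x, P (a * x)}.
Proof.
move=> a0 hP; apply: negligibleS (affine_negligible 0 a0 hP) => x /=.
by rewrite addr0.
Qed.

Section KernelEquations.
Context {R : realType} (d : R) (r s : nat).
Variables (phi : 'I_r -> R -> R[i]) (psi : 'I_s -> R -> R[i]).
Variables (phit : 'I_r -> R -> R[i]) (psit : 'I_s -> R -> R[i]).
Hypothesis d0 : d != 0.
Local Notation mu := (@completed_lebesgue_measure R).

(** The three families of equations are the vanishing of the kernel for the
    shifts of both levels, of the fine level only and of the coarse level only. *)
Lemma refinement_kernelP :
  (forall t, {ae mu, forall x, refinement_kernel d phi psi phit psit t x = 0}) <->
  [/\ forall k : R, (setZ `&` dsetZ d) k ->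
        {ae mu, forall xi : R,
          \sum_(l < r) ((phi l xi)^*)%R * phit l (xi + 2 * pi * k)
          + \sum_(l < s) ((psi l xi)^*)%R * psit l (xi + 2 * pi * k)
          = \sum_(l < r) ((phi l (d^-1 * xi))^*)%R
                         * phit l (d^-1 * (xi + 2 * pi * k))},
      forall k : R, (setZ `\` dsetZ d) k ->
        {ae mu, forall xi : R,
          \sum_(l < r) ((phi l xi)^*)%R * phit l (xi + 2 * pi * k)
          + \sum_(l < s) ((psi l xi)^*)%R * psit l (xi + 2 * pi * k) = 0} &
      forall k : R, (dsetZ d `\` setZ) k ->
        {ae mu, forall xi : R,
          \sum_(l < r) ((phi l xi)^*)%R * phit l (xi + 2 * pi * d^-1 * k) = 0}].
Proof.
have coarseE k x : \sum_(l < r) ((phi l (d^-1 * x))^*)%R * phit l (d^-1 * (x + 2 * pi * k)) =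
    gram phi phit (d^-1 * (2 * pi * k)) (d^-1 * x).
  by apply: eq_bigr => l _; rewrite mulrDr.
have dilateE k x : \sum_(l < r) ((phi l x)^*)%R * phit l (x + 2 * pi * d^-1 * k) =
    gram phi phit (d^-1 * (2 * pi * k)) (d^-1 * (d * x)).
  by rewrite mulKf// (_ : d^-1 * (2 * pi * k) = 2 * pi * d^-1 * k)//; ring.
rewrite /refinement_kernel /fine_kernel /coarse_kernel; split=> [h|[hb hf hc] t].
  split=> k [k1 k2]; have := h k.
  - rewrite asboolT// asboolT//; apply: ae_mono => x /eqP; rewrite subr_eq0 => /eqP.
    by rewrite coarseE.
  - rewrite asboolT// asboolF//; apply: ae_mono => x; by rewrite subr0.
  - rewrite asboolF// asboolT// => /(ae_dilate d0); apply: ae_mono => x /eqP.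
    by rewrite add0r oppr_eq0 dilateE => /eqP.
case: (asboolP (setZ t)) => [z|z]; case: (asboolP (dsetZ d t)) => [dz|dz].
- by apply: ae_mono (hb t (conj z dz)) => x; rewrite coarseE => <-; rewrite subrr.
- by apply: ae_mono (hf t (conj z dz)) => x hx; rewrite subr0.
- have dV0 : d^-1 != 0 by rewrite invr_eq0.
  apply: ae_mono (ae_dilate dV0 (hc t (conj dz z))) => x.
  by rewrite dilateE mulVKf// => ->; rewrite subr0.
- by apply: aeW => x; rewrite subr0.
Qed.

End KernelEquations.

Theorem theorem6 (R : realType) (d : R) (hd : 1 < `|d|) (r s : nat)
    (phi : 'I_r -> R -> R[i]) (psi : 'I_s -> R -> R[i])
    (phit : 'I_r -> R -> R[i]) (psit : 'I_s -> R -> R[i])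
    (hphi : forall l, L2loc (phi l)) (hpsi : forall l, L2loc (psi l))
    (hphit : forall l, L2loc (phit l)) (hpsit : forall l, L2loc (psit l)) :
  let conditions :=
    [/\ distr_cvg
          (fun (j : nat) (xi : R) =>
             \sum_(l < r) (phi l (d ^ (- j%:Z) * xi))^*
                          * phit l (d ^ (- j%:Z) * xi))
          (fun _ : R => 1),
        forall k : R, (setZ `&` dsetZ d) k ->
          {ae @completed_lebesgue_measure R, forall xi : R,
            \sum_(l < r) (phi l xi)^* * phit l (xi + 2 * pi * k)
            + \sum_(l < s) (psi l xi)^* * psit l (xi + 2 * pi * k)
            = \sum_(l < r) (phi l (d^-1 * xi))^*
                           * phit l (d^-1 * (xi + 2 * pi * k))},
        forall k : R, (setZ `\` dsetZ d) k ->
          {ae @completed_lebesgue_measure R, forall xi : R,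
            \sum_(l < r) (phi l xi)^* * phit l (xi + 2 * pi * k)
            + \sum_(l < s) (psi l xi)^* * psit l (xi + 2 * pi * k) = 0} &
        forall k : R, (dsetZ d `\` setZ) k ->
          {ae @completed_lebesgue_measure R, forall xi : R,
            \sum_(l < r) (phi l xi)^* * phit l (xi + 2 * pi * d^-1 * k) = 0}]
  in
  ((exists J : int, dual_wavelet_frames d phi psi phit psit J) <-> conditions)
  /\
  ((forall J : int, dual_wavelet_frames d phi psi phit psit J) <-> conditions).
Proof.
move=> conditions.
have d0 : d != 0 by rewrite -normr_gt0 (lt_trans _ hd).
have frames_cond J : dual_wavelet_frames d phi psi phit psit J <-> conditions.
  apply: (iff_trans (framesP hd hphi hpsi hphit hpsit J)).
  have kP : refinement_identity d phi psi phit psit <->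
      forall t, {ae @completed_lebesgue_measure R,
        forall x, refinement_kernel d phi psi phit psit t x = 0}.
    split; first exact: (kernel_of_refinement hd hphi hpsi hphit hpsit).
    exact: (refinement_of_kernel hd hphi hpsi hphit hpsit).
  have aP := approximation_identityP hd hphi hphit.
  have rP := refinement_kernelP phi psi phit psit d0.
  split=> [[/kP/rP[c2 c3 c4] /aP c1]|[c1 c2 c3 c4]]; first by split.
  by split; [apply/kP/rP; split|exact/aP].
split; split.
- by move=> [J /frames_cond].
- by move=> c; exists 0; exact/frames_cond.
- by move=> /(_ 0) /frames_cond.
- by move=> c J; exact/frames_cond.
Qed.
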